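(* A graph $G$ belongs to $\mathcal{U}_3$ if and only if either $G\in\mathcal{W}_3$, or $G$ is isomorphic to an extended prism with extension pattern $$(\underbrace{3,\dots,3}_{h-1},\,2,\,\underbrace{1,\dots,1}_{k-h})$$ for some integers $k\ge 3$ and $1\le h\le k$.
   Context: In a bridgeless cubic graph, an edge is lonely if it belongs to exactly one perfect matching; $l(G)$ is the number of lonely edges. $\mathcal{U}$ is the class of 3-connected cubic graphs having at least one lonely edge, and $\mathcal{U}_k=\{G\in\mathcal{U}: l(G)=k\}$. Replacing a vertex $x$ of a cubic graph by a triangle means deleting $x$, adding three new mutually adjacent vertices, and joining each of them to a distinct neighbour of $x$; a descendant of $G$ is any graph obtained from $G$ by a nonempty sequence of such replacements. The tricorn is the 10-vertex graph obtained from $K_4$ by replacing three of its vertices by triangles. The prism $Pr$ is the 6-vertex cubic graph consisting of two vertex-disjoint triangles $T_u$ and $T_v$ together with a perfect matching of three edges between them. Label the vertices of $T_v$ as $x_1,x_2,x_3$. For $s\in\{1,2,3\}$, a $T_v$-extension of index $s$ replaces $x_s$ by a new triangle $y_1y_2y_3$ in which, for each $j\ne s$, $y_j$ is joined to $x_j$, and $y_s$ is joined to the neighbour of $x_s$ outside $T_v$; afterwards the new triangle becomes $T_v$ and its vertices are renamed $x_i:=y_i$. An extended prism with extension pattern $(s_1,\dots,s_m)$ is the graph obtained from $Pr$ by applying successively $T_v$-extensions of indices $s_1,\dots,s_m$. $\mathcal{W}_3$ is the set consisting of the tricorn, all descendants of the tricorn that belong to $\mathcal{U}_3$, and the extended prism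 with extension pattern $(3,1,3)$. *)

(* Defs.v *)
From mathcomp Require Import all_boot.
Set Implicit Arguments. Unset Strict Implicit. Unset Printing Implicit Defensive.

Record graph := Graph { gV : finType; gE : rel gV }.
Arguments gE : clear implicits.

Section Basic.
Variable G : graph.
Local Notation V := (gV G).
Local Notation e := (gE G).

Definition simple_graph : Prop :=
  (forall u v, e u v = e v u) /\ (forall u, e u u = false).

Definition cubic : Prop := forall u : V, #|[pred v | e u v]| = 3.

Definition three_connected : Prop :=
  3 < #|V| /\
  forall X : {set V}, #|X| <= 2 ->
    forall u v, u \notin X -> v \notin X ->
      connect (fun a b => [&& a \notin X, b \notin X & e a b]) u v.

Definition is_edge (A : {set V}) : bool :=
  [exists u, exists v, e u v && (A == [set u; v])].

Definition perfect_matching (M : {set {set V}}) : bool :=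
  [forall A in M, is_edge A] && [forall v, #|[set A in M | v \in A]| == 1].

Definition lonely (A : {set V}) : bool :=
  is_edge A && (#|[set M : {set {set V}} | perfect_matching M && (A \in M)]| == 1).

Definition lonely_count : nat := #|[set A : {set V} | lonely A]|.

End Basic.

Definition in_U (G : graph) : Prop :=
  [/\ simple_graph G, cubic G, three_connected G & 1 <= lonely_count G].

Definition in_Uk (k : nat) (G : graph) : Prop := in_U G /\ lonely_count G = k.

Definition iso (G H : graph) : Prop :=
  exists f : gV G -> gV H, bijective f /\ forall u v, gE H (f u) (f v) = gE G u v.

(* Replacing vertex x of G by a triangle; nb i is the old neighbour of x to
   which the new triangle vertex i is joined. *)
Definition rep_V (G : graph) (x : gV G) : finType :=
  ({v : gV G | v != x} + 'I_3)%type.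

Definition rep_E (G : graph) (x : gV G) (nb : 'I_3 -> gV G) : rel (rep_V x) :=
  fun a b =>
    match a, b with
    | inl u, inl v => gE G (val u) (val v)
    | inr i, inr j => i != j
    | inl u, inr j => val u == nb j
    | inr i, inl v => val v == nb i
    end.

Definition replace_tri (G : graph) (x : gV G) (nb : 'I_3 -> gV G) : graph :=
  @Graph (rep_V x) (rep_E nb).

Definition tri_step (G H : graph) : Prop :=
  exists (x : gV G) (nb : 'I_3 -> gV G),
    injective nb /\ (forall v, gE G x v <-> exists i, nb i = v) /\
    iso H (replace_tri x nb).

Inductive descendant (G : graph) : graph -> Prop :=
| desc1 H : tri_step G H -> descendant G H
| descS H K : descendant G H -> tri_step H K -> descendant G K.

Definition K4 : graph := @Graph 'I_4 (fun i j => i != j).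

(* The tricorn: K4 on {0, a, b, c} with a, b, c replaced by the triangles
   {1,2,3}, {4,5,6}, {7,8,9}. *)
Definition tricorn_edges : seq (nat * nat) :=
  [:: (1,2); (2,3); (1,3); (4,5); (5,6); (4,6); (7,8); (8,9); (7,9);
      (0,1); (0,4); (0,7); (2,5); (3,8); (6,9)].

Definition tricorn : graph :=
  @Graph 'I_10 (fun i j => ((i : nat, j : nat) \in tricorn_edges)
                          || ((j : nat, i : nat) \in tricorn_edges)).

(* Graphs with a labelled triangle T_v = (x_1, x_2, x_3); label i : 'I_3
   stands for x_(i+1). *)
Record lgraph := LGraph { lgr : graph; lab : 'I_3 -> gV lgr }.

(* The prism: T_u = {0,1,2}, T_v = {3,4,5}, matching i -- i+3. *)
Definition prism : graph :=
  @Graph 'I_6 (fun i j => (i != j) && (((i < 3) == (j < 3)) || (i %% 3 == j %% 3))).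

Definition prism_l : lgraph := @LGraph prism (fun i => @inord 5 (i + 3)).

(* attachment function of a T_v-extension of index s, where w is the
   neighbour of x_s outside T_v *)
Definition ext_nb (L : lgraph) (s : 'I_3) (w : gV (lgr L)) : 'I_3 -> gV (lgr L) :=
  fun j => if j == s then w else lab L j.

Inductive is_ext_prism : seq 'I_3 -> lgraph -> Prop :=
| EP0 : is_ext_prism [::] prism_l
| EPS p L s w :
    is_ext_prism p L ->
    gE (lgr L) (lab L s) w -> (forall j, w != lab L j) ->
    is_ext_prism (rcons p s)
      (@LGraph (replace_tri (lab L s) (ext_nb s w)) (fun j => inr j)).

(* 1-based extension index s in {1,2,3} to 'I_3 *)
Definition idx (s : nat) : 'I_3 := inord s.-1.

Definition ext_prism_iso (p : seq nat) (G : graph) : Prop :=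
  exists L, is_ext_prism (map idx p) L /\ iso G (lgr L).

Definition in_W3 (G : graph) : Prop :=
  iso G tricorn \/ (descendant tricorn G /\ in_Uk 3 G) \/ ext_prism_iso [:: 3; 1; 3] G.

(* Main.v *)
Require Import Defs.
From mathcomp Require Import all_boot zify.
Set Implicit Arguments. Unset Strict Implicit. Unset Printing Implicit Defensive.

(** If uv is lonely, then G - u - v has a unique perfect matching, hence by
    Kotzig's theorem a bridge belonging to that matching. Cutting along such
    bridges, a minimal odd 3-edge-cut yields a triangle containing an edge of
    the matching, and contracting this triangle keeps the graph 3-connected
    with a lonely edge. So every graph of U arises from K4 by replacing vertices
    by triangles; it is K4, an extended prism, the tricorn or a descendant of
    the tricorn, according to the shape of the tree of its 3-edge-cuts.

    For an extended prism, the perfect matchings are classified by their trace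
    on the three edges leaving T_v: state k if only the edge at x_k is used,
    state 0 if all three are. Let v_k be the number of lonely edges whose
    perfect matching has state k (no lonely edge has state 0). The prism has
    v = (2,2,2), and a T_v-extension of index s replaces v_s by v_s - 1
    (truncated) and exchanges the other two values. Hence the number of lonely
    edges is a function of the pattern, and it is 3 exactly for the patterns
    a..abc..c of length at least 3 and aba, up to renaming the indices. *)

(** * Perfect matchings as partner functions *)

(** A perfect matching is an involution sending each vertex to a neighbour, so that switching along
    a cycle and lifting through a replaced vertex become formulas for functions; lonely edges are
    counted as ordered pairs, whence the doublings. Connectivity is handled by edge cuts of size at
    least 3, equivalent to 3-connectivity for cubic graphs, because cuts pull back along the
    contraction of a triangle. Replacement becomes a relation [tri_at], stable under isomorphism, so
    that replacements at different vertices can be interchanged; a replacement in T_u then puts a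
    letter in front of the pattern.

    The law for v rests on a splitting v_k = t_k + o_k, where t_k counts the edge of T_v opposite
    x_k and o_k the edges off T_v, both 0 or 1 and t_k at most o_k. After an extension at s, the new
    state s merges the old states s and 0, and an edge off T_v from the old state s also occurs in
    the new state 0: all these cease to be lonely. Only the edge of T_v opposite x_s can survive, as
    an edge off the new triangle. So o_s is replaced by t_s and t_s by 0. *)

Definition pmf (G : graph) (p : {ffun gV G -> gV G}) : bool :=
  [forall v, gE G v (p v) && (p (p v) == v)].

Definition plonely (G : graph) (u v : gV G) : bool :=
  #|[set p : {ffun gV G -> gV G} | pmf p && (p u == v)]| == 1.

Section PM.
Variable G : graph.
Hypothesis sG : simple_graph G.
Local Notation V := (gV G).
Local Notation e := (gE G).

Lemma edge_sym u v : e u v = e v u. Proof. by case: sG. Qed.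
Lemma edge_irr u : e u u = false. Proof. by case: sG. Qed.
Lemma edge_neq u v : e u v -> u != v.
Proof. by apply: contraTneq => ->; rewrite edge_irr. Qed.

Lemma pmfP (p : {ffun V -> V}) :
  reflect ((forall v, e v (p v)) /\ (forall v, p (p v) = v)) (pmf p).
Proof.
apply: (iffP forallP) => [H|[H1 H2] v]; last by rewrite H1 H2 eqxx.
by split=> v; case/andP: (H v) => // _ /eqP.
Qed.

Implicit Types (p q : {ffun V -> V}) (M : {set {set V}}) (A : {set V}) (u v : V).

Lemma pmf_edge p v : pmf p -> e v (p v). Proof. by case/pmfP. Qed.
Lemma pmfK p v : pmf p -> p (p v) = v. Proof. by case/pmfP. Qed.

Lemma set2_eq (u v w : V) : u != v -> [set u; v] = [set u; w] -> v = w.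
Proof.
move=> uv /setP /(_ v); rewrite !inE eqxx orbT => /esym /orP[/eqP E|/eqP //].
by rewrite E eqxx in uv.
Qed.

Definition pm_set (p : {ffun V -> V}) : {set {set V}} := [set [set v; p v] | v in V].

Lemma mem_pm_set p u v : pmf p -> e u v -> ([set u; v] \in pm_set p) = (p u == v).
Proof.
move=> pp euv; apply/imsetP/eqP => [[w _ E]|<-]; last by exists u.
have /setP /(_ u) := E; rewrite !inE eqxx => /esym/orP[/eqP Ew|/eqP Ew].
  by subst w; apply/esym/set2_eq; last exact: E; apply: edge_neq.
have pu : p u = w by rewrite Ew pmfK.
rewrite pu; apply/esym/(@set2_eq u); first exact: edge_neq.
by rewrite E -Ew setUC.
Qed.

Lemma pm_set_inj p q : pmf p -> pmf q -> pm_set p = pm_set q -> p = q.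
Proof.
move=> pp qq E; apply/ffunP => v.
have ev := pmf_edge v pp.
by apply/esym/eqP; rewrite -(mem_pm_set qq ev) -E (mem_pm_set pp ev).
Qed.

Lemma is_edgeP (A : {set V}) : reflect (exists u v, e u v /\ A = [set u; v]) (is_edge A).
Proof.
apply: (iffP existsP) => [[u /existsP[v /andP[euv /eqP EA]]]|[u [v [euv ->]]]].
  by exists u, v.
by exists u; apply/existsP; exists v; rewrite euv eqxx.
Qed.

Lemma pm_set_perfect p : pmf p -> perfect_matching (pm_set p).
Proof.
move=> pp; apply/andP; split.
  apply/forall_inP => A /imsetP[v _ ->]; apply/is_edgeP; exists v, (p v).
  by split=> //; apply: pmf_edge.
apply/forallP => v; apply/cards1P; exists [set v; p v].
apply/setP=> A; rewrite !inE; apply/andP/eqP => [[/imsetP[w _ ->]]|->].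
  rewrite !inE => /orP[/eqP->//|/eqP->].
  by rewrite pmfK // setUC.
split; last by rewrite !inE eqxx.
by apply/imsetP; exists v.
Qed.

(** A partner of [v] is chosen from the edge of [M] covering [v]; the choice is an involution
    because each vertex is covered only once. *)
Lemma perfect_pm_set M : perfect_matching M -> exists2 p, pmf p & M = pm_set p.
Proof.
case/andP => /forall_inP HE /forallP H1.
have ex v : exists w, [set v; w] \in M.
  case/cards1P: (H1 v) => A /setP /(_ A); rewrite !inE eqxx => /andP[AM vA].
  case/is_edgeP: (HE _ AM) => a [b [eab EA]]; move: vA AM; rewrite EA !inE.
  by case/orP => /eqP -> ?; [exists b | exists a; rewrite setUC].
have uniq_M v A B : A \in M -> B \in M -> v \in A -> v \in B -> A = B.
  move=> AM BM vA vB; case/cards1P: (H1 v) => C /setP E.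
  have := E A; have := E B; rewrite !inE AM BM vA vB.
  by move=> /esym/eqP-> /esym/eqP->.
pose f v := xchoose (ex v).
have fM v : [set v; f v] \in M := xchooseP (ex v).
have fe v : e v (f v).
  case/is_edgeP: (HE _ (fM v)) => a [b [eab E]].
  have /setP /(_ v) := E; rewrite !inE eqxx => /esym/orP[]/eqP Ev.
    have -> // : f v = b; last by rewrite Ev.
    have /setP /(_ b) := E; rewrite !inE eqxx orbT => /orP[/eqP Eb|/eqP->//].
    by move: eab; rewrite -Ev Eb edge_irr.
  have -> // : f v = a; last by rewrite Ev edge_sym.
  have /setP /(_ a) := E; rewrite !inE eqxx => /orP[/eqP Eb|/eqP->//].
  by move: eab; rewrite -Ev Eb edge_irr.
have fK v : f (f v) = v.
  have E : [set f v; f (f v)] = [set v; f v].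
    by apply: (uniq_M (f v)); rewrite ?fM // !inE eqxx ?orbT.
  apply: (@set2_eq (f v)); first exact/edge_neq/fe.
  by rewrite E setUC.
exists (finfun f); first by apply/pmfP; split=> v; rewrite !ffunE ?fe ?fK.
apply/setP=> A; apply/idP/imsetP => [AM|[v _ ->]]; last by rewrite ffunE.
case/is_edgeP: (HE _ AM) => a [b [eab EA]]; exists a => //; rewrite ffunE.
by apply: (uniq_M a) => //; rewrite ?fM // ?EA !inE eqxx.
Qed.

Lemma lonely_plonely u v : e u v -> lonely [set u; v] = plonely u v.
Proof.
move=> euv; rewrite /lonely /plonely.
have -> : is_edge [set u; v] by apply/is_edgeP; exists u, v.
rewrite /=; congr (_ == 1).
rewrite -(card_in_imset (f := pm_set) (D := [set p | pmf p & p u == v])).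
  apply: eq_card => M; rewrite !inE; apply/andP/imsetP => [[/perfect_pm_set[p pp ->]]|[p]].
    by rewrite mem_pm_set // => pu; exists p; rewrite ?inE ?pp.
  by rewrite inE => /andP[pp pu] ->; rewrite pm_set_perfect // mem_pm_set.
by move=> p q; rewrite !inE => /andP[pp _] /andP[qq _]; apply: pm_set_inj.
Qed.

Lemma plonely_edge u v : plonely u v -> e u v.
Proof.
case/cards1P => p /setP /(_ p); rewrite !inE eqxx => /andP[pp /eqP <-].
exact: pmf_edge.
Qed.

Lemma plonelyP u v :
  reflect (exists p, [/\ pmf p, p u = v & forall q, pmf q -> q u = v -> q = p]) (plonely u v).
Proof.
apply: (iffP cards1P) => [[p /setP E]|[p [pp pu H]]]; exists p.
  have := E p; rewrite !inE eqxx => /andP[pp /eqP pu]; split=> // q qq qu.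
  by have := E q; rewrite !inE qq qu eqxx => /esym/eqP.
apply/setP=> q; rewrite !inE; apply/andP/eqP => [[qq /eqP qu]|->]; first exact: H.
by rewrite pp pu.
Qed.

(** Without loops, exactly two ordered pairs lie over each edge. *)
Lemma lonely_countE : (lonely_count G).*2 = #|[set z : V * V | plonely z.1 z.2]|.
Proof.
pose P := [set z : V * V | plonely z.1 z.2].
pose f (z : V * V) := [set z.1; z.2].
rewrite -/P -[#|P|]sum1_card (partition_big f (mem [set A : {set V} | lonely A])) /=; last first.
  by case=> u v; rewrite !inE /= => uv; rewrite lonely_plonely // plonely_edge.
rewrite -muln2 /lonely_count -sum_nat_const; apply: eq_bigr => A; rewrite inE => lA.
have /is_edgeP[u [v [euv EA]]] : is_edge A by case/andP: lA.
have uv := edge_neq euv.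
rewrite sum1dep_card -[LHS]/(2) -(_ : #|[set (u, v); (v, u)]| = 2); last first.
  rewrite cards2; suff -> : (u, v) != (v, u) by [].
  by rewrite xpair_eqE negb_and uv.
apply: eq_card => -[a b]; rewrite !inE !xpair_eqE /f /=.
apply/orP/andP => [[]/andP[/eqP-> /eqP->]|[lab /eqP]].
- by rewrite -lonely_plonely // -EA lA eqxx.
- by rewrite -lonely_plonely 1?edge_sym // setUC -EA lA eqxx.
move=> E; have ab := edge_neq (plonely_edge lab).
have /setP /(_ a) := E; rewrite EA !inE eqxx => /esym/orP[]/eqP Ea.
  by left; rewrite Ea eqxx /= eq_sym; apply/eqP/(@set2_eq u) => //; rewrite -{2}Ea E.
right; rewrite Ea eqxx /=; apply/eqP/esym.
by apply/(@set2_eq v); rewrite 1?eq_sym // -{2}Ea E EA setUC.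
Qed.

End PM.

(** * Edge cuts in cubic graphs *)

Definition cut (G : graph) (A B : {set gV G}) : nat :=
  \sum_(x in A) \sum_(y in B) (gE G x y : nat).

Definition three_edge_connected (G : graph) : Prop :=
  forall X : {set gV G}, X != set0 -> X != setT -> 3 <= cut X (~: X).

(** Two vertices of degree 3, joined by [d] edges, send [a1], [b1] edges to one side and [a2], [b2]
    to the other. The degrees add up to 6, so all the inequalities are tight: [d = 0], [b1 = a2] and
    [b1 + a2 = 3], impossible by parity. *)
Fact no_balanced_cut a1 a2 b1 b2 d :
  3 = a1 + a2 + (0 + d) -> 3 = b1 + b2 + (d + 0) -> 2 < a1 + b1 -> 2 < a2 + b2 ->
  3 <= b1 + a2 + d -> 3 <= a1 + b2 + d -> False.
Proof. lia. Qed.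

Section Cut.
Variable G : graph.
Hypothesis sG : simple_graph G.
Local Notation V := (gV G).
Local Notation e := (gE G).
Implicit Types (A B C X : {set V}) (x y u v : V).

Lemma cutC A B : cut A B = cut B A.
Proof.
rewrite /cut exchange_big; apply: eq_bigr => x _; apply: eq_bigr => y _.
by rewrite edge_sym.
Qed.

Lemma cutUl A B C : [disjoint A & B] -> cut (A :|: B) C = cut A C + cut B C.
Proof. by move=> dAB; rewrite /cut (big_setID A) setUK setDUl setDv set0U (setDidPl _) // disjoint_sym. Qed.

Lemma cutUr A B C : [disjoint A & B] -> cut C (A :|: B) = cut C A + cut C B.
Proof. by move=> dAB; rewrite !(cutC C) cutUl. Qed.

Lemma cutTr A B : cut A setT = cut A B + cut A (~: B).
Proof. by rewrite -cutUr ?setUCr // -setI_eq0 setICr. Qed.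

Lemma cut0l A : cut set0 A = 0. Proof. by rewrite /cut big_set0. Qed.

Lemma cut_eq0 A B : (forall x y, x \in A -> y \in B -> e x y = false) -> cut A B = 0.
Proof. by move=> H; rewrite /cut big1 // => x xA; rewrite big1 // => y yB; rewrite H. Qed.

Lemma cut1l x B : cut [set x] B = #|[set y in B | e x y]|.
Proof.
rewrite /cut big_set1 -sum1_card big_mkcond [RHS]big_mkcond; apply: eq_bigr => y _.
by rewrite inE; case: (y \in B); case: (e x y).
Qed.

Lemma cut11 x y : cut [set x] [set y] = e x y.
Proof. by rewrite /cut !big_set1. Qed.

Lemma cut_compl X : cut X (~: X) = cut (~: X) (~: ~: X).
Proof. by rewrite setCK cutC. Qed.

Lemma cut_gt0 A B x y : x \in A -> y \in B -> e x y -> 0 < cut A B.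
Proof.
by move=> xA yB xy; rewrite /cut (big_setD1 x) //= (big_setD1 y) //= xy.
Qed.

Hypothesis cG : cubic G.

Lemma cut1T x : cut [set x] setT = 3.
Proof. by rewrite cut1l -(cG x); apply: eq_card => y; rewrite !inE. Qed.

Lemma cutT A : cut A setT = 3 * #|A|.
Proof.
rewrite /cut -sum1_card big_distrr /=; apply: eq_bigr => x _.
by rewrite muln1 -(cut1T x) /cut big_set1.
Qed.

Lemma cut_self A : cut A A <= #|A| * #|A|.-1.
Proof.
rewrite -sum_nat_const; apply: leq_sum => x xA.
rewrite (big_setD1 x) //= edge_irr // add0n (cardsD1 x A) xA /=.
by rewrite -sum1_card; apply: leq_sum => y _; case: (e x y).
Qed.

Lemma cut_self1 x : cut [set x] [set x] = 0.
Proof. by rewrite cut11 edge_irr. Qed.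

(** At most two edges have a set [Z] of at most two ends in [X], and deleting [Z] separates the rest
    of [X] from its complement. If nothing of [X] remains, then [X] has n <= 2 vertices, and the
    degree sum 3n exceeds n(n - 1) + 2. *)
Lemma three_connected_edge : three_connected G -> three_edge_connected G.
Proof.
case=> V4 H X X0 XT; rewrite leqNgt; apply/negP => cX.
pose Z := [set x in X | [exists y, (y \notin X) && e x y]].
have ZX : Z \subset X by apply/subsetP => x; rewrite inE => /andP[].
have cZ : #|Z| <= cut X (~: X).
  rewrite /cut (big_setID Z) /= (setIidPr ZX) -sum1_card.
  apply: (leq_trans _ (leq_addr _ _)); apply: leq_sum => x.
  rewrite inE => /andP[xX /existsP[y /andP[yX xy]]].
  by rewrite (big_setD1 y) ?inE //= xy.
have [XZ|/subsetPn[u uX uZ]] := boolP (X \subset Z).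
  have EZ : Z = X by apply/eqP; rewrite eqEsubset ZX.
  rewrite EZ in cZ.
  have c3 := cutTr X X; rewrite cutT in c3.
  have := cut_self X; rewrite -card_gt0 in X0.
  by case: #|X| cZ c3 X0 => [|[|[|n]]] //=; lia.
have [v vX] : exists v, v \notin X.
  apply/existsP; rewrite -negb_forall; apply: contra XT => /forallP XT.
  by apply/eqP/setP => v; rewrite inE XT.
have vZ : v \notin Z by apply: contra vX; apply: (subsetP ZX).
have := H Z (leq_trans cZ _) u v uZ vZ; rewrite -ltnS => /(_ cX) uv.
have clo : closed (fun a b => [&& a \notin Z, b \notin Z & e a b]) X.
  move=> a b /and3P[aZ bZ ab]; apply/idP/idP => [aX|bX].
    apply: contraNT aZ => bX; rewrite inE aX; apply/existsP; exists b.
    by rewrite bX.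
  apply: contraNT bZ => aX; rewrite inE bX; apply/existsP; exists a.
  by rewrite aX edge_sym.
by have := closed_connect clo uv; rewrite uX (negbTE vX).
Qed.

(** Let [C] be a component after deleting [X] and [C'] the rest. All edges leaving [C] or [C'] end
    in [X], and there are at least 3 of each kind, too many for one vertex of degree 3. For two
    vertices, adding either of them to [C] gives two more cuts, and [no_balanced_cut] applies. *)
Lemma three_edge_connected_vertex :
  3 < #|V| -> three_edge_connected G -> three_connected G.
Proof.
move=> V4 H; split=> // X cX u v uX vX.
set r := (fun a b : V => _).
apply/negPn/negP => nuv.
pose C := [set w | connect r u w].
have uC : u \in C by rewrite inE.
have vC : v \notin C by rewrite inE.
have CX : [disjoint C & X].
  apply/pred0P => w /=; rewrite inE; apply/negbTE/negP => /andP[/connectP[s]].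
  case/lastP: s => [_ /= ->|s z]; first by rewrite (negbTE uX).
  by rewrite rcons_path last_rcons => /andP[_ /and3P[_ zX _]] ->; rewrite (negbTE zX).
pose C' := ~: (C :|: X).
have vC' : v \in C' by rewrite !inE negb_or -[connect _ _ _]/(connect r u v) nuv.
have CC' : cut C C' = 0.
  apply: cut_eq0 => x y; rewrite !inE negb_or => ux /andP[uy yX].
  apply: contraNF uy => xy; apply: (connect_trans ux); apply: connect1.
  rewrite /r xy yX /= andbT.
  by apply: contraTN CX => xX; apply/pred0Pn; exists x; rewrite /= inE ux.
have nT A w : w \notin A -> A != setT.
  by apply: contraNneq => ->; rewrite inE.
have n0 A w : w \in A -> A != set0 by move=> ?; apply/set0Pn; exists w.
have compC : ~: C = C' :|: X.
  apply/setP=> w; rewrite !inE -!/(w \in C) negb_or.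
  case wX: (w \in X); rewrite ?orbT ?orbF ?andbT //.
  by move/disjointFl: CX => /(_ w wX); rewrite inE => ->.
have C'X : [disjoint C' & X].
  by apply/pred0P => w /=; rewrite !inE negb_or; case: (w \in X); rewrite ?andbF.
have dCC' : [disjoint C & C'].
  by apply/pred0P => w /=; rewrite !inE negb_or; case: (connect r u w).
have cC : 3 <= cut C X.
  have := H C (n0 _ _ uC) (nT _ _ vC).
  by rewrite compC cutUr // CC'.
have compC' : ~: C' = C :|: X by rewrite setCK.
have uC' : u \notin C' by rewrite !inE connect0.
have cC' : 3 <= cut C' X.
  have := H C' (n0 _ _ vC') (nT _ _ uC').
  by rewrite compC' cutUr // cutC CC'.
have TE : setT = C :|: C' :|: X by rewrite -setUA -compC setUCr.
have dT : [disjoint C :|: C' & X].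
  by rewrite -setI_eq0 setIUl !disjoint_setI0 // setU0.
have deg a : 3 = cut [set a] C + cut [set a] C' + cut [set a] X.
  by rewrite -cutUr // -cutUr // -TE cut1T.
have [/eqP|X1] := posnP #|X|.
  by rewrite cards_eq0 => /eqP X0; rewrite X0 cutC cut0l in cC.
have [X1'|X2] : #|X| = 1 \/ #|X| = 2 by lia.
  have /cards1P[a Xa] : #|X| == 1 by rewrite X1'.
  have := deg a; rewrite (cutC _ C) (cutC _ C') -Xa; lia.
have /cards2P[a [b [ab Xab]]] : #|X| == 2 by rewrite X2.
have dab : [disjoint [set a] & [set b]].
  by apply/pred0P => w /=; rewrite !inE; case: eqP => // ->; apply/negbTE.
have aX : a \in X by rewrite Xab !inE eqxx.
have bX : b \in X by rewrite Xab !inE eqxx orbT.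
have da := deg a; have db := deg b.
rewrite Xab !(cutUr _ dab) in da db cC cC'.
rewrite cut_self1 in da; rewrite cut_self1 (cutC [set b] [set a]) in db.
have aC : a \notin C by rewrite (disjointFl CX).
have aC' : a \notin C' by rewrite (disjointFl C'X).
have bC' : b \notin C' by rewrite (disjointFl C'X).
have bC : b \notin C by rewrite (disjointFl CX).
have dis1 x A : x \notin A -> [disjoint A & [set x]].
  by rewrite disjoint_sym disjoints1.
have vX' : (v != a) && (v != b) by move: vX; rewrite Xab !inE negb_or.
have cut_one x y : x \in X -> y \in X -> x != y -> X = x |: [set y] ->
    3 <= cut C [set y] + cut [set x] C' + cut [set x] [set y].
  move=> xX yX xy Xxy.
  have xC : x \notin C by rewrite (disjointFl CX).
  have yC : y \notin C by rewrite (disjointFl CX).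
  have yC' : y \notin C' by rewrite (disjointFl C'X).
  have vx : v \notin C :|: [set x].
    by rewrite in_setU in_set1 (negbTE vC) /=; apply: contraNneq vX => ->.
  have ux : u \in C :|: [set x] by rewrite in_setU uC.
  have := H _ (n0 _ _ ux) (nT _ _ vx).
  have -> : ~: (C :|: [set x]) = C' :|: [set y].
    have xC' : x \notin C' by rewrite (disjointFl C'X).
    rewrite setCU compC Xxy; apply/setP=> w.
    rewrite in_setI !in_setU in_setC !in_set1.
    have [->|_] := eqVneq w x; last by rewrite andbT.
    by rewrite andbF (negbTE xC') (negbTE xy).
  rewrite (cutUl _ (dis1 _ _ xC)) !(cutUr _ (dis1 _ _ yC')) CC'.
  by rewrite add0n addnA.
have h1 := cut_one a b aX bX ab Xab.
have h2 : 3 <= cut C [set a] + cut [set b] C' + cut [set b] [set a].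
  by apply: cut_one => //; rewrite 1?eq_sym // Xab setUC.
move: da db cC cC' h1 h2.
rewrite (cutC C [set a]) (cutC C [set b]) (cutC C' [set a]) (cutC C' [set b]) (cutC [set b] [set a]).
exact: no_balanced_cut.
Qed.
End Cut.

(** * Kotzig's theorem on unique perfect matchings *)

Section Kotzig.
Variables (T : finType) (e : rel T) (p : T -> T) (W : {set T}).
Hypothesis e_sym : symmetric e.
Hypothesis pK : involutive p.
Hypothesis p_neq : forall x, p x != x.
Hypothesis pW : forall x, x \in W -> p x \in W.

(** A step goes from [a] along an edge to [p b] and then along the matching edge to [b]; [a != b]
    keeps the first edge out of the matching. A sequence of steps thus lists every second vertex of
    an alternating path. *)
Definition alt_step : rel T := fun a b => e a (p b) && (a != b).
Local Notation F := alt_step.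

(** Excluding partners from the list makes the full alternating path, with its skipped vertices,
    free of repetitions. *)
Definition regular (s : seq T) : bool := uniq s && all (fun x => p x \notin s) s.

Hypothesis no_alt_cycle :
  forall c, c != [::] -> cycle F c -> regular c -> {subset c <= W} -> False.

Definition alt_path (s : seq T) : bool :=
  [&& sorted F s, regular s & all [in W] s].

(** The bound on the length makes the existence boolean; a regular path satisfies it
    automatically. *)
Definition even_reach (r : T) : {set T} :=
  [set x | [exists t : {bseq #|T| of T}, alt_path (r :: t) && (last r t == x)]].
Local Notation D := even_reach.

(** An alternating path walked backwards lists the partners; this is the step-by-step form of that
    reversal. *)
Lemma alt_step_skew a b : F a b -> F (p b) (p a).
Proof. by case/andP => ab nab; rewrite /F pK e_sym ab (inj_eq (inv_inj pK)) eq_sym. Qed.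

Lemma even_reachP r x :
  reflect (exists s, alt_path (r :: s) /\ last r s = x) (x \in D r).
Proof.
rewrite inE; apply: (iffP existsP) => [[t /andP[At /eqP lt]]|[s [As ls]]].
  by exists t.
have ss : size s <= #|T|.
  by case/and3P: As => _ /andP[/= /andP[_ us] _] _; rewrite -(card_uniqP us) max_card.
by exists (Bseq ss); rewrite As ls eqxx.
Qed.

Lemma regular_sub s t : regular s -> uniq t -> {subset t <= s} -> regular t.
Proof.
case/andP => _ /allP As ut ts; rewrite /regular ut; apply/allP => x xt.
by apply: contra (As _ (ts _ xt)); apply: ts.
Qed.

Lemma regular_cat s t : regular s -> regular t ->
  (forall x, x \in t -> x \notin s /\ p x \notin s) -> regular (s ++ t).
Proof.
case/andP=> us /allP As /andP[ut /allP At] st; apply/andP; split.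
  by rewrite cat_uniq us ut andbT; apply/hasPn => x /st[].
apply/allP=> x; rewrite !mem_cat negb_or => /orP[xs|xt].
  by rewrite As //=; apply/negP => /st[_]; rewrite pK xs.
by rewrite At // andbT; case: (st x xt).
Qed.

Lemma regular_prefix s1 s2 : regular (s1 ++ s2) -> regular s1.
Proof.
move=> rs; apply: (regular_sub rs); first by case/andP: rs; rewrite cat_uniq => /andP[].
by move=> x; rewrite mem_cat => ->.
Qed.

Lemma regular_suffix s1 s2 : regular (s1 ++ s2) -> regular s2.
Proof.
move=> rs; apply: (regular_sub rs); first by case/andP: rs; rewrite cat_uniq => /and3P[].
by move=> x; rewrite mem_cat => ->; rewrite orbT.
Qed.

Lemma regular_rev_map s : regular s -> regular (rev (map p s)).
Proof.
case/andP=> us /allP As; rewrite /regular rev_uniq map_inj_uniq; last exact: inv_inj.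
rewrite us; apply/allP => x; rewrite mem_rev => /mapP[y ys ->].
by rewrite pK mem_rev; apply/mapP => -[z zs Ey]; have := As _ zs; rewrite -Ey ys.
Qed.

Lemma alt_path_prefix s1 s2 : alt_path (s1 ++ s2) -> alt_path s1.
Proof.
case/and3P => /cat_sorted2[ss _] rs; rewrite all_cat => /andP[ws _].
by rewrite /alt_path ss (regular_prefix rs) ws.
Qed.

Lemma alt_path_mem r s z : alt_path (r :: s) -> z \in r :: s -> z \in D r.
Proof.
move=> As zs; apply/even_reachP.
case/splitPl: zs As => s1 s2 Ez; rewrite -cat_cons => /alt_path_prefix As.
by exists s1.
Qed.

Lemma split_first (a : pred T) s : has a s ->
  exists s1 x s2, [/\ s = s1 ++ x :: s2, a x & ~~ has a s1].
Proof.
elim: s => //= x s IH; have [ax _|ax /IH[s1 [y [s2 [-> ay ns]]]]] := boolP (a x).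
  by exists [::], x, s.
by exists (x :: s1), y, s2; rewrite /= (negbTE ax).
Qed.

(** A path [q] from [p y] is appended to a path [c1] from [r] to [p y]. Let [w] be the first entry
    of [q] at which the two meet. If [w] is on [c1], an alternating cycle closes through [p y]. If
    [p w] is on [c1], then [c1] up to [p w] followed by [q] walked backwards reaches [y], against
    [y \notin D r]. *)
Lemma even_reach_sub r x y : x \in D r -> y \in W -> y \notin D r ->
  e x y -> x != p y -> D (p y) \subset D r.
Proof.
move=> /even_reachP[c0 [Ac0 lc0]] yW yD exy xpy; set y' := p y.
have py' : p y' = y by exact: pK.
have [c1 [Ac1 lc1]] : exists s, alt_path (r :: s) /\ last r s = y'.
  have [/(alt_path_mem Ac0)/even_reachP //|y'c0] := boolP (y' \in r :: c0).
  have yc0 : y \notin r :: c0 by apply: contra yD; apply: alt_path_mem.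
  exists (rcons c0 y'); rewrite last_rcons; split=> //.
  case/and3P: Ac0 => sc0 rc0 wc0; rewrite -rcons_cons /alt_path.
  apply/and3P; split.
  - by rewrite /= rcons_path -/(sorted F (r :: c0)) sc0 lc0 /F py' exy.
  - rewrite -cats1 regular_cat //; first by rewrite /regular /= inE p_neq.
    by move=> w; rewrite inE => /eqP->; rewrite py'.
  by rewrite all_rcons wc0 /= pW.
case/and3P: (Ac1) => sc1 rc1 wc1.
have y'c1 : y' \in r :: c1 by rewrite -lc1 mem_last.
have yc1 : y \notin r :: c1 by case/andP: rc1 => _ /allP /(_ _ y'c1); rewrite py'.
apply/subsetP => z /even_reachP[q [Aq lq]].
case/and3P: (Aq) => sq rq wq.
pose bad w := (w \in r :: c1) || (p w \in r :: c1).
have [hb|nb] := boolP (has bad q); last first.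
  apply/even_reachP; exists (c1 ++ q); rewrite last_cat lc1; split=> //.
  apply/and3P; split.
  - by rewrite /= cat_path -/(sorted F (r :: c1)) sc1 lc1.
  - rewrite -cat_cons regular_cat //; first exact: (@regular_suffix [:: y']).
    by move=> w /(hasPn nb); rewrite /bad negb_or => /andP[].
  by rewrite -cat_cons all_cat wc1; case/andP: wq.
case: (split_first hb) => q1 [w [q2 [Eq bw nb]]].
have pq : path F y' q1 /\ F (last y' q1) w.
  by move: sq; rewrite Eq /= cat_path /= => /and3P[].
have rq1 : regular q1.
  by move: rq; rewrite Eq -cat1s => /regular_suffix/regular_prefix.
have good v : v \in q1 -> v \notin r :: c1 /\ p v \notin r :: c1.
  by move/(hasPn nb); rewrite /bad negb_or => /andP[].
have wq1 v : v \in q1 -> v \in W.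
  move=> vq; move/allP: wq; apply; rewrite Eq inE mem_cat vq orbT //.
exfalso; have [wc|pwc] := orP bw.
  have [k1 [k2 Ek]] : exists k1 k2, r :: c1 = k1 ++ w :: k2.
    by case/splitPr: wc => k1 k2; exists k1, k2.
  have lk : last w k2 = y'.
    by rewrite -lc1 -(last_cons w r c1) Ek last_cat.
  move: sc1 rc1 wc1 good; rewrite Ek => /cat_sorted2[_ sk] /regular_suffix rk wk good.
  apply: (@no_alt_cycle ((w :: k2) ++ q1)) => //.
  - rewrite /= rcons_cat cat_path -/(sorted F (w :: k2)) sk lk rcons_path.
    by case: pq => -> ->.
  - apply: regular_cat => // v /good; rewrite !mem_cat !negb_or.
    by case=> /andP[_ ->] /andP[_ ->].
  move=> v; rewrite mem_cat => /orP[vk|/wq1//].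
  by move/allP: wk; apply; rewrite mem_cat vk orbT.
have [k1 [k2 Ek]] : exists k1 k2, r :: c1 = k1 ++ p w :: k2.
  by case/splitPr: pwc => k1 k2; exists k1, k2.
(* The part of the second path before [w], walked backwards; its last entry is [p y' = y]. *)
pose t := rev (map p (y' :: q1)).
have pt : path F (p w) t.
  rewrite /t -(belast_rcons y' q1 w) -map_rev.
  have pr : path (fun a b => F b a) w (rev (belast y' (rcons q1 w))).
    by rewrite -{1}(last_rcons y' q1 w) rev_path rcons_path; case: pq => -> ->.
  move: pr; move: (rev _) => u.
  elim: u w {Eq bw pwc Ek pq} => //= a s IH b /andP[ab pa].
  by rewrite alt_step_skew //= IH.
have rt : regular t.
  apply: regular_rev_map; move: rq; rewrite Eq -cat_cons; exact: regular_prefix.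
suff At : alt_path ((k1 ++ [:: p w]) ++ t).
  have [c' Ec'] : exists c', (k1 ++ [:: p w]) ++ t = r :: c'.
    case: (k1) Ek => [|a k] /= [-> _]; first by exists t.
    by exists ((k ++ [:: p w]) ++ t).
  have yt : y \in r :: c'.
    by rewrite -Ec' mem_cat mem_rev orbC -py' map_f // inE eqxx.
  by rewrite Ec' in At; rewrite (alt_path_mem At yt) in yD.
have Ek' : r :: c1 = (k1 ++ [:: p w]) ++ k2 by rewrite Ek -catA.
rewrite /alt_path regular_cat //=.
- rewrite -catA; apply/andP; split.
    move: sc1; rewrite Ek; case: (k1) => [|a k] /=; first by rewrite pt.
    by rewrite !cat_path /= pt => /and3P[-> -> _].
  rewrite !all_cat; move: wc1; rewrite Ek all_cat /= => /and3P[-> -> _] /=.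
  rewrite all_rev all_map; apply/allP => v; rewrite inE /= => /orP[/eqP->|/wq1/pW//].
  by rewrite py'.
- by move: rc1; rewrite Ek' => /regular_prefix.
move=> v; rewrite mem_rev => /mapP[v']; rewrite inE => /orP[/eqP->|/good[n1 n2]] ->; last first.
  by rewrite pK; move: n1 n2; rewrite Ek' !mem_cat !negb_or => /andP[-> _] /andP[-> _].
rewrite py' -/y'; split; first by move: yc1; rewrite Ek' mem_cat negb_or => /andP[].
case: (k2) Ek' => [|a k] E.
  have: last r (r :: c1) = p w by rewrite E cats0 last_cat.
  rewrite /= lc1 => /(congr1 p); rewrite py' pK => Ew.
  case/andP: rq => _ /= /andP[]; rewrite py' Ew Eq !inE mem_cat !inE eqxx !orbT //.
have ya : y' \in a :: k.
  have -> : y' = last r (r :: c1) by rewrite /= lc1.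
  by rewrite E last_cat /= mem_last.
case/andP: rc1 => + _; rewrite E cat_uniq => /and3P[_ /hasPn/(_ _ ya)//].
Qed.

(** Choose [r] with [D r] smallest. If a non-matching edge xy left [D r], then [D (p y) = D r] by
    minimality, so [x] would be reachable from [p y] and xy would close an alternating cycle. Hence
    only matching edges leave. If such an edge started at [x != r], the last step of a path to [x]
    would use a non-matching edge to [p x], which also leaves [D r]. *)
Theorem kotzig : W != set0 ->
  exists r (S : {set T}), [/\ r \in W, S \subset W, r \in S, p r \notin S &
    forall x y, x \in S -> y \in W :\: S -> e x y -> x = r /\ y = p r].
Proof.
case/set0Pn => w0 w0W.
case: (arg_minnP (fun r => #|D r|) w0W) => r rW0 rmin; have rW : r \in W := rW0.
have rD : r \in D r.
  by apply/even_reachP; exists [::]; rewrite /alt_path /regular /= inE p_neq rW.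
have prD : p r \notin D r.
  apply/negP => /even_reachP[s [/and3P[_ /andP[_ /andP[+ _]] _] ls]].
  by rewrite -[X in X \notin _]ls mem_last.
have cyc x y : x \in W -> y \in D x -> F y x -> False.
  move=> xW /even_reachP[s [/and3P[ss rs ws] ls]] yx.
  apply: (@no_alt_cycle (x :: s)) => //; last by move=> v; move/allP: ws; apply.
  by rewrite /= rcons_path -/(sorted F (x :: s)) ss ls yx.
have DW : D r \subset W.
  apply/subsetP => x /even_reachP[s [/and3P[_ _ /allP ws] <-]].
  by apply: ws; rewrite mem_last.
have main x y : x \in D r -> y \in W -> y \notin D r -> e x y -> x = p y.
  move=> xD yW yD xy; apply/eqP/negPn/negP => xpy.
  have sub := even_reach_sub xD yW yD xy xpy.
  have ED : D (p y) = D r.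
    by apply/eqP; rewrite eqEcard sub rmin //; apply: pW.
  by apply: (cyc (p y) x); rewrite ?pW ?ED // /F pK xy xpy.
exists r, (D r); split=> // x y xD; rewrite inE => /andP[yD yW] xy.
have Ex := main x y xD yW yD xy.
suff xr : x = r by rewrite -xr Ex pK.
case/even_reachP: (xD) => s; case/lastP: s => [[_ <-]//|s z].
rewrite last_rcons => -[As Ez]; subst z.
have wD : last r s \in D r.
  apply: (alt_path_mem As); rewrite -rcons_cons mem_rcons inE mem_last orbT //.
case/and3P: As => + _ _; rewrite /= rcons_path => /andP[_ /andP[ewx wx]].
have px : p x = y by rewrite Ex pK.
have Ew := main _ y wD yW yD; rewrite px in ewx; move/(_ ewx): Ew => Ew.
by rewrite Ew -Ex eqxx in wx.
Qed.
End Kotzig.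

(** The two sums equal to 3 give [s = d], so [w = 2d], and [0 < t] bounds this by 4; but [a] and [b]
    are at least 2. Everything is therefore tight. *)
Fact odd_cut_split c1 c2 w a b s d t :
  c1 = 1 + a -> c2 = 1 + b -> w = a + b -> w = s + d -> 3 = s + t -> 3 = d + t ->
  3 <= c1 -> 3 <= c2 -> 3 <= w -> 0 < t -> [/\ c1 = 3, c2 = 3 & d = 2].
Proof. by move=> *; split; lia. Qed.

(** * Descent from a lonely edge to a triangle containing a matching edge *)

Section MTriangle.
Variable G : graph.
Hypothesis sG : simple_graph G.
Local Notation V := (gV G).
Local Notation e := (gE G).
Variables (p : {ffun V -> V}) (u v : V).
Hypotheses (pp : pmf p) (puv : p u = v).
Hypothesis p_unique : forall q : {ffun V -> V}, pmf q -> q u = v -> q = p.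

(** Switching [p] along the cycle, which misses [u] and [v], would give a second perfect matching
    through [uv]. *)
Lemma unique_no_alt_cycle (W : {set V}) : u \notin W -> v \notin W ->
  forall c, c != [::] -> cycle (alt_step e p) c -> regular p c -> {subset c <= W} -> False.
Proof.
move=> uW vW c c0 cyc /andP[uc /allP rc] cW.
have pK := fun x => pmfK x pp.
(* The list [c] holds one end of each matching edge of the cycle. A listed vertex is joined forwards
   to the partner of the next one, a skipped vertex backwards to the predecessor of its own
   partner. *)
pose q := [ffun x => if x \in c then p (next c x) else
                     if p x \in c then prev c (p x) else p x].
have Fn x : x \in c -> e x (p (next c x)) && (x != next c x).
  by move=> xc; have := next_cycle cyc xc.
have Fp x : x \in c -> e (prev c x) (p x).
  by move=> xc; have /andP[] := prev_cycle cyc xc.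
have qq : pmf q.
  apply/pmfP; split=> x; rewrite [q x]ffunE.
    case: ifP => [/Fn/andP[]//|_]; case: ifP => [/Fp|_]; last exact: pmf_edge.
    by rewrite pK edge_sym.
  case: ifP => [xc|xc].
    by rewrite ffunE pK (negbTE (rc _ _)) ?mem_next // xc prev_next.
  case: ifP => pxc; rewrite ffunE; first by rewrite mem_prev pxc next_prev // pK.
  by rewrite pxc pK xc.
have uc' : u \notin c by apply: contra uW; apply: cW.
have vc' : v \notin c by apply: contra vW; apply: cW.
have qp : q = p by apply: p_unique; rewrite // ffunE (negbTE uc') puv (negbTE vc').
case: c c0 cyc uc rc cW @q Fn Fp qq uc' vc' qp => // x c _ _ _ _ _ q Fn _ _ _ _ qp.
have xc : x \in x :: c by rewrite inE eqxx.
case/andP: (Fn _ xc) => _ /eqP; apply.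
have := congr1 (fun f : {ffun V -> V} => p (f x)) qp.
by rewrite /q ffunE xc !pK => ->.
Qed.

Hypothesis cG : cubic G.
Hypothesis tG : three_edge_connected G.

(** The matching leaves [S] only at [r]. Kotzig's theorem splits [S] without [r] into two parts
    joined by the single edge from [r1] to [p r1]. Counting edges shows that both parts again have a
    cut of size 3, left by the matching only at [r1] and [p r1], so a part with several vertices is
    handled by induction. If both are single vertices, the same count makes [r] adjacent to both. *)
Lemma odd_cut_triangle (S : {set V}) r :
  u \notin S -> r \in S -> p r \notin S ->
  (forall x, x \in S -> x != r -> p x \in S) ->
  cut S (~: S) = 3 -> 1 < #|S| ->
  exists a b c, [/\ p a = b, e a c & e b c].
Proof.
have pK := fun x => pmfK x pp.
have [n] := ubnP #|S|; elim: n S r => // n IH S r leS uS rS prS clS cS S1.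
pose W := S :\ r.
have pW x : x \in W -> p x \in W.
  rewrite !inE => /andP[xr xS]; rewrite clS // andbT.
  by apply: contraNneq prS => <-; rewrite pK.
have W0 : W != set0.
  by rewrite -card_gt0; move: S1; rewrite (cardsD1 r) rS.
have uW : u \notin W by rewrite inE (negbTE uS) andbF.
have vW : v \notin W by apply: contra uW => /pW; rewrite -puv pK.
have esym : symmetric e by move=> x y; apply: edge_sym.
have pn x : p x != x by rewrite eq_sym; apply/(edge_neq sG)/pmf_edge.
have [r1 [S1' [r1W S1W r1S pr1S onlyS]]] :=
  kotzig esym pK pn pW (unique_no_alt_cycle uW vW) W0.
move: S1 => S_gt1; pose S2 := W :\: S1'.
have r2S : p r1 \in S2 by rewrite inE pr1S pW.
have nT (A : {set V}) w : w \notin A -> A != setT.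
  by apply: contraNneq => ->; rewrite inE.
have n0 (A : {set V}) w : w \in A -> A != set0 by move=> ?; apply/set0Pn; exists w.
have eS : S = W :|: [set r] by rewrite setUC setD1K.
have eW : W = S1' :|: S2 by rewrite -[LHS](setID W S1') (setIidPr S1W).
have dWr : [disjoint W & [set r]] by rewrite disjoint_sym disjoints1 !inE eqxx.
have d12 : [disjoint S1' & S2] by rewrite disjoint_sym disjoints_subset subsetDr.
have eCW : ~: W = ~: S :|: [set r].
  by apply/setP=> x; rewrite !inE; case: (eqVneq x r) => //= [->|_]; rewrite ?orbT ?orbF ?rS.
have dSr : [disjoint ~: S & [set r]] by rewrite disjoint_sym disjoints1 !inE rS.
have eC1 : ~: S1' = S2 :|: ~: W.
  apply/setP=> x; rewrite !inE; case x1: (x \in S1') => //=.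
    by have := subsetP S1W x x1; rewrite !inE => ->.
  by case: (_ && _).
have eC2 : ~: S2 = S1' :|: ~: W.
  apply/setP=> x; rewrite !inE; case x1: (x \in S1') => //=.
have d2W : [disjoint S2 & ~: W] by rewrite disjoints_subset setCK subsetDl.
have d1W : [disjoint S1' & ~: W] by rewrite disjoints_subset setCK.
have c12 : cut S1' S2 = 1.
  rewrite /cut (big_setD1 r1) //= [X in _ + X]big1 ?addn0; last first.
    move=> x; rewrite inE inE => /andP[xr xS]; rewrite big1 // => y yS.
    case exy: (e x y) => //.
    by have [xE _] := onlyS x y xS yS exy; rewrite xE eqxx in xr.
  rewrite (big_setD1 (p r1)) //= (pmf_edge _ pp) big1 // => y; rewrite inE inE => /andP[yr yS].
  case exy: (e r1 y) => //.
  by have [_ yE] := onlyS r1 y r1S yS exy; rewrite yE eqxx in yr.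
have b1 : 0 < cut [set r] (~: S).
  by apply: (cut_gt0 (x := r) (y := p r)); rewrite ?inE // pmf_edge.
have c3 : 3 <= cut W (~: W) by apply: tG => //; apply: nT uW.
have c31 : 3 <= cut S1' (~: S1').
  apply: tG; first exact: n0 r1S.
  by apply: (nT _ u); apply: contra uW; apply: (subsetP S1W).
have c32 : 3 <= cut S2 (~: S2).
  apply: tG; first exact: n0 r2S.
  by apply: (nT _ u); apply: contra uW; rewrite inE => /andP[].
have e1 : cut S1' (~: S1') = 1 + cut S1' (~: W) by rewrite eC1 cutUr // c12.
have e2 : cut S2 (~: S2) = 1 + cut S2 (~: W) by rewrite eC2 cutUr // cutC // c12.
have e3 : cut W (~: W) = cut S1' (~: W) + cut S2 (~: W) by rewrite {1}eW cutUl.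
have e4 : cut W (~: W) = cut W (~: S) + cut [set r] W by rewrite {1}eCW cutUr // (cutC sG W [set r]).
have e5 : 3 = cut W (~: S) + cut [set r] (~: S) by rewrite -cS {1}eS cutUl.
have e6 : 3 = cut [set r] W + cut [set r] (~: S).
  rewrite -(cut1T cG r) (cutTr sG _ S) {1}eS (cutUr sG _ dWr) cut_self1 //.
  by rewrite addn0.
have [k1 k2 k3] := odd_cut_split e1 e2 e3 e4 e5 e6 c31 c32 c3 b1.
have leW : #|W| < n by move: leS; rewrite (cardsD1 r) rS.
have [S1'1|S1'1] := ltnP 1 #|S1'|.
  apply: (IH S1' r1) => //.
  - by apply: leq_ltn_trans leW; apply: subset_leq_card.
  - by apply: contra uW; apply: (subsetP S1W).
  move=> x xS xr; have pxW := pW _ (subsetP S1W _ xS).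
  apply: contraNT xr => pxS; apply/eqP.
  by apply: (proj1 (onlyS x (p x) xS _ (pmf_edge x pp))); rewrite inE pxS.
have [S2'1|S2'1] := ltnP 1 #|S2|.
  apply: (IH S2 (p r1)) => //.
  - by apply: leq_ltn_trans leW; apply: subset_leq_card; apply: subsetDl.
  - by apply: contra uW; rewrite inE => /andP[].
  - by rewrite pK inE r1S.
  move=> x xS xr; move: (xS); rewrite inE => /andP[xS1 xW]; rewrite inE pW // andbT.
  apply: contra xr => pxS; apply/eqP.
  by apply: (proj2 (onlyS (p x) x pxS xS _)); rewrite edge_sym // pmf_edge.
have E1 : S1' = [set r1].
  by apply/eqP; rewrite eq_sym eqEcard sub1set r1S cards1.
have E2 : S2 = [set p r1].
  by apply/eqP; rewrite eq_sym eqEcard sub1set r2S cards1.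
exists r1, (p r1), r; split=> //.
all: rewrite (edge_sym sG); move: k3; rewrite eW cutUr // E1 E2 !cut11.
  by case: (e r r1) => //; case: (e r _).
by case: (e r (p r1)) => //; case: (e r _).
Qed.

Lemma pm_triangle : 3 < #|V| -> exists a b c, [/\ p a = b, e a c & e b c].
Proof.
(* The descent starts with the complement of [u]: its cut consists of the three edges at [u], and
   the matching crosses it only in [uv]. *)
move=> V4; apply: (@odd_cut_triangle (~: [set u]) v).
- by rewrite !inE eqxx.
- by rewrite !inE -puv eq_sym; apply/(edge_neq sG)/pmf_edge.
- by rewrite -puv pmfK // !inE eqxx.
- move=> x; rewrite !inE => xu xv; apply: contra xv => /eqP pxu.
  by rewrite -puv -pxu pmfK.
- rewrite cutC // setCK -(cut1T cG u) (cutTr sG [set u] [set u]) cut_self1 //.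
- by have := cardsC [set u]; rewrite cards1; lia.
Qed.

End MTriangle.

(** * Replacing a vertex by a triangle *)

Definition is_iso (G H : graph) (f : gV G -> gV H) : Prop :=
  bijective f /\ forall u v, gE H (f u) (f v) = gE G u v.

Lemma inj_surj_bij (S T : finType) (g : S -> T) :
  injective g -> (forall a, exists b, g b = a) -> bijective g.
Proof.
move=> gi gs; apply: inj_card_bij => //.
rewrite -(card_codom gi); apply/subset_leq_card/subsetP => a _.
by case: (gs a) => b <-; apply: codom_f.
Qed.

Lemma iso_trans G H K : iso G H -> iso H K -> iso G K.
Proof.
case=> f [bf fE] [g [bg gE]]; exists (g \o f); split; first exact: bij_comp.
by move=> u v; rewrite /= gE fE.
Qed.

(* H arises from G by replacing x by the triangle with vertices c i; h is the
   embedding of the other vertices, its value at x is irrelevant. *)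
Record tri_at (G H : graph) (x : gV G) (nb : 'I_3 -> gV G)
    (h : gV G -> gV H) (c : 'I_3 -> gV H) : Prop := TriAt {
  tri_nb_inj : injective nb;
  tri_nbE : forall v, gE G x v <-> exists i, nb i = v;
  tri_hh : forall u v, u != x -> v != x -> gE H (h u) (h v) = gE G u v;
  tri_hc : forall u i, u != x -> gE H (h u) (c i) = (u == nb i);
  tri_ch : forall u i, u != x -> gE H (c i) (h u) = (u == nb i);
  tri_cc : forall i j, gE H (c i) (c j) = (i != j);
  tri_h_inj : forall u v, u != x -> v != x -> h u = h v -> u = v;
  tri_c_inj : injective c;
  tri_hNc : forall u i, u != x -> h u != c i;
  tri_cover : forall a, (exists2 u, u != x & a = h u) \/ (exists i, a = c i) }.

(** Definition by cases on a vertex of [H], old or new. The final default is never reached under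
    [tri_at], whose cases cover [H]. *)
Definition tri_case (G H : graph) (x : gV G) (h : gV G -> gV H) (c : 'I_3 -> gV H)
    (T : Type) (f : gV G -> T) (g : 'I_3 -> T) (a : gV H) : T :=
  if [pick u | (u != x) && (a == h u)] is Some u then f u
  else if [pick i | a == c i] is Some i then g i else g ord0.

Section Tri.
Variables (G H : graph) (x : gV G) (nb : 'I_3 -> gV G) (h : gV G -> gV H) (c : 'I_3 -> gV H).
Hypothesis tri : tri_at x nb h c.

Lemma tri_case_h T (f : gV G -> T) g u : u != x -> tri_case x h c f g (h u) = f u.
Proof.
move=> ux; rewrite /tri_case; case: pickP => [v /andP[vx /eqP E]|/(_ u)].
  by rewrite (tri_h_inj tri ux vx E).
by rewrite ux eqxx.
Qed.

Lemma tri_case_c T (f : gV G -> T) g i : tri_case x h c f g (c i) = g i.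
Proof.
rewrite /tri_case; case: pickP => [v /andP[vx /eqP E]|_].
  by have := tri_hNc tri i vx; rewrite E eqxx.
by case: pickP => [j /eqP/(tri_c_inj tri)->//|/(_ i)]; rewrite eqxx.
Qed.

Lemma tri_iso K (f : gV H -> gV K) : is_iso f -> tri_at x nb (f \o h) (f \o c).
Proof.
case: tri => ni nE hh hc ch cc hi ci hnc cov [bf fE].
have fi := bij_inj bf; split=> //=.
- by move=> *; rewrite fE hh.
- by move=> *; rewrite fE hc.
- by move=> *; rewrite fE ch.
- by move=> *; rewrite fE cc.
- by move=> u v ux vx /fi; apply: hi.
- by move=> i j /fi; apply: ci.
- by move=> u i ux; rewrite (inj_eq fi) hnc.
case: bf => g fK gK a; rewrite -(gK a).
by case: (cov (g a)) => [[u ux ->]|[i ->]]; [left; exists u|right; exists i].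
Qed.

Lemma tri_iso_src K (f : gV K -> gV G) (g : gV G -> gV K) :
  cancel f g -> cancel g f -> (forall u v, gE G (f u) (f v) = gE K u v) ->
  tri_at (g x) (g \o nb) (h \o f) c.
Proof.
case: tri => ni nE hh hc ch cc hi ci hnc cov fK gK fE.
have gi := can_inj gK; have fi := can_inj fK.
have ne u : u != g x -> f u != x by apply: contra => /eqP <-; rewrite fK.
split=> //=.
- by move=> i j /gi; apply: ni.
- move=> v; rewrite -fE gK; split=> [/nE[i E]|[i <-]]; first by exists i; rewrite E fK.
  by rewrite gK; apply/nE; exists i.
- by move=> *; rewrite hh ?ne.
- by move=> u i /ne ux; rewrite hc // -(inj_eq gi) fK.
- by move=> u i /ne ux; rewrite ch // -(inj_eq gi) fK.
- by move=> u v /ne ux /ne vx /hi E; apply/fi/E.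
- by move=> u i /ne ux; apply: hnc.
move=> a; case: (cov a) => [[u ux ->]|[i ->]]; last by right; exists i.
by left; exists (g u); rewrite ?gK // (inj_eq gi).
Qed.

Lemma tri_perm (s : 'I_3 -> 'I_3) : injective s -> tri_at x (nb \o s) h (c \o s).
Proof.
move=> si; case: tri => ni nE hh hc ch cc hi ci hnc cov.
have [t sK tK] := injF_bij si.
split=> //=.
- by move=> i j /ni/si.
- move=> v; rewrite nE; split=> -[i <-]; first by exists (t i); rewrite tK.
  by exists (s i).
- by move=> *; rewrite hc.
- by move=> *; rewrite ch.
- by move=> *; rewrite cc (inj_eq si).
- by move=> i j /ci/si.
- by move=> *; apply: hnc.
by move=> a; case: (cov a) => [|[i ->]]; [left|right; exists (t i); rewrite tK].
Qed.

(** This splitting reduces every count in [H] (vertices, degrees, edge cuts) to one in [G]. *)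
Lemma tri_sum (F : gV H -> nat) :
  \sum_a F a = \sum_(u | u != x) F (h u) + \sum_i F (c i).
Proof.
rewrite (bigID (fun a => [exists i, a == c i])) /= [LHS]addnC; congr (_ + _).
  rewrite (reindex_onto h (tri_case x h c id (fun=> x))) /=.
    apply: eq_bigl => u; have [ux|ux] := eqVneq u x; last first.
      rewrite tri_case_h // eqxx andbT; apply/existsP => -[i /eqP E].
      by have := tri_hNc tri i ux; rewrite E eqxx.
    apply/negbTE/negP => /andP[n /eqP E].
    case: (tri_cover tri (h u)) E n => [[v vx ->]|[i ->]].
      by rewrite tri_case_h // => E; rewrite E ux eqxx in vx.
    by move=> _ /existsP; apply; exists i.
  move=> a; case: (tri_cover tri a) => [[v vx ->]|[i ->]]; first by rewrite tri_case_h.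
  by move/existsP; case; exists i.
rewrite (reindex_onto c (tri_case x h c (fun=> ord0) id)) /=.
  apply: eq_bigl => i; rewrite tri_case_c eqxx andbT.
  by apply/existsP; exists i.
by move=> a /existsP[i /eqP->]; rewrite tri_case_c.
Qed.

Lemma tri_card : #|gV H| = #|gV G| + 2.
Proof.
rewrite -[LHS]sum1_card (tri_sum (fun=> 1)) !sum1_card card_ord.
have := cardC1 x; rewrite (_ : #|predC1 x| = #|(fun i : gV G => i != x)|); last exact: eq_card.
by have : 0 < #|gV G| by [apply/card_gt0P; exists x]; lia.
Qed.

Hypothesis sG : simple_graph G.

Lemma tri_nbx i : nb i != x.
Proof.
rewrite eq_sym; apply: (edge_neq sG).
by apply/(tri_nbE tri); exists i.
Qed.

Lemma tri_simple : simple_graph H.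
Proof.
case: tri => ni nE hh hc ch cc hi ci hnc cov; split.
  move=> a b; case: (cov a) => [[u ux ->]|[i ->]]; case: (cov b) => [[v vx ->]|[j ->]].
  - by rewrite !hh // (edge_sym sG).
  - by rewrite hc // ch.
  - by rewrite hc // ch.
  - by rewrite !cc eq_sym.
move=> a; case: (cov a) => [[u ux ->]|[i ->]]; first by rewrite hh // (edge_irr sG).
by rewrite cc eqxx.
Qed.

Lemma tri_nb_sum v : \sum_i (v == nb i) = gE G x v :> nat.
Proof.
case xv: (gE G x v).
  have [i E] := proj1 (tri_nbE tri v) xv.
  rewrite (bigD1 i) //= -E eqxx big1 // => j ji.
  by rewrite (inj_eq (tri_nb_inj tri)) eq_sym (negbTE ji).
rewrite big1 // => i _; case: eqP => // E.
suff: gE G x v by rewrite xv.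
by apply/(tri_nbE tri); exists i.
Qed.

Lemma deg_sum (K : graph) (u : gV K) : #|[pred v | gE K u v]| = \sum_v gE K u v.
Proof. by rewrite -sum1_card big_mkcond; apply: eq_bigr => v _; rewrite inE; case: (gE _ _ _). Qed.

Lemma tri_deg_h u : u != x -> #|[pred v | gE H (h u) v]| = #|[pred v | gE G u v]|.
Proof.
move=> ux; rewrite !deg_sum (tri_sum (fun v => gE H (h u) v)) [in RHS](bigD1 x) //= addnC.
congr (_ + _); last by apply: eq_bigr => v vx; rewrite (tri_hh tri).
by rewrite (edge_sym sG u) -tri_nb_sum; apply: eq_bigr => i _; rewrite (tri_hc tri).
Qed.

Lemma tri_deg_c i : #|[pred v | gE H (c i) v]| = 3.
Proof.
rewrite deg_sum (tri_sum (fun v => gE H (c i) v)) (bigD1 (nb i)) ?tri_nbx //=.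
rewrite (tri_ch tri) ?tri_nbx // eqxx big1 => [|v /andP[vx vn]]; last first.
  by rewrite (tri_ch tri) // (negbTE vn).
rewrite (bigD1 i) //= (tri_cc tri) eqxx /= (eq_bigr (fun=> 1)) => [|j ji].
  by rewrite sum1_card cardC1 card_ord.
by rewrite (tri_cc tri) eq_sym ji.
Qed.

Lemma tri_deg_x : #|[pred v | gE G x v]| = 3.
Proof.
rewrite deg_sum (eq_bigr (fun v => \sum_i (v == nb i))) => [|v _]; last by rewrite tri_nb_sum.
rewrite exchange_big /= (eq_bigr (fun=> 1)) ?sum1_card ?card_ord // => i _.
by rewrite (bigD1 (nb i)) //= eqxx big1 // => v /negbTE->.
Qed.

Lemma tri_cubic : cubic G <-> cubic H.
Proof.
split=> cG; last first.
  move=> u; have [->|ux] := eqVneq u x; first exact: tri_deg_x.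
  by rewrite -tri_deg_h.
move=> a; case: (tri_cover tri a) => [[u ux ->]|[i ->]]; last exact: tri_deg_c.
by rewrite tri_deg_h.
Qed.

Definition tri_proj : gV H -> gV G := tri_case x h c id (fun=> x).
Lemma tri_proj_h u : u != x -> tri_proj (h u) = u. Proof. exact: tri_case_h. Qed.
Lemma tri_proj_c i : tri_proj (c i) = x. Proof. exact: tri_case_c. Qed.

Lemma cut_sum (K : graph) (A B : {set gV K}) :
  cut A B = \sum_a \sum_b [&& a \in A, b \in B & gE K a b].
Proof.
rewrite /cut big_mkcond; apply: eq_bigr => a _; case: (a \in A) => /=; last by rewrite big1.
by rewrite big_mkcond; apply: eq_bigr => b _; case: (b \in B).
Qed.

(** A preimage does not split the triangle, so no triangle edge crosses the cut, and the three edges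
    leaving the triangle stand for the three edges at [x]. *)
Lemma tri_cut (X : {set gV G}) :
  cut (tri_proj @^-1: X) (~: (tri_proj @^-1: X)) = cut X (~: X).
Proof.
rewrite !cut_sum (tri_sum (fun a => \sum_b _)) [RHS](bigD1 x) //= addnC.
congr (_ + _).
  under eq_bigr => i _ do rewrite (tri_sum (fun b => _ : bool)) /=.
  rewrite big_split /= [X in _ + X]big1 ?addn0 => [|i _]; last first.
    by rewrite big1 // => j _; rewrite !inE !tri_proj_c; case: (x \in X).
  rewrite exchange_big /= [RHS](bigD1 x) //= [in RHS]inE.
  have -> : [&& x \in X, x \notin X & gE G x x] = false by case: (x \in X).
  rewrite add0n; apply: eq_bigr => v vx.
  under eq_bigr => i _ do rewrite !inE tri_proj_c tri_proj_h // (tri_ch tri) //.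
  rewrite inE; case: (x \in X) => /=; last by rewrite big1.
  case: (v \in X) => /=; first by rewrite big1.
  by rewrite tri_nb_sum.
apply: eq_bigr => u ux; rewrite (tri_sum (fun b => _ : bool)) /= [RHS](bigD1 x) //= addnC.
congr (_ + _); last first.
  by apply: eq_bigr => v vx; rewrite !inE !tri_proj_h // (tri_hh tri).
under eq_bigr => i _ do rewrite !inE tri_proj_c tri_proj_h // (tri_hc tri) //.
rewrite inE (edge_sym sG); case: (u \in X) => /=; last by rewrite big1.
case: (x \in X) => /=; first by rewrite big1.
by rewrite tri_nb_sum.
Qed.

Lemma tri_3ec_down : three_edge_connected H -> three_edge_connected G.
Proof.
move=> tH X /set0Pn[u uX] XT; rewrite -tri_cut.
have surj v : exists a, tri_proj a = v.
  have [->|vx] := eqVneq v x; first by exists (c ord0); rewrite tri_proj_c.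
  by exists (h v); rewrite tri_proj_h.
apply: tH.
  by case: (surj u) => a E; apply/set0Pn; exists a; rewrite inE E.
apply: contraNneq XT => E; apply/eqP/setP => v.
by case: (surj v) => a <-; have /setP/(_ a) := E; rewrite !inE.
Qed.

(** A set not splitting the triangle is a preimage, where [tri_cut] applies. Otherwise, up to
    complement, exactly one [c i] is inside; it has at most one edge into the rest of the set, so
    removing it does not enlarge the cut. If it is the whole set, the cut is its degree. *)
Lemma tri_3ec_up : cubic G -> three_edge_connected G -> three_edge_connected H.
Proof.
move=> cG tG; have sH := tri_simple; have cH := proj1 tri_cubic cG.
have aux (X : {set gV H}) : X != set0 -> X != setT ->
    (forall i j, (c i \in X) = (c j \in X)) -> 3 <= cut X (~: X).
  move=> X0 XT cX; pose Y := [set u | if u == x then c ord0 \in X else h u \in X].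
  have E : X = tri_proj @^-1: Y.
    apply/setP => a; rewrite !inE; case: (tri_cover tri a) => [[u ux ->]|[i ->]].
      by rewrite tri_proj_h // (negbTE ux).
    by rewrite tri_proj_c eqxx.
  rewrite E tri_cut; apply: tG.
    by apply: contraNneq X0 => Y0; rewrite E Y0 preimset0.
  by apply: contraNneq XT => Y0; rewrite E Y0 preimsetT.
have one (X : {set gV H}) i : X != setT -> c i \in X -> (forall j, j != i -> c j \notin X) ->
    3 <= cut X (~: X).
  move=> XT iX jX; pose Y := X :\ c i.
  have [Y0|Y0] := eqVneq Y set0.
    have -> : X = [set c i].
      by rewrite -(setD1K iX) -/Y Y0 setU0.
    by have := cutTr sH [set c i] [set c i]; rewrite cut1T // cut_self1 // add0n => <-.
  have YC : c i \notin Y by rewrite !inE eqxx.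
  have YT : Y != setT by apply: contraNneq YC => ->; rewrite inE.
  have := aux Y Y0 YT _.
  have cY j : c j \in Y = false.
    rewrite !inE (inj_eq (tri_c_inj tri)); have [->//|ji] := eqVneq j i.
    exact/negbTE/jX.
  have eY : Y = X :\ c i by [].
  have eX : X = Y :|: [set c i] by rewrite setUC setD1K.
  have eCY : ~: Y = ~: X :|: [set c i].
    by apply/setP => a; rewrite !inE; case: eqP => [->|_]; rewrite ?iX ?orbT ?orbF.
  have d1 : [disjoint Y & [set c i]] by rewrite disjoint_sym disjoints1.
  have d2 : [disjoint ~: X & [set c i]] by rewrite disjoint_sym disjoints1 inE iX.
  move=> /(_ (fun j k => etrans (cY j) (esym (cY k)))).
  rewrite eCY cutUr // {2}eX cutUl // (cutC sH Y [set c i]).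
  have e3 := cutTr sH [set c i] X; rewrite cut1T // {1}eX (cutUr sH _ d1) cut_self1 // in e3.
  have : cut [set c i] Y <= 1.
    rewrite cut1l -(cards1 (h (nb i))); apply: subset_leq_card; apply/subsetP => a.
    rewrite !inE; case: (tri_cover tri a) => [[u ux ->]|[j ->]].
      by rewrite (tri_ch tri) // => /andP[_ /eqP->].
    by move: (cY j); rewrite !inE => ->.
  move: e3; move: (cut [set c i] Y) (cut [set c i] (~: X)) (cut Y (~: X)) => n1 n2 n3; lia.
move=> X X0 XT.
have CX0 : ~: X != set0.
  by apply: contraNneq XT => E; rewrite -[X]setCK E setC0.
have CXT : ~: X != setT.
  by apply: contraNneq X0 => E; rewrite -[X]setCK E setCT.
pose o0 : 'I_3 := ord0; pose o1 : 'I_3 := Ordinal (isT : 1 < 3); pose o2 : 'I_3 := ord_max.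
have all3 (P : 'I_3 -> Prop) : P o0 -> P o1 -> P o2 -> forall i, P i.
  move=> P0 P1 P2 [[|[|[|//]]] lt].
  - by rewrite (_ : Ordinal lt = o0) //; apply: val_inj.
  - by rewrite (_ : Ordinal lt = o1) //; apply: val_inj.
  - by rewrite (_ : Ordinal lt = o2) //; apply: val_inj.
case e0: (c o0 \in X); case e1: (c o1 \in X); case e2: (c o2 \in X).
- by apply: aux => //; do 2![elim/all3]; rewrite ?e0 ?e1 ?e2.
- rewrite cut_compl //; apply: (one _ o2) => //; first by rewrite inE e2.
  by elim/all3 => //; rewrite inE ?e0 ?e1.
- rewrite cut_compl //; apply: (one _ o1) => //; first by rewrite inE e1.
  by elim/all3 => //; rewrite inE ?e0 ?e2.
- by apply: (one _ o0) => //; elim/all3 => //; rewrite ?e1 ?e2.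
- rewrite cut_compl //; apply: (one _ o0) => //; first by rewrite inE e0.
  by elim/all3 => //; rewrite inE ?e1 ?e2.
- by apply: (one _ o1) => //; elim/all3 => //; rewrite ?e0 ?e2.
- by apply: (one _ o2) => //; elim/all3 => //; rewrite ?e0 ?e1.
by apply: aux => //; do 2![elim/all3]; rewrite ?e0 ?e1 ?e2.
Qed.

End Tri.

Section Unique.
Variables (G H G' H' : graph) (x : gV G) (nb : 'I_3 -> gV G) (h : gV G -> gV H) (c : 'I_3 -> gV H).
Variables (x' : gV G') (nb' : 'I_3 -> gV G') (h' : gV G' -> gV H') (c' : 'I_3 -> gV H').
Hypotheses (tri : tri_at x nb h c) (tri' : tri_at x' nb' h' c').
Variables (f : gV G -> gV G') (s : 'I_3 -> 'I_3).
Hypotheses (fi : is_iso f) (fx : f x = x') (fnb : forall i, f (nb i) = nb' (s i)).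

(** Up to isomorphism the result of a replacement depends only on the replaced vertex; [s] absorbs
    the numbering of the new vertices. *)
Lemma tri_unique : exists g : gV H -> gV H',
  [/\ is_iso g, forall u, u != x -> g (h u) = h' (f u) & forall i, g (c i) = c' (s i)].
Proof.
pose g := tri_case x h c (h' \o f) (c' \o s).
have gh u : u != x -> g (h u) = h' (f u) by move=> ux; rewrite /g (tri_case_h tri).
have gc i : g (c i) = c' (s i) by rewrite /g (tri_case_c tri).
case: (fi) => bf fE; have finj := bij_inj bf.
have si : injective s.
  move=> i j E; apply: (tri_nb_inj tri); apply: finj; by rewrite !fnb E.
have [t sK tK] := injF_bij si.
have fne u : u != x -> f u != x' by rewrite -fx (inj_eq finj).
exists g; split=> //; split.
  apply: inj_surj_bij.
    move=> a b; case: (tri_cover tri a) => [[u ux ->]|[i ->]];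
      case: (tri_cover tri b) => [[v vx ->]|[j ->]]; rewrite ?gh ?gc //.
    - by move=> /(tri_h_inj tri' (fne _ ux) (fne _ vx)) /finj ->.
    - by move=> E; have := tri_hNc tri' (s j) (fne _ ux); rewrite E eqxx.
    - by move=> E; have := tri_hNc tri' (s i) (fne _ vx); rewrite E eqxx.
    - by move/(tri_c_inj tri')/si->.
  move=> a; case: (tri_cover tri' a) => [[v vx ->]|[j ->]]; last first.
    by exists (c (t j)); rewrite gc tK.
  case: bf => f' fK f'K; exists (h (f' v)); rewrite gh ?f'K //.
  by apply: contraNneq vx => E; rewrite -fx -E f'K.
move=> a b; case: (tri_cover tri a) => [[u ux ->]|[i ->]];
      case: (tri_cover tri b) => [[v vx ->]|[j ->]]; rewrite ?gh ?gc //.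
- by rewrite (tri_hh tri') ?fne // fE (tri_hh tri).
- by rewrite (tri_hc tri') ?fne // (tri_hc tri) // -fnb (inj_eq finj).
- by rewrite (tri_ch tri') ?fne // (tri_ch tri) // -fnb (inj_eq finj).
by rewrite (tri_cc tri') (tri_cc tri) (inj_eq si).
Qed.
End Unique.

Definition rep_inl (G : graph) (x : gV G) (v : gV G) : rep_V x :=
  if (insub v : option {v : gV G | v != x}) is Some w then inl w else inr ord0.

Lemma rep_inlE (G : graph) (x v : gV G) (vx : v != x) :
  rep_inl x v = inl (exist _ v vx).
Proof. by rewrite /rep_inl insubT. Qed.

Lemma replace_tri_at (G : graph) (x : gV G) (nb : 'I_3 -> gV G) :
  injective nb -> (forall v, gE G x v <-> exists i, nb i = v) ->
  @tri_at G (replace_tri x nb) x nb (rep_inl x) inr.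
Proof.
move=> ni nE; split=> //=.
- by move=> u v ux vx; rewrite !rep_inlE.
- by move=> u i ux; rewrite !rep_inlE.
- by move=> u i ux; rewrite !rep_inlE.
- by move=> u v ux vx; rewrite !rep_inlE => -[].
- by move=> i j [].
- by move=> u i ux; rewrite !rep_inlE.
by case=> [[u ux]|i]; [left; exists u; rewrite ?rep_inlE|right; exists i].
Qed.

Lemma tri_stepP (G H : graph) :
  tri_step G H <-> exists x nb h c, @tri_at G H x nb h c.
Proof.
split=> [[x [nb [ni [nE [f [[g fK gK] fE]]]]]]|[x [nb [h [c tri]]]]].
  have gi : @is_iso (replace_tri x nb) H g.
    split; first by exists f.
    by move=> u v; rewrite -fE !gK.
  by exists x, nb; eexists; eexists; exact: (tri_iso (replace_tri_at ni nE) gi).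
exists x, nb; split; first exact: tri_nb_inj tri.
split; first exact: tri_nbE tri.
have tri0 := replace_tri_at (tri_nb_inj tri) (tri_nbE tri).
have id_iso : @is_iso G G id by split=> //; exists id.
have [f [fi _ _]] := tri_unique (s := id) tri tri0 id_iso erefl (fun=> erefl).
by exists f.
Qed.

Definition third (i j : 'I_3) : 'I_3 := odflt ord0 [pick l | (l != i) && (l != j)].

Lemma ord3_cases (i j k l : 'I_3) : i != j -> i != k -> j != k -> [\/ l = i, l = j | l = k].
Proof.
move=> ij ik jk; have [->|li] := eqVneq l i; first by constructor 1.
have [->|lj] := eqVneq l j; first by constructor 2.
constructor 3; apply: val_inj; move: ij ik jk li lj; rewrite -!val_eqE /=.
by move: (ltn_ord i) (ltn_ord j) (ltn_ord k) (ltn_ord l); lia.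
Qed.

Lemma thirdP i j : i != j -> (third i j != i) && (third i j != j).
Proof.
move=> ij; rewrite /third; case: pickP => [l //|none].
have [l [li lj]] : exists l : 'I_3, l != i /\ l != j.
  have nz : 0 < #|~: [set i; j]| by have := cardsC [set i; j]; rewrite cards2 ij card_ord; lia.
  by case/card_gt0P: nz => l; rewrite !inE negb_or => /andP[li lj]; exists l.
by have := none l; rewrite li lj.
Qed.

Lemma third_uniq i j k : i != j -> i != k -> j != k -> third i j = k.
Proof.
move=> ij ik jk; case/andP: (thirdP ij) => ti tj.
by case: (ord3_cases (third i j) ij ik jk) => E //; rewrite E eqxx in ti tj.
Qed.

(** * Lifting perfect matchings through a replaced vertex *)

Section Lift.
Variables (G H : graph) (x : gV G) (nb : 'I_3 -> gV G) (h : gV G -> gV H) (c : 'I_3 -> gV H).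
Hypotheses (tri : tri_at x nb h c) (sG : simple_graph G).
Implicit Types (q : {ffun gV G -> gV G}) (P : {ffun gV H -> gV H}).

Let ch u : u != x -> forall i, h u != c i. Proof. by move=> ux i; apply: (tri_hNc tri). Qed.

Definition nb_idx v : 'I_3 := odflt ord0 [pick i | nb i == v].

Lemma nb_idxK i : nb_idx (nb i) = i.
Proof.
by rewrite /nb_idx; case: pickP => [j /eqP/(tri_nb_inj tri)//|/(_ i)]; rewrite eqxx.
Qed.

Lemma nb_idxE v : gE G x v -> nb (nb_idx v) = v.
Proof. by move=> xv; case: (proj1 (tri_nbE tri v) xv) => i <-; rewrite nb_idxK. Qed.

Lemma nb_edge i : gE G x (nb i).
Proof. by apply/(tri_nbE tri); exists i. Qed.

Lemma c_adj i a : gE H (c i) a -> a = h (nb i) \/ exists2 j, j != i & a = c j.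
Proof.
case: (tri_cover tri a) => [[u ux ->]|[j ->]].
  by rewrite (tri_ch tri) // => /eqP->; left.
by rewrite (tri_cc tri) => ij; right; exists j; rewrite // eq_sym.
Qed.

Lemma h_adj u a : u != x -> gE H (h u) a ->
  (exists2 v, v != x & a = h v /\ gE G u v) \/ (exists2 i, a = c i & u = nb i).
Proof.
move=> ux; case: (tri_cover tri a) => [[v vx ->]|[j ->]].
  by rewrite (tri_hh tri) // => uv; left; exists v.
by rewrite (tri_hc tri) // => /eqP->; right; exists j.
Qed.

(** The edge of [q] at [x] moves to the new vertex facing the same neighbour, and the two other new
    vertices are matched to each other. *)
Definition lift1 q : {ffun gV H -> gV H} :=
  finfun (tri_case x h c
    (fun v => if q v == x then c (nb_idx v) else h (q v))
    (fun i => if nb i == q x then h (nb i) else c (third i (nb_idx (q x))))).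

Lemma lift1_h q v : v != x -> lift1 q (h v) = if q v == x then c (nb_idx v) else h (q v).
Proof. by move=> vx; rewrite ffunE (tri_case_h tri). Qed.

Lemma lift1_c q i : lift1 q (c i) =
  if nb i == q x then h (nb i) else c (third i (nb_idx (q x))).
Proof. by rewrite ffunE (tri_case_c tri). Qed.

Lemma lift1_local q q' a : q (tri_proj x h c a) = q' (tri_proj x h c a) -> lift1 q a = lift1 q' a.
Proof.
case: (tri_cover tri a) => [[u ux ->]|[i ->]].
  by rewrite (tri_proj_h tri) // !lift1_h // => ->.
by rewrite (tri_proj_c tri) !lift1_c => ->.
Qed.

Lemma lift1_pmf q : pmf q -> pmf (lift1 q).
Proof.
move=> qq; have qK v := pmfK v qq; have qe v := pmf_edge v qq.
have [k Ek] := proj1 (tri_nbE tri _) (qe x).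
have nbx := tri_nbx tri sG.
apply/pmfP; split=> a; case: (tri_cover tri a) => [[u ux ->]|[i ->]].
- rewrite lift1_h //; case: eqP => [qu|/eqP qu].
    rewrite (tri_hc tri) // nb_idxE // -qu (edge_sym sG); exact: qe.
  by rewrite (tri_hh tri).
- rewrite lift1_c -Ek nb_idxK; case: eqP => [/(tri_nb_inj tri)->|/eqP n].
    by rewrite (tri_ch tri) ?nbx ?eqxx.
  have ik : i != k by apply: contraNneq n => ->.
  by rewrite (tri_cc tri) eq_sym; case/andP: (thirdP ik).
- rewrite lift1_h //; case: eqP => [qu|/eqP qu].
    have Eu : u = nb k by rewrite Ek -qu qK.
    by rewrite lift1_c Eu nb_idxK Ek eqxx.
  rewrite lift1_h // qK (negbTE ux) //.
- rewrite lift1_c -Ek nb_idxK; case: eqP => [/(tri_nb_inj tri)->|/eqP n].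
    by rewrite lift1_h ?nbx // Ek qK eqxx -Ek nb_idxK.
  have ik : i != k by apply: contraNneq n => ->.
  case/andP: (thirdP ik) => ti tk.
  rewrite lift1_c -Ek nb_idxK (inj_eq (tri_nb_inj tri)) (negbTE tk).
  by rewrite (@third_uniq (third i k) k i) // eq_sym.
Qed.

Lemma lift1_inj q q' : pmf q -> pmf q' -> lift1 q = lift1 q' -> q = q'.
Proof.
move=> qq qq' E.
have H1 v : v != x -> q v = q' v.
  move=> vx; have := congr1 (fun P : {ffun _ -> _} => tri_proj x h c (P (h v))) E.
  rewrite !lift1_h //; do 2![case: eqP => [->|/eqP ?]];
    by rewrite ?(tri_proj_c tri) ?(tri_proj_h tri).
apply/ffunP => v; have [->|/H1//] := eqVneq v x.
have wx : q x != x by rewrite eq_sym; apply/(edge_neq sG)/pmf_edge.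
by rewrite -(pmfK (q x) qq') -(H1 _ wx) (pmfK x qq).
Qed.

(** Parity: one or three vertices of the triangle are matched outside it. This dichotomy is the
    origin of the states. *)
Lemma pmf_triangle P : pmf P -> (forall i, P (c i) = h (nb i)) \/
  exists i j k, [/\ i != j, i != k, j != k, P (c i) = c j & P (c k) = h (nb k)].
Proof.
move=> PP; have [/existsP[i /existsP[j /eqP ij]]|none] := boolP [exists i, exists j, P (c i) == c j].
  right; have nij : i != j.
    by have := pmf_edge (c i) PP; rewrite ij (tri_cc tri).
  case/andP: (thirdP nij) => ki kj; exists i, j, (third i j).
  rewrite ![_ == third i j]eq_sym nij ki kj ij; split=> //.
  case: (c_adj (pmf_edge (c (third i j)) PP)) => // -[l lk El].
  have nik : i != third i j by rewrite eq_sym.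
  have njk : j != third i j by rewrite eq_sym.
  have Ek : P (c l) = c (third i j) by rewrite -El pmfK.
  case: (ord3_cases l nij nik njk) lk Ek => ->; last by rewrite eqxx.
    by rewrite ij => _ /(tri_c_inj tri) E; rewrite -E eqxx in kj.
  by rewrite -ij pmfK // => _ /(tri_c_inj tri) E; rewrite -E eqxx in ki.
left=> i; case: (c_adj (pmf_edge (c i) PP)) => // -[j _ Ej].
by case/existsP: none; exists i; apply/existsP; exists j; rewrite Ej.
Qed.

(** Contracting the triangle loses its matching edge, and the partner of [c k] becomes the partner
    of [x]. *)
Lemma lift1_onto P i j k : pmf P -> i != j -> i != k -> j != k -> P (c i) = c j ->
  P (c k) = h (nb k) -> exists q, [/\ pmf q, q x = nb k & lift1 q = P].
Proof.
move=> PP ij ik jk Pij Pk; have PK a := pmfK a PP.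
have nbx := tri_nbx tri sG.
pose q := [ffun v => if v == x then nb k else tri_proj x h c (P (h v))].
have qx : q x = nb k by rewrite ffunE eqxx.
have Pji : P (c j) = c i by rewrite -Pij PK.
have Pnk : P (h (nb k)) = c k by rewrite -Pk PK.
have other l : l != k -> exists2 l', l' != k & P (c l) = c l'.
  by case: (ord3_cases l ij ik jk) => ->; rewrite ?eqxx // => _; [exists j|exists i].
have hk v : v != x -> v != nb k -> exists w, [/\ w != x, P (h v) = h w & gE G v w].
  move=> vx vk; case: (h_adj vx (pmf_edge (h v) PP)) => [[w wx [Pv vw]]|[l Pv vl]].
    by exists w.
  have lk : l != k by apply: contraNneq vk => <-; rewrite vl.
  have [l' _ El] := other l lk; have := PK (h v).
  by rewrite Pv El => E; have := ch vx l'; rewrite -E eqxx.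
have qk : q (nb k) = x by rewrite ffunE (negbTE (nbx k)) Pnk (tri_proj_c tri).
have qh v w : v != x -> w != x -> P (h v) = h w -> q v = w.
  by move=> vx wx E; rewrite ffunE (negbTE vx) E (tri_proj_h tri).
have qq : pmf q.
  apply/pmfP; split=> v.
    have [->|vx] := eqVneq v x; first by rewrite qx nb_edge.
    have [->|vk] := eqVneq v (nb k); first by rewrite qk (edge_sym sG) nb_edge.
    by have [w [wx Pv vw]] := hk v vx vk; rewrite (qh _ _ vx wx Pv).
  have [->|vx] := eqVneq v x; first by rewrite qx qk.
  have [->|vk] := eqVneq v (nb k); first by rewrite qk qx.
  have [w [wx Pv vw]] := hk v vx vk; rewrite (qh _ _ vx wx Pv).
  by apply: qh; rewrite // -Pv PK.
exists q; split=> //; apply/ffunP => a; case: (tri_cover tri a) => [[v vx ->]|[l ->]].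
  rewrite lift1_h //; have [->|vk] := eqVneq v (nb k).
    by rewrite qk eqxx nb_idxK Pnk.
  by have [w [wx Pv vw]] := hk v vx vk; rewrite (qh _ _ vx wx Pv) (negbTE wx) Pv.
rewrite lift1_c qx nb_idxK (inj_eq (tri_nb_inj tri)).
case: (ord3_cases l ij ik jk) => ->.
- by rewrite (negbTE ik) (@third_uniq i k j) 1?eq_sym // eq_sym.
- by rewrite (negbTE jk) (@third_uniq j k i) 1?eq_sym // eq_sym.
- by rewrite eqxx.
Qed.

(** Since it uses a triangle edge, the matching through [uv] is a lift [lift1 q]. The edge of [q] at
    the image of [u] is lonely: by [lift1_local], a second matching through that edge would lift to
    a second one through [uv]. *)
Lemma plonely_down P i j u v : pmf P -> P (c i) = c j -> P u = v -> plonely u v ->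
  exists u' v' : gV G, plonely u' v'.
Proof.
move=> PP Pij Puv /plonelyP[P' [PP' P'uv uniq]].
have EP := uniq P PP Puv; subst P'.
case: (pmf_triangle PP) => [/(_ i)|[i' [j' [k [ij ik jk Pij' Pk]]]]].
  by rewrite Pij => E; have := ch (tri_nbx tri sG i) j; rewrite E eqxx.
have [q [qq _ Eq]] := lift1_onto PP ij ik jk Pij' Pk.
exists (tri_proj x h c u), (q (tri_proj x h c u)); apply/plonelyP; exists q; split=> //.
move=> q' qq' /lift1_local E; apply: lift1_inj => //.
by rewrite Eq; apply: uniq; rewrite ?lift1_pmf // E Eq.
Qed.

(** In this case the edges of [q] at [x] and its neighbours stay among these four vertices; deleting
    them frees all three neighbours for the new triangle, which is what [lift3] does. *)
Definition star q : bool := [forall i, [exists j, q (nb i) == nb j] || (q (nb i) == x)].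

Definition lift3 q : {ffun gV H -> gV H} :=
  finfun (tri_case x h c
    (fun v => if gE G x v then c (nb_idx v) else h (q v)) (fun i => h (nb i))).

Lemma lift3_h q v : v != x -> lift3 q (h v) = if gE G x v then c (nb_idx v) else h (q v).
Proof. by move=> vx; rewrite ffunE (tri_case_h tri). Qed.

Lemma lift3_c q i : lift3 q (c i) = h (nb i).
Proof. by rewrite ffunE (tri_case_c tri). Qed.

Lemma lift3_pmf q : pmf q -> star q -> pmf (lift3 q).
Proof.
move=> qq /forallP st; have qK v := pmfK v qq; have qe v := pmf_edge v qq.
have nbx := tri_nbx tri sG.
have qn v : v != x -> ~~ gE G x v -> (q v != x) /\ ~~ gE G x (q v).
  move=> vx xv; split.
    by apply: contra xv => /eqP <-; rewrite (edge_sym sG).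
  apply: contra xv => /(tri_nbE tri)[i Ei]; have := st i; rewrite Ei qK (negbTE vx) orbF.
  by case/existsP => j /eqP->; rewrite nb_edge.
apply/pmfP; split=> a; case: (tri_cover tri a) => [[u ux ->]|[i ->]].
- rewrite lift3_h //; case: ifP => xu; first by rewrite (tri_hc tri) // nb_idxE.
  by have [qx _] := qn u ux (negbT xu); rewrite (tri_hh tri).
- by rewrite lift3_c (tri_ch tri) ?nbx // eqxx.
- rewrite lift3_h //; case: ifP => xu; first by rewrite lift3_c nb_idxE.
  by have [qx qn'] := qn u ux (negbT xu); rewrite lift3_h // (negbTE qn') qK.
- by rewrite lift3_c lift3_h ?nbx // nb_edge nb_idxK.
Qed.

Lemma star_nb q s i : pmf q -> star q -> q x = nb s -> i != s -> q (nb i) = nb (third i s).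
Proof.
move=> qq /forallP/(_ i) st qx ns; have qK v := pmfK v qq.
case/orP: st => [/existsP[j /eqP Ej]|/eqP E]; last first.
  have := qK (nb i); rewrite E qx => /(tri_nb_inj tri) E'.
  by rewrite E' eqxx in ns.
rewrite Ej; congr nb; apply/esym/third_uniq => //.
  apply: contraTneq (pmf_edge (nb i) qq) => E; rewrite Ej -E.
  by rewrite (edge_irr sG).
apply: contraNneq (tri_nbx tri sG i) => E.
by rewrite -(qK (nb i)) Ej -E -qx qK.
Qed.

(** Contraction leaves [x] and its three neighbours unmatched: [x] takes [nb s], and the other two
    neighbours, being adjacent, take each other. *)
Lemma lift3_onto P s : pmf P -> (forall i, P (c i) = h (nb i)) ->
  (forall i j, i != s -> j != s -> i != j -> gE G (nb i) (nb j)) ->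
  exists q, [/\ pmf q, star q, q x = nb s & lift3 q = P].
Proof.
move=> PP Pc es; have PK a := pmfK a PP.
have nbx := tri_nbx tri sG.
have Pnb i : P (h (nb i)) = c i by rewrite -Pc PK.
have hk v : v != x -> ~~ gE G x v ->
    exists w, [/\ w != x, ~~ gE G x w, P (h v) = h w & gE G v w].
  move=> vx vk; case: (h_adj vx (pmf_edge (h v) PP)) => [[w wx [Pv vw]]|[l Pv vl]].
    exists w; split=> //; apply: contraT; rewrite negbK => /(tri_nbE tri)[i Ei].
    by have := PK (h v); rewrite Pv -Ei Pnb => E; have := ch vx i; rewrite E eqxx.
  by rewrite vl nb_edge in vk.
pose q := [ffun v => if v == x then nb s else if v == nb s then x else
   if gE G x v then nb (third (nb_idx v) s) else tri_proj x h c (P (h v))].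
have qx : q x = nb s by rewrite ffunE eqxx.
have qs : q (nb s) = x by rewrite ffunE (negbTE (nbx _)) eqxx.
have qi i : i != s -> q (nb i) = nb (third i s).
  move=> ns; rewrite ffunE (negbTE (nbx _)) (inj_eq (tri_nb_inj tri)) (negbTE ns).
  by rewrite nb_edge nb_idxK.
have qh v w : v != x -> ~~ gE G x v -> w != x -> P (h v) = h w -> q v = w.
  move=> vx xv wx E; rewrite ffunE (negbTE vx) E (tri_proj_h tri) // (negbTE xv).
  by case: eqP => // Ev; rewrite Ev nb_edge in xv.
have case3 v : [\/ v = x, v = nb s, (exists2 i, i != s & v = nb i) | v != x /\ ~~ gE G x v].
  have [->|vx] := eqVneq v x; first by constructor 1.
  have [xv|xv] := boolP (gE G x v); last by constructor 4.
  have [i <-] := proj1 (tri_nbE tri _) xv.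
  by have [->|ns] := eqVneq i s; [constructor 2|constructor 3; exists i].
have qq : pmf q.
  apply/pmfP; split=> v; case: (case3 v) => [->|->|[i ns ->]|[vx xv]].
  - by rewrite qx nb_edge.
  - by rewrite qs (edge_sym sG) nb_edge.
  - by case/andP: (thirdP ns) => t1 t2; rewrite qi // es // eq_sym.
  - by have [w [wx xw Pv vw]] := hk v vx xv; rewrite (qh _ _ vx xv wx Pv).
  - by rewrite qx qs.
  - by rewrite qs qx.
  - case/andP: (thirdP ns) => t1 t2; rewrite !qi //.
    by rewrite (@third_uniq (third i s) s i) // eq_sym.
  - have [w [wx xw Pv vw]] := hk v vx xv; rewrite (qh _ _ vx xv wx Pv).
    by apply: qh; rewrite // -Pv PK.
exists q; split=> //.
  apply/forallP => i; have [->|ns] := eqVneq i s; first by rewrite qs eqxx orbT.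
  by apply/orP; left; apply/existsP; exists (third i s); rewrite qi.
apply/ffunP => a; case: (tri_cover tri a) => [[v vx ->]|[i ->]]; last by rewrite lift3_c Pc.
rewrite lift3_h //; case: ifP => [xv|/negbT xv].
  by have [i <-] := proj1 (tri_nbE tri _) xv; rewrite nb_idxK Pnb.
by have [w [wx xw Pv vw]] := hk v vx xv; rewrite (qh _ _ vx xv wx Pv).
Qed.

End Lift.

(** * Contracting a triangle *)

Section Contract.
Variables (H : graph) (c : 'I_3 -> gV H).
Hypotheses (sH : simple_graph H) (cH : cubic H) (tH : three_edge_connected H).
Hypotheses (V4 : 4 < #|gV H|) (cc : forall i j, gE H (c i) (c j) = (i != j)).
Local Notation V := (gV H).
Local Notation e := (gE H).

Let T : {set V} := [set c i | i in 'I_3].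

Lemma tri_inj : injective c.
Proof.
move=> i j E; apply/eqP; apply: contraFT (edge_irr sH (c i)) => ij.
by rewrite {2}E cc.
Qed.

Lemma mem_tri i : c i \in T. Proof. exact: imset_f. Qed.

Lemma nbrs3_cut (S : {set V}) (y p q r : V) : uniq [:: p; q; r] ->
  e y p -> e y q -> e y r -> p \in S -> q \in S -> r \in S -> cut [set y] (~: S) = 0.
Proof.
move=> upqr yp yq yr pS qS rS; have := cutTr sH [set y] S; rewrite cut1T //.
suff : 3 <= cut [set y] S by lia.
rewrite cut1l (cardD1 p) inE pS yp (cardD1 q) !inE qS yq (cardD1 r) !inE rS yr.
by move: upqr; rewrite /= !inE !negb_or (eq_sym q p) (eq_sym r p) (eq_sym r q) => /andP[/andP[-> ->] /andP[-> _]].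
Qed.

Lemma nbrs2_cut (S : {set V}) (y p q : V) : p != q ->
  e y p -> e y q -> p \in S -> q \in S -> cut [set y] (~: S) <= 1.
Proof.
move=> pq yp yq pS qS; have := cutTr sH [set y] S; rewrite cut1T //.
suff : 2 <= cut [set y] S by lia.
by rewrite cut1l (cardD1 p) inE pS yp (cardD1 q) !inE qS yq eq_sym pq.
Qed.

Lemma outer_ex i : exists w, [/\ w \notin T, e (c i) w & forall z, z \notin T -> e (c i) z -> z = w].
Proof.
clear tH V4.
have [j [k [ij ik jk]]] : exists j k : 'I_3, [/\ i != j, i != k & j != k].
  have [j ji] : exists j : 'I_3, j != i.
    by have /card_gt0P[j] : 0 < #|predC1 i| by [rewrite cardC1 card_ord]; exists j.
  case/andP: (thirdP ji) => t1 t2; exists j, (third j i).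
  by rewrite eq_sym ji eq_sym t2 eq_sym t1.
have /cards1P[w Ew] : #|[set v | e (c i) v] :\ c j :\ c k| == 1.
  have N3 : #|[set v | e (c i) v]| = 3 by rewrite cardsE; apply: cH.
  have jN : c j \in [set v | e (c i) v] by rewrite inE cc.
  have kN : c k \in [set v | e (c i) v] :\ c j.
    by rewrite !inE cc ik (inj_eq tri_inj) eq_sym jk.
  by move: N3; rewrite (cardsD1 (c j)) jN (cardsD1 (c k) (_ :\ _)) kN => E; apply/eqP; lia.
have /setP mw := Ew.
have ew := mw w; rewrite !inE eqxx in ew; case/and3P: ew => wk wj ew.
exists w; split=> //.
  apply/imsetP => -[l _ El]; case: (ord3_cases l ij ik jk) => E.
  - by rewrite El E (edge_irr sH) in ew.
  - by rewrite El E eqxx in wj.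
  - by rewrite El E eqxx in wk.
move=> z zT ez; have := mw z; rewrite !inE ez andbT.
have -> : z != c k by apply: contraNneq zT => ->; apply: mem_tri.
have -> : z != c j by apply: contraNneq zT => ->; apply: mem_tri.
by move/esym/eqP.
Qed.

(** If two triangle vertices had a common outer neighbour [z], at most two edges would leave the
    triangle together with [z]: one at the third vertex and one at [z]. With more than four vertices
    this would be a forbidden cut. *)
Lemma outer_inj (w : 'I_3 -> V) : (forall i, w i \notin T) -> (forall i, e (c i) (w i)) ->
  injective w.
Proof.
move=> wT we i j Eij; apply/eqP; apply: contraT => ij.
case/andP: (thirdP ij); set k := third i j => ki kj.
have ik : i != k by rewrite eq_sym.
have jk : j != k by rewrite eq_sym.
set z := w i; have zc l : z != c l by apply: contraNneq (wT i) => E; rewrite -/z E mem_tri.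
pose S := [set c i] :|: ([set c j] :|: ([set c k] :|: [set z])).
have dis (x : V) (A : {set V}) : x \notin A -> [disjoint [set x] & A] by rewrite disjoints1.
have mS : [/\ c i \in S, c j \in S, c k \in S & z \in S].
  by rewrite !inE !eqxx !orbT.
case: mS => iS jS kS zS.
have iz : e (c i) z by apply: we.
have jz : e (c j) z by rewrite /z Eij; apply: we.
have SE : cut S (~: S) = cut [set c i] (~: S) + (cut [set c j] (~: S) + (cut [set c k] (~: S) + cut [set z] (~: S))).
  rewrite {1}/S !cutUl // dis // !inE ?negb_or ?(inj_eq tri_inj) ?ij ?ik ?jk //=.
  - by rewrite eq_sym zc.
  - by rewrite eq_sym zc.
  - by rewrite eq_sym zc.
have c1 : cut [set c i] (~: S) = 0.
  apply: (@nbrs3_cut _ _ (c j) (c k) z); rewrite ?cc //=.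
  by rewrite !inE !negb_or (inj_eq tri_inj) jk eq_sym zc eq_sym zc.
have c2 : cut [set c j] (~: S) = 0.
  apply: (@nbrs3_cut _ _ (c i) (c k) z); rewrite ?cc // 1?eq_sym //=.
  by rewrite !inE !negb_or (inj_eq tri_inj) ik eq_sym zc eq_sym zc.
have c3 : cut [set c k] (~: S) <= 1.
  by apply: (@nbrs2_cut _ _ (c i) (c j)); rewrite ?cc // (inj_eq tri_inj).
have c4 : cut [set z] (~: S) <= 1.
  by apply: (@nbrs2_cut _ _ (c i) (c j)); rewrite ?(inj_eq tri_inj) // edge_sym.
have S0 : S != set0 by apply/set0Pn; exists z.
have S4 : #|S| <= 4.
  apply: (leq_trans (leq_card_setU _ _)); rewrite cards1 ltnS.
  apply: (leq_trans (leq_card_setU _ _)); rewrite cards1 ltnS.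
  by apply: (leq_trans (leq_card_setU _ _)); rewrite !cards1.
have ST : S != setT by apply: contraTneq S4 => ->; rewrite cardsT -ltnNge.
by have := tH S0 ST; rewrite SE c1 c2; lia.
Qed.

Lemma contract_triangle : exists G x nb h,
  simple_graph G /\ @tri_at G H x nb h c.
Proof.
have [w wP] := fin_all_exists outer_ex.
have wT i : w i \notin T by case: (wP i).
have we i : e (c i) (w i) by case: (wP i).
have wu i z : z \notin T -> e (c i) z -> z = w i by case: (wP i) => _ _; apply.
have winj := outer_inj wT we.
(* The vertex [c ord0] is kept to represent the contracted triangle. *)
pose VG := {v : V | (v \notin T) || (v == c ord0)}.
have x0 : (c ord0 \notin T) || (c ord0 == c ord0) by rewrite eqxx orbT.
pose x : VG := Sub (c ord0) x0.
have nb0 i : (w i \notin T) || (w i == c ord0) by rewrite wT.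
pose nb i : VG := Sub (w i) (nb0 i).
have VGx (v : VG) : v != x -> val v \notin T.
  by move: (valP v) => /orP[//|/eqP E]; rewrite -val_eqE /= E eqxx.
have Tx (v : VG) : val v \notin T -> v != x.
  by apply: contraNneq => ->; rewrite /= mem_tri.
pose eG (u v : VG) := if u == x then (v != x) && [exists i, v == nb i]
  else if v == x then [exists i, u == nb i] else e (val u) (val v).
pose G := @Graph VG eG.
have nbx i : nb i != x by apply: Tx; rewrite /= wT.
exists G, x, nb, (val : VG -> V); split; split=> /=.
- move=> u v; rewrite /eG; case: (eqVneq u x) => ux; case: (eqVneq v x) => vx //=.
  exact: edge_sym.
- move=> u; rewrite /eG; case: (eqVneq u x) => ux //; exact: edge_irr.
- by move=> i j /(congr1 val) /= /winj.
- move=> v; rewrite /eG eqxx; split=> [/andP[_ /existsP[i /eqP->]]|[i <-]]; first by exists i.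
  by rewrite nbx; apply/existsP; exists i.
- by move=> u v ux vx; rewrite /eG (negbTE ux) (negbTE vx).
- move=> u i ux; rewrite (edge_sym sH); apply/idP/eqP => [/(wu _ _ (VGx _ ux)) E|->].
    by apply: val_inj.
  exact: we.
- move=> u i ux; apply/idP/eqP => [/(wu _ _ (VGx _ ux)) E|->]; last exact: we.
  by apply: val_inj.
- exact: cc.
- by move=> u v _ _ /val_inj.
- exact: tri_inj.
- by move=> u i ux; apply: contraNneq (VGx _ ux) => E; rewrite [val u]E mem_tri.
move=> a; have [aT|aT] := boolP (a \in T); first by case/imsetP: aT => i _ ->; right; exists i.
left; have a0 : (a \notin T) || (a == c ord0) by rewrite aT.
by exists (Sub a a0) => //; apply: Tx.
Qed.

End Contract.

Lemma cubic_card (G : graph) : simple_graph G -> cubic G -> 0 < #|gV G| -> 3 < #|gV G|.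
Proof.
move=> sG cG /card_gt0P[x _]; have := subset_leq_card (subsetT (x |: [set v | gE G x v])).
by rewrite cardsU1 inE (edge_irr sG) cardsE (cG x) cardsT.
Qed.

Lemma card4_K4 (G : graph) : simple_graph G -> cubic G -> #|gV G| = 4 -> iso G K4.
Proof.
move=> sG cG V4.
have comp (u v : gV G) : gE G u v = (u != v).
  have [->|uv] := eqVneq u v; first exact: edge_irr.
  have : [set w | gE G u w] = [set~ u].
    apply/eqP; rewrite eqEcard cardsC1 V4 cardsE (cG u) leqnn andbT.
    by apply/subsetP => w; rewrite !inE eq_sym; apply: edge_neq.
  by move/setP/(_ v); rewrite !inE eq_sym uv.
have [f [bf]] : exists f : gV G -> 'I_4, bijective f /\ True.
  exists (fun v => cast_ord V4 (enum_rank v)); split=> //.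
  exists (fun i => enum_val (cast_ord (esym V4) i)) => v.
    by rewrite cast_ordK enum_rankK.
  by rewrite enum_valK cast_ordKV.
by exists f; split=> // u v /=; rewrite comp (inj_eq (bij_inj bf)).
Qed.

Lemma in_U_plonely (G : graph) : simple_graph G -> cubic G -> three_connected G ->
  (exists u v : gV G, plonely u v) -> in_U G.
Proof.
move=> sG cG tG [u [v uv]]; split=> //.
apply/card_gt0P; exists [set u; v]; rewrite inE lonely_plonely //.
exact: plonely_edge.
Qed.

Lemma plonely_in_U (G : graph) : in_U G -> exists u v : gV G, plonely u v.
Proof.
case=> sG cG tG /card_gt0P[A]; rewrite inE => lA.
have /andP[/is_edgeP[u [v [uv EA]]] _] := lA.
by exists u, v; rewrite -lonely_plonely // -EA.
Qed.

Lemma in_U_reduction (H : graph) : in_U H ->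
  iso H K4 \/ exists G, [/\ in_U G, tri_step G H & #|gV G| < #|gV H|].
Proof.
move=> UH; have [u [v luv]] := plonely_in_U UH.
case: UH => sH cH tH _; have tE := three_connected_edge sH cH tH.
have V3 : 3 < #|gV H| by case: tH.
have [/eqP|n4] := eqVneq #|gV H| 4; first by move/eqP => E; left; apply: card4_K4.
right; have V4 : 4 < #|gV H| by rewrite ltn_neqAle eq_sym n4.
case/plonelyP: (luv) => p [pp puv uniq].
have [a [b [d [pab ead ebd]]]] := pm_triangle sH pp puv uniq cH tE V3.
have eab : gE H a b by rewrite -pab pmf_edge.
pose c (i : 'I_3) := if i == 0 :> nat then a else if i == 1 :> nat then b else d.
have cc i j : gE H (c i) (c j) = (i != j).
  rewrite -val_eqE /c; case: i j => [[|[|[|//]]] ?] [[|[|[|//]]] ?] /=;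
    by rewrite ?(edge_irr sH) // (edge_sym sH).
have [G [x [nb [h [sG tri]]]]] := contract_triangle sH cH tE V4 cc.
pose o1 : 'I_3 := Ordinal (isT : 1 < 3).
(* The numbering of the triangle puts its matching edge at the indices 0 and 1, so that
   [plonely_down] carries the lonely edge to the contracted graph. *)
have pc : p (c ord0) = c o1 by [].
have [u' [v' l']] := plonely_down tri sG pp pc puv luv.
have cG := proj2 (tri_cubic tri sG) cH.
have V3G : 3 < #|gV G| by apply: cubic_card => //; apply/card_gt0P; exists x.
exists G; split.
- apply: in_U_plonely => //; last by exists u', v'.
  by apply: three_edge_connected_vertex => //; apply: tri_3ec_down tri sG tE.
- by apply/tri_stepP; exists x, nb, h, c.
- by rewrite (tri_card tri); lia.
Qed.

(** * Structure of the graphs with a lonely edge *)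

Section Commute.
Variables (G H K : graph) (x y : gV G).
Variables (nb1 : 'I_3 -> gV G) (h1 : gV G -> gV H) (c1 : 'I_3 -> gV H).
Variables (nb2 : 'I_3 -> gV H) (h2 : gV H -> gV K) (c2 : 'I_3 -> gV K).
Hypotheses (sG : simple_graph G) (yx : y != x).
Hypotheses (tri1 : tri_at x nb1 h1 c1) (tri2 : tri_at (h1 y) nb2 h2 c2).

Let sH : simple_graph H := tri_simple tri1 sG.

(** This pushes a replacement at an old vertex below a previous replacement, the tool for all
    inductions on patterns. The final equations trace where labelled vertices and attachments go. *)
Lemma tri_commute : exists H' nb1' h1' c1' nb2' h2' c2',
  [/\ @tri_at G H' y nb1' h1' c1', @tri_at H' K (h1' x) nb2' h2' c2',
      [/\ forall u, u != x -> u != y -> h2' (h1' u) = h2 (h1 u),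
      forall i, c2' i = h2 (c1 i) & forall j, h2' (c1' j) = c2 j],
      forall i, nb1 i != y -> nb2' i = h1' (nb1 i) &
      forall j u, u != x -> nb2 j = h1 u -> nb1' j = u].
Proof.
pose pr := tri_proj x h1 c1.
have prh u : u != x -> pr (h1 u) = u := tri_proj_h tri1 (u:=u).
have prc i : pr (c1 i) = x := tri_proj_c tri1 i.
have xy : x != y by rewrite eq_sym.
pose nb1' j := pr (nb2 j).
have nb2P j : (exists u, [/\ u != x, nb2 j = h1 u & gE G y u]) \/
              (exists i, nb2 j = c1 i /\ nb1 i = y).
  have := nb_edge tri2 j; case: (tri_cover tri1 (nb2 j)) => [[u ux ->]|[i ->]].
    by rewrite (tri_hh tri1) // => yu; left; exists u.
  by rewrite (tri_hc tri1) // => /eqP->; right; exists i.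
have nb1'inj : injective nb1'.
  move=> j j'; rewrite /nb1' => E; apply: (tri_nb_inj tri2).
  case: (nb2P j) (nb2P j') E => [[u [ux -> _]]|[i [-> yi]]] [[u' [u'x -> _]]|[i' [-> yi']]].
  - by rewrite !prh // => ->.
  - by rewrite prh // prc => E; rewrite E eqxx in ux.
  - by rewrite prh // prc => E; rewrite -E eqxx in u'x.
  - by have -> // : i = i' by apply: (tri_nb_inj tri1); rewrite yi yi'.
have nb2c i : nb1 i = y -> exists j, nb2 j = c1 i.
  by move=> yi; apply/(tri_nbE tri2); rewrite (tri_hc tri1) // yi.
have nb1'E v : gE G y v <-> exists j, nb1' j = v.
  have [->|vx] := eqVneq v x; split.
  - rewrite (edge_sym sG) => /(tri_nbE tri1)[i /nb2c[j Ej]].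
    by exists j; rewrite /nb1' Ej prc.
  - case=> j; rewrite /nb1'; case: (nb2P j) => [[u [ux -> _]]|[i [-> <-]] _].
      by rewrite prh // => E; rewrite E eqxx in ux.
    by rewrite (edge_sym sG); apply: (nb_edge tri1).
  - rewrite -(tri_hh tri1) // => /(tri_nbE tri2)[j E].
    by exists j; rewrite /nb1' E prh.
  - case=> j; rewrite /nb1'; case: (nb2P j) => [[u [ux -> yu]]|[i [-> _]]].
      by rewrite prh // => <-.
    by rewrite prc => E; rewrite E eqxx in vx.
have [H' [h1' [c1' tri1']]] : exists H' h1' c1', @tri_at G H' y nb1' h1' c1'.
  by do 3!eexists; apply: replace_tri_at.
pose J i := odflt ord0 [pick j | nb2 j == c1 i].
have JE i : nb1 i = y -> nb2 (J i) = c1 i.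
  move=> /nb2c[j Ej]; rewrite /J; case: pickP => [j' /eqP//|/(_ j)].
  by rewrite Ej eqxx.
have h1y u : u != x -> u != y -> h1 u != h1 y.
  by move=> ux uy; apply: contra uy => /eqP/(tri_h_inj tri1 ux yx)->.
have c1y i : c1 i != h1 y by rewrite eq_sym; apply: (tri_hNc tri1).
(* If [y] is a neighbour of [x], the triangle for [x] must attach to the vertex of the triangle for
   [y] that faces [x]; [J] gives its index. *)
pose nb2' i : gV H' := if nb1 i == y then c1' (J i) else h1' (nb1 i).
pose h2' := tri_case y h1' c1' (fun u => h2 (h1 u)) c2.
have h2h u : u != y -> h2' (h1' u) = h2 (h1 u) by move=> uy; rewrite /h2' (tri_case_h tri1').
have h2c j : h2' (c1' j) = c2 j by rewrite /h2' (tri_case_c tri1').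
have cov (w : gV H') : [\/ w = h1' x, (exists u, [/\ u != x, u != y & w = h1' u]) | exists j, w = c1' j].
  case: (tri_cover tri1' w) => [[u uy ->]|[j ->]]; last by constructor 3; exists j.
  by have [->|ux] := eqVneq u x; [constructor 1|constructor 2; exists u].
have nbu u j : u != x -> (u == nb1' j) = (h1 u == nb2 j).
  move=> ux; rewrite /nb1'; apply/eqP/eqP => [|<-]; last by rewrite prh.
  case: (nb2P j) => [[v [vx -> _]]|[i [-> _]]]; first by rewrite prh // => ->.
  by rewrite prc => E; rewrite E eqxx in ux.
have nb2'c i j : (c1' j == nb2' i) = (c1 i == nb2 j).
  rewrite /nb2'; case: (eqVneq (nb1 i) y) => yi.
    rewrite (inj_eq (tri_c_inj tri1')) -(JE i yi) (inj_eq (tri_nb_inj tri2)).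
    exact: eq_sym.
  rewrite eq_sym (negbTE (tri_hNc tri1' _ yi)); apply/esym/eqP => E.
  have := nb_edge tri2 j; rewrite -E (tri_hc tri1) // eq_sym.
  by rewrite (negbTE yi).
have nb2'h i u : u != y -> (h1' u == nb2' i) = (u == nb1 i).
  move=> uy; rewrite /nb2'; case: (eqVneq (nb1 i) y) => [yi|yi].
    by rewrite yi (negbTE uy); apply/negbTE/(tri_hNc tri1').
  apply/eqP/eqP => [|->//]; exact: (tri_h_inj tri1').
exists H', nb1', h1', c1', nb2', h2', (h2 \o c1); split=> //.
- split=> /=.
  + move=> i i'; rewrite /nb2'; case: (eqVneq (nb1 i) y) => yi; case: (eqVneq (nb1 i') y) => yi'.
    * by move=> _; apply: (tri_nb_inj tri1); rewrite yi yi'.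
    * by move=> E; have := tri_hNc tri1' (J i) yi'; rewrite E eqxx.
    * by move=> E; have := tri_hNc tri1' (J i') yi; rewrite E eqxx.
    * by move=> /(tri_h_inj tri1' yi yi') /(tri_nb_inj tri1).
  + move=> w; case: (tri_cover tri1' w) => [[u uy ->]|[j ->]].
      rewrite (tri_hh tri1') //; split=> [/(tri_nbE tri1)[i Ei]|[i /esym/eqP]].
        by exists i; apply/esym/eqP; rewrite nb2'h ?Ei.
      by rewrite nb2'h // => /eqP->; apply: (nb_edge tri1).
    rewrite (tri_hc tri1') //; split.
      move/eqP=> Ex; case: (nb2P j) => [[u [ux Eu _]]|[i [Ei _]]].
        by move: Ex; rewrite /nb1' Eu prh // => E; rewrite -E eqxx in ux.
      by exists i; apply/esym/eqP; rewrite nb2'c Ei.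
    case=> i /esym/eqP; rewrite nb2'c => /eqP Ei.
    by rewrite /nb1' -Ei prc.
  + move=> w w'; case: (cov w) => [->|[u [ux uy ->]]|[j ->]]; rewrite ?eqxx //;
      case: (cov w') => [->|[u' [ux' uy' ->]]|[j' ->]]; rewrite ?eqxx // => _ _.
    * by rewrite !h2h // (tri_hh tri2) ?h1y // (tri_hh tri1) // (tri_hh tri1').
    * by rewrite h2h // h2c (tri_hc tri2) ?h1y // (tri_hc tri1') // nbu.
    * by rewrite h2h // h2c (tri_ch tri2) ?h1y // (tri_ch tri1') // nbu.
    * by rewrite !h2c (tri_cc tri2) (tri_cc tri1').
  + move=> w i; case: (cov w) => [->|[u [ux uy ->]]|[j ->]]; rewrite ?eqxx // => _.
    * by rewrite h2h // (tri_hh tri2) ?h1y // (tri_hc tri1) // nb2'h.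
    * by rewrite h2c (tri_ch tri2) // nb2'c.
  + move=> w i; case: (cov w) => [->|[u [ux uy ->]]|[j ->]]; rewrite ?eqxx // => _.
    * by rewrite h2h // (tri_hh tri2) ?h1y // (tri_ch tri1) // nb2'h.
    * by rewrite h2c (tri_hc tri2) // nb2'c.
  + by move=> i i'; rewrite (tri_hh tri2) // (tri_cc tri1).
  + move=> w w'; case: (cov w) => [->|[u [ux uy ->]]|[j ->]]; rewrite ?eqxx //;
      case: (cov w') => [->|[u' [ux' uy' ->]]|[j' ->]]; rewrite ?eqxx // => _ _.
    * by rewrite !h2h // => /(tri_h_inj tri2 (h1y _ ux uy) (h1y _ ux' uy')) /(tri_h_inj tri1 ux ux') ->.
    * by rewrite h2h // h2c => E; have := tri_hNc tri2 j' (h1y _ ux uy); rewrite E eqxx.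
    * by rewrite h2h // h2c => E; have := tri_hNc tri2 j (h1y _ ux' uy'); rewrite E eqxx.
    * by rewrite !h2c => /(tri_c_inj tri2) ->.
  + by move=> i i' /(tri_h_inj tri2 (c1y _) (c1y _)) /(tri_c_inj tri1).
  + move=> w i; case: (cov w) => [->|[u [ux uy ->]]|[j ->]]; rewrite ?eqxx // => _.
    * rewrite h2h //; apply: contra (tri_hNc tri1 i ux) => /eqP.
      by move/(tri_h_inj tri2 (h1y _ ux uy) (c1y _))->.
    * by rewrite h2c eq_sym; apply: (tri_hNc tri2).
  + move=> a; case: (tri_cover tri2 a) => [[b by_ ->]|[j ->]]; last first.
      by left; exists (c1' j); rewrite ?h2c // eq_sym; apply: (tri_hNc tri1').
    case: (tri_cover tri1 b) by_ => [[u ux ->]|[i ->]] by_; last by right; exists i.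
    have uy : u != y by apply: contraNneq by_ => ->.
    left; exists (h1' u); last by rewrite h2h.
    by apply: contra ux => /eqP/(tri_h_inj tri1' uy xy)->.
- by split=> // u ux uy; rewrite h2h.
- by move=> i yi; rewrite /nb2' (negbTE yi).
by move=> j u ux E; rewrite /nb1' E prh.
Qed.
End Commute.

(** * Replacements between small graphs, by evaluation *)

Definition tri_check (n m : nat) (eG eH : rel nat) (x : nat) (nb h c : nat -> nat) : bool :=
  let I := iota 0 3 in let U := [seq u <- iota 0 n | u != x] in
  [&& x < n,
      all (fun i => [&& nb i < n, c i < m & all (fun j => (nb i == nb j) ==> (i == j)) I]) I,
      all (fun v => eG x v == has (fun i => nb i == v) I) (iota 0 n),
      all (fun u => [&& h u < m,
             all (fun v => (eH (h u) (h v) == eG u v) && ((h u == h v) ==> (u == v))) U &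
             all (fun i => [&& eH (h u) (c i) == (u == nb i), eH (c i) (h u) == (u == nb i)
                             & h u != c i]) I]) U,
      all (fun i => all (fun j => (eH (c i) (c j) == (i != j)) && ((c i == c j) ==> (i == j))) I) I &
      all (fun a => has (fun u => a == h u) U || has (fun i => a == c i) I) (iota 0 m)].

(** Concrete instances of [tri_at] become a boolean test on natural numbers, settled by
    [vm_compute]; ordinals enter only through [inord]. *)
Lemma tri_checkP n m (eG : rel 'I_n.+1) (eH : rel 'I_m.+1) (eGn eHn : rel nat) x nb h c :
  (forall i j : 'I_n.+1, eG i j = eGn i j) -> (forall i j : 'I_m.+1, eH i j = eHn i j) ->
  tri_check n.+1 m.+1 eGn eHn x nb h c ->
  @tri_at (Graph eG) (Graph eH) (inord x) (fun i => inord (nb i)) (fun u => inord (h u))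
    (fun i => inord (c i)).
Proof.
move=> EG EH /and5P[xn /allP C1 /allP C2 /allP C3 /andP[/allP C4 /allP C5]].
have I3 (i : 'I_3) : (i : nat) \in iota 0 3 by rewrite mem_iota /= ltn_ord.
have In (u : 'I_n.+1) : (u : nat) \in iota 0 n.+1 by rewrite mem_iota /= ltn_ord.
have xv : nat_of_ord (@inord n x) = x by rewrite inordK.
have IU (u : 'I_n.+1) : u != inord x -> (u : nat) \in [seq u <- iota 0 n.+1 | u != x].
  by rewrite mem_filter In andbT -val_eqE /= inordK.
have nbv (i : 'I_3) : nat_of_ord (@inord n (nb i)) = nb i.
  by rewrite inordK //; case/and3P: (C1 i (I3 i)).
have cv (i : 'I_3) : nat_of_ord (@inord m (c i)) = c i.
  by rewrite inordK //; case/and3P: (C1 i (I3 i)).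
have hv (u : 'I_n.+1) : u != inord x -> nat_of_ord (@inord m (h u)) = h u.
  by move=> /IU /C3 /and3P[hu _ _]; rewrite inordK.
split=> /=.
- move=> i j /(congr1 val) /=; rewrite !nbv => E; apply: val_inj => /=.
  by case/and3P: (C1 i (I3 i)) => _ _ /allP /(_ j (I3 j)); rewrite E eqxx => /eqP.
- move=> v; rewrite EG xv (eqP (C2 v (In v))); split.
    case/hasP => i; rewrite mem_iota /= => lt /eqP E; exists (Ordinal lt).
    by apply: val_inj; rewrite /= (nbv (Ordinal lt)).
  by case=> i <-; apply/hasP; exists (i : nat); rewrite ?I3 // nbv.
- move=> u v ux vx; rewrite EH EG !hv //; apply/eqP.
  by case/and3P: (C3 u (IU u ux)) => _ /allP /(_ v (IU v vx)) /andP[].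
- move=> u i ux; rewrite EH hv // cv -val_eqE /= nbv; apply/eqP.
  by case/and3P: (C3 u (IU u ux)) => _ _ /allP /(_ i (I3 i)) /and3P[].
- move=> u i ux; rewrite EH hv // cv -val_eqE /= nbv; apply/eqP.
  by case/and3P: (C3 u (IU u ux)) => _ _ /allP /(_ i (I3 i)) /and3P[].
- move=> i j; rewrite EH !cv -val_eqE /=; apply/eqP.
  by move/allP: (C4 i (I3 i)) => /(_ j (I3 j)) /andP[].
- move=> u v ux vx /(congr1 val) /=; rewrite !hv // => E; apply: val_inj => /=.
  by case/and3P: (C3 u (IU u ux)) => _ /allP /(_ v (IU v vx)) /andP[_]; rewrite E eqxx => /eqP.
- move=> i j /(congr1 val) /=; rewrite !cv => E; apply: val_inj => /=.
  by move/allP: (C4 i (I3 i)) => /(_ j (I3 j)) /andP[_]; rewrite E eqxx => /eqP.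
- move=> u i ux; rewrite -val_eqE /= hv // cv.
  by case/and3P: (C3 u (IU u ux)) => _ _ /allP /(_ i (I3 i)) /and3P[].
move=> a; have : (a : nat) \in iota 0 m.+1 by rewrite mem_iota /= ltn_ord.
case/C5/orP => /hasP[k]; rewrite ?mem_filter mem_iota /=.
  case/andP=> kx lt /eqP E; left; exists (Ordinal lt : 'I_n.+1).
    by rewrite -val_eqE /= xv.
  by apply: val_inj; rewrite /= -E inord_val.
by move=> lt /eqP E; right; exists (Ordinal lt); rewrite /= -E inord_val.
Qed.

Definition sym_list (l : seq (nat * nat)) : rel nat :=
  fun i j => ((i, j) \in l) || ((j, i) \in l).

(* The prism with one vertex a of T_v replaced: T_u = {0,1,2}, the new triangle
   is {3,4,5}, and the two other vertices of the old T_v are 6 and 7. *)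
Definition rung_vertex (a k : nat) : nat := 6 + (if a < k then k.-1 else k).
Definition ext1_edges (a : nat) : seq (nat * nat) :=
  [:: (0,1); (0,2); (1,2); (3,4); (3,5); (4,5); (6,7); (a, 3 + a)] ++
  flatten [seq [:: (k, rung_vertex a k); (rung_vertex a k, 3 + k)] | k <- iota 0 3 & k != a].
Definition ext1 (a : nat) : graph := @Graph 'I_8 (fun i j => sym_list (ext1_edges a) i j).

Definition prism_rel : rel nat :=
  fun i j => (i != j) && (((i < 3) == (j < 3)) || (i %% 3 == j %% 3)).

Lemma ord3P (P : 'I_3 -> Prop) :
  P (Ordinal (isT : 0 < 3)) -> P (Ordinal (isT : 1 < 3)) -> P (Ordinal (isT : 2 < 3)) ->
  forall i, P i.
Proof. by move=> P0 P1 P2 [[|[|[|//]]] lt]; rewrite (bool_irrelevance lt isT). Qed.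

Lemma ext1_lab (a : 'I_3) : exists nb c,
  [/\ @tri_at prism (ext1 a) (lab prism_l a) nb (fun u : 'I_6 => @inord 7 (if u < 3 then u : nat else rung_vertex a (u - 3))) c,
      forall j, j != a -> nb j = lab prism_l j & forall i, c i = @inord 7 (3 + i)].
Proof.
exists (fun i : 'I_3 => @inord 5 ((fun i : nat => if i == a then a : nat else i + 3) i)), (fun i : 'I_3 => @inord 7 ((fun i => 3 + i) i)).
split=> //; last by move=> j ja; rewrite val_eqE (negbTE ja).
apply: (@tri_checkP 5 7 (gE prism) (gE (ext1 a)) prism_rel (sym_list (ext1_edges a)) (a + 3)
  (fun i => if i == a then a : nat else i + 3)
  (fun u => if u < 3 then u else rung_vertex a (u - 3)) (fun i => 3 + i)) => //.
by elim/ord3P: a; vm_compute.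
Qed.

(** With [ext1_lab] this shows that replacing vertex [a] of [T_u] or of [T_v] gives the same graph:
    the rung at [a] stays, and the other two rungs acquire adjacent middle vertices. So a
    replacement in the base is an extension in disguise. *)
Lemma ext1_base (a : 'I_3) : exists nb c,
  [/\ @tri_at prism (ext1 a) (@inord 5 a) nb (fun u : 'I_6 => @inord 7 (if u < 3 then rung_vertex a u else u)) c &
      forall i, c i = @inord 7 i].
Proof.
exists (fun i : 'I_3 => @inord 5 ((fun i : nat => if i == a then a + 3 else i) i)), (fun i : 'I_3 => @inord 7 ((fun i : nat => i) i)).
split=> //.
apply: (@tri_checkP 5 7 (gE prism) (gE (ext1 a)) prism_rel (sym_list (ext1_edges a)) a
  (fun i => if i == a then a + 3 else i)
  (fun u => if u < 3 then rung_vertex a u else u) (fun i => i)) => //.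
by elim/ord3P: a; vm_compute.
Qed.

(** The two end triangles and the one replacing a middle vertex are the three triangles of the
    tricorn; the other middle vertex becomes its vertex 0, the default value of [h]. *)
Lemma ext1_tricorn (s i : 'I_3) : s != i -> exists nb h c,
  @tri_at (ext1 s) tricorn (@inord 7 (rung_vertex s i)) nb h c.
Proof.
move=> si; pose k := 3 - s - i.
pose nb (j : nat) := if j == 0 then rung_vertex s k else if j == 1 then nat_of_ord i else 3 + i.
pose h u := if u == k then 1 else if u == i then 2 else if u == s then 3 else
  if u == 3 + k then 7 else if u == 3 + s then 8 else if u == 3 + i then 9 else 0.
exists (fun j : 'I_3 => @inord 7 (nb j)), (fun u : 'I_8 => @inord 9 (h u)), (fun j : 'I_3 => @inord 9 (4 + j)).
apply: (@tri_checkP 7 9 (gE (ext1 s)) (gE tricorn) (sym_list (ext1_edges s))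
  (sym_list tricorn_edges) _ nb h (fun j => 4 + j)) => //.
rewrite /nb /h /k {nb h k}; move: si.
by elim/ord3P: s; elim/ord3P: i => // _; vm_compute.
Qed.

Lemma K4_simple : simple_graph K4.
Proof. by split=> [u v|u] /=; rewrite ?eqxx // eq_sym. Qed.

Lemma prism_tri : @tri_at K4 prism (@inord 3 3) (fun i : 'I_3 => @inord 3 i)
  (fun u : 'I_4 => @inord 5 u) (fun i : 'I_3 => @inord 5 (3 + i)).
Proof.
exact: (@tri_checkP 3 5 (gE K4) (gE prism) (fun i j => i != j) prism_rel 3 id id (fun j => 3 + j)).
Qed.

Lemma K4_prism H (x : gV K4) nb h c : @tri_at K4 H x nb h c -> iso H prism.
Proof.
move=> tri; have tri' := prism_tri; have sK := K4_simple.
have nbx := tri_nbx tri sK; have nbE := nb_idxE tri; have nbK := nb_idxK tri.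
pose f (v : gV K4) : gV K4 := if v == x then @inord 3 3 else @inord 3 (nb_idx nb v).
have fx : f x = @inord 3 3 by rewrite /f eqxx.
have fnb i : f (nb i) = @inord 3 i by rewrite /f (negbTE (nbx i)) nbK.
have finj : injective f.
  have f3 v : v != x -> f v != @inord 3 3.
    move=> vx; rewrite /f (negbTE vx) -val_eqE /= !inordK //.
      by rewrite neq_ltn ltn_ord.
    exact: leq_trans (ltn_ord _) _.
  move=> u v; have [->|ux] := eqVneq u x; have [->|vx] := eqVneq v x => //.
  - by move=> E; have := f3 v vx; rewrite -E fx eqxx.
  - by move=> E; have := f3 u ux; rewrite E fx eqxx.
  rewrite /f (negbTE ux) (negbTE vx) => /(congr1 val) /=; rewrite !inordK ?(leq_trans (ltn_ord _)) // => /ord_inj E.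
  have xu : gE K4 x u by rewrite /= eq_sym.
  have xv : gE K4 x v by rewrite /= eq_sym.
  by rewrite -(nbE _ xu) E nbE.
have fi : is_iso f by split=> [|u v]; [apply: injF_bij|rewrite /= (inj_eq finj)].
have [g [gi _ _]] := tri_unique (s := id) tri tri' fi fx fnb.
by exists g.
Qed.

Lemma K4_cubic : cubic K4.
Proof.
move=> u; rewrite (eq_card (B := predC1 u)) ?cardC1 ?card_ord // => v.
by rewrite !inE eq_sym.
Qed.

Lemma K4_3ec : three_edge_connected K4.
Proof.
move=> X X0 XT; have -> : cut X (~: X) = #|X| * #|~: X|.
  rewrite /cut -sum_nat_const; apply: eq_bigr => x xX.
  rewrite -sum1_card; apply: eq_bigr => y; rewrite inE => yX /=.
  by case: eqP => // E; rewrite -E xX in yX.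
have CX0 : ~: X != set0.
  by apply: contraNneq XT => E; rewrite -[X]setCK E setC0.
rewrite -!card_gt0 in X0 CX0; have := cardsC X; rewrite card_ord.
by move: #|_| #|_| X0 CX0 => [|[|[|[|n]]]] [|[|[|[|m]]]]; lia.
Qed.

Lemma prism_simple : simple_graph prism. Proof. exact: tri_simple prism_tri K4_simple. Qed.

(** * Replacements in extended prisms *)

Record label_ok (L : lgraph) : Prop := LabelOk {
  lok_simple : simple_graph (lgr L);
  lok_cubic : cubic (lgr L);
  lok_3ec : three_edge_connected (lgr L);
  lok_tri : forall i j, gE (lgr L) (lab L i) (lab L j) = (i != j) }.

Definition liso (L L' : lgraph) : Prop :=
  exists f : gV (lgr L) -> gV (lgr L'), is_iso f /\ forall i, f (lab L i) = lab L' i.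

Section Ext.
Variables (L : lgraph) (s : 'I_3) (w : gV (lgr L)).
Hypotheses (okL : label_ok L) (sw : gE (lgr L) (lab L s) w) (wl : forall j, w != lab L j).

Lemma lab_inj : injective (lab L).
Proof. exact: tri_inj (lok_simple okL) (lok_tri okL). Qed.

Lemma ext_nb_inj : injective (ext_nb s w).
Proof.
move=> i j; rewrite /ext_nb; do 2!case: eqP => [->|?] //; last by move/lab_inj.
  by move=> E; have := wl j; rewrite E eqxx.
by move=> E; have := wl i; rewrite E eqxx.
Qed.

Lemma ext_nbE v : gE (lgr L) (lab L s) v <-> exists i, ext_nb s w i = v.
Proof.
split=> [sv|[i <-]]; last first.
  by rewrite /ext_nb; case: eqP => // /eqP; rewrite (lok_tri okL) eq_sym.
have [/imsetP[i _ Ev]|vT] := boolP (v \in [set lab L i | i in 'I_3]).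
  exists i; rewrite /ext_nb; case: eqP => // E.
  by rewrite Ev E (edge_irr (lok_simple okL)) in sv.
have [w' [_ _ uw]] := outer_ex (lok_simple okL) (lok_cubic okL) (lok_tri okL) s.
exists s; rewrite /ext_nb eqxx (uw v) // (uw w) //.
by apply/imsetP => -[j _ E]; have := wl j; rewrite E eqxx.
Qed.

Lemma ext_tri : @tri_at _ (replace_tri (lab L s) (ext_nb s w)) (lab L s) (ext_nb s w)
  (rep_inl (lab L s)) inr.
Proof. exact: replace_tri_at ext_nb_inj ext_nbE. Qed.

End Ext.

Lemma lok_outer L : label_ok L -> forall s,
  exists2 w, gE (lgr L) (lab L s) w & forall j, w != lab L j.
Proof.
move=> okL s; have [w [wT sw _]] := outer_ex (lok_simple okL) (lok_cubic okL) (lok_tri okL) s.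
exists w => // j; apply: contraNneq wT => ->; exact: imset_f.
Qed.

Lemma label_ok_tri L x nb H h c : label_ok L ->
  @tri_at (lgr L) H x nb h c -> label_ok (@LGraph H c).
Proof.
move=> [sL cL tL _] tri; split=> /=.
- exact: tri_simple tri sL.
- exact/(tri_cubic tri sL).
- exact: tri_3ec_up tri sL cL tL.
- exact: tri_cc tri.
Qed.

Lemma prism_ok : label_ok prism_l.
Proof.
split; first exact: prism_simple.
- exact: (proj1 (tri_cubic prism_tri K4_simple) K4_cubic).
- exact: tri_3ec_up prism_tri K4_simple K4_cubic K4_3ec.
by move=> i j; rewrite /= -val_eqE /= !inordK; elim/ord3P: i; elim/ord3P: j.
Qed.

Lemma ep_ok p L : is_ext_prism p L -> label_ok L.
Proof.
elim=> [|{}p {}L s w EP okL sw wl]; first exact: prism_ok.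
by apply: label_ok_tri okL (ext_tri okL sw wl).
Qed.

(** The isomorphism has to respect labels, because the next extension refers to them. *)
Lemma ep_extend p L s nb H h c : is_ext_prism p L -> @tri_at (lgr L) H (lab L s) nb h c ->
  (forall j, j != s -> nb j = lab L j) ->
  exists2 L', is_ext_prism (rcons p s) L' & liso (@LGraph H c) L'.
Proof.
move=> EP tri nbl; have okL := ep_ok EP; set w := nb s.
have sw : gE (lgr L) (lab L s) w by apply: (nb_edge tri).
have wl j : w != lab L j.
  have [->|js] := eqVneq j s; first exact: (tri_nbx tri (lok_simple okL)).
  by rewrite -nbl // (inj_eq (tri_nb_inj tri)) eq_sym.
exists (@LGraph (replace_tri (lab L s) (ext_nb s w)) (fun j => inr j)); first exact: EPS.
have nbE i : id (nb i) = ext_nb s w (id i).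
  by rewrite /ext_nb; case: eqP => [->//|/eqP/nbl].
have idi : @is_iso (lgr L) (lgr L) id by split=> //; exists id.
have [g [gi _ gc]] := tri_unique tri (ext_tri okL sw wl) idi erefl nbE.
by exists g.
Qed.

Lemma tri_relabel L s nb H h c : label_ok L -> @tri_at (lgr L) H (lab L s) nb h c ->
  exists nb' c', @tri_at (lgr L) H (lab L s) nb' h c' /\ forall j, j != s -> nb' j = lab L j.
Proof.
move=> okL tri; have [w sw wl] := lok_outer okL s.
pose t j := nb_idx nb (ext_nb s w j).
have tE j : nb (t j) = ext_nb s w j.
  by apply: (nb_idxE tri); apply/(ext_nbE okL sw wl); exists j.
have ti : injective t.
  by move=> i j E; apply: (ext_nb_inj okL wl (s := s)); rewrite -!tE E.
exists (nb \o t), (c \o t); split; first exact: tri_perm.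
by move=> j js; rewrite /= tE /ext_nb (negbTE js).
Qed.

Lemma tri_unique_at G x nb H h c nb' H' h' c' : simple_graph G ->
  @tri_at G H x nb h c -> @tri_at G H' x nb' h' c' ->
  exists g : gV H -> gV H', is_iso g /\ forall u, u != x -> g (h u) = h' u.
Proof.
move=> sG tri tri'; have idi : @is_iso G G id by split=> //; exists id.
have nbE i : id (nb i) = nb' (nb_idx nb' (nb i)).
  by rewrite (nb_idxE tri') //; apply: (nb_edge tri).
by have [g [gi gh _]] := tri_unique tri tri' idi erefl nbE; exists g.
Qed.

Lemma tri_iso_at G G' H x nb h c (f : gV G -> gV G') : @tri_at G H x nb h c -> is_iso f ->
  exists h', @tri_at G' H (f x) (f \o nb) h' c /\ forall u, h' (f u) = h u.
Proof.
move=> tri [[g fK gK] fE]; exists (h \o g); split; last by move=> u /=; rewrite fK.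
by apply: (tri_iso_src tri gK fK) => u v; rewrite -fE !gK.
Qed.

Definition tricorn_like (G : graph) : Prop := iso G tricorn \/ descendant tricorn G.

Lemma tri_step_iso G G' H : iso G G' -> tri_step G H -> tri_step G' H.
Proof.
move=> [f fi] /tri_stepP[x [nb [h [c tri]]]].
have [h' [tri' _]] := tri_iso_at tri fi.
by apply/tri_stepP; do 4!eexists; apply: tri'.
Qed.

Lemma tricorn_like_step G H : tricorn_like G -> tri_step G H -> tricorn_like H.
Proof.
case=> [iG sGH|dG sGH]; right; last exact: descS dG sGH.
exact: desc1 (tri_step_iso iG sGH).
Qed.

Lemma prism_lab_cases (y : gV prism) :
  (exists a : 'I_3, y = @inord 5 a) \/ (exists a, y = lab prism_l a).
Proof.
case: (ltnP y 3) => y3; [left|right].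
  by exists (Ordinal y3); rewrite /= inord_val.
have lt : y - 3 < 3 by have := ltn_ord y; lia.
by exists (Ordinal lt); apply: val_inj; rewrite /= subnK // inord_val.
Qed.

Fact addn3_ltF i : (i + 3 < 3) = false. Proof. by lia. Qed.

Lemma prism_extend_base (y : gV prism) nb H h c : (forall i, y != lab prism_l i) ->
  @tri_at prism H y nb h c ->
  exists a L, is_ext_prism [:: a] L /\ liso (@LGraph H (h \o lab prism_l)) L.
Proof.
move=> yl tri; case: (prism_lab_cases y) => [[a Ey]|[a Ey]]; last first.
  by have := yl a; rewrite Ey eqxx.
exists a; have [nb1 [c1 [tri1 nl1 c1E]]] := ext1_lab a.
have [L EL [g [gi gl]]] := ep_extend EP0 tri1 nl1.
have [nb2 [c2 [tri2 c2E]]] := ext1_base a.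
rewrite Ey in tri; have [f [fi fh]] := tri_unique_at prism_simple tri tri2.
exists L; split=> //; exists (g \o f); split.
  case: fi gi => bf fE [bg gE]; split; first exact: bij_comp.
  by move=> u v; rewrite /= gE fE.
move=> i; rewrite /= fh; last by have := yl i; rewrite Ey eq_sym.
rewrite -gl /= c1E inordK; last by have := ltn_ord i; lia.
by rewrite addn3_ltF addnC.
Qed.

Lemma ep_rcons_inv q L : is_ext_prism q L -> (q = [::] /\ L = prism_l) \/
  exists p L0 s w, [/\ q = rcons p s, is_ext_prism p L0, gE (lgr L0) (lab L0 s) w,
    forall j, w != lab L0 j &
    L = @LGraph (replace_tri (lab L0 s) (ext_nb s w)) (fun j => inr j)].
Proof.
case=> [|p L0 s w EP sw wl]; first by left.
by right; exists p, L0, s, w.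
Qed.

Lemma ep_unshift p a L : is_ext_prism (a :: p) L ->
  exists L0 y nb h c, [/\ is_ext_prism p L0, forall i, y != lab L0 i,
    @tri_at (lgr L0) (lgr L) y nb h c & forall i, h (lab L0 i) = lab L i].
Proof.
elim/last_ind: p L => [|p s IH] L /ep_rcons_inv [[//]|[p0 [L0 [s0 [w [Ep EP0' sw wl EL]]]]]].
  have [Ep0 Es0] : p0 = [::] /\ s0 = a.
    by case: p0 Ep {EP0'} => [|b p0] /= => [[->]|[_]] //; case: p0.
  subst p0 s0 L.
  case: (ep_rcons_inv EP0') => [[_ EL0]|[p1 [? [? [? [E]]]]]]; last by case: p1 E.
  subst L0; set L := @LGraph _ _; have okP := prism_ok.
  have tri := ext_tri okP sw wl.
  have [nb1 [c1 [tri1 nl1 c1E]]] := ext1_lab a.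
  have [nb2 [c2 [tri2 c2E]]] := ext1_base a.
  have nbE i : id (nb1 i) = ext_nb (L := prism_l) a w (id i).
    rewrite /ext_nb; case: eqP => [->|/eqP/nl1//].
    have [k Ek] := proj1 (tri_nbE tri1 w) sw; rewrite -Ek; congr nb1.
    by apply/esym/eqP; apply: contraT => /nl1 E; have := wl k; rewrite -Ek E eqxx.
  have idi : @is_iso prism prism id by split=> //; exists id.
  have [g [gi _ gc]] := tri_unique tri1 tri idi erefl nbE.
  exists prism_l, (@inord 5 a), nb2; do 2!eexists; split; first exact: EP0.
  - by move=> i; rewrite -val_eqE /= !inordK; have := ltn_ord a; have := ltn_ord i; lia.
  - exact: (tri_iso tri2 gi).
  move=> i /=; rewrite -gc c1E inordK; last by have := ltn_ord i; lia.
  by rewrite addn3_ltF; congr (g (inord _)); apply: addnC.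
move: Ep; rewrite -rcons_cons => /rcons_inj[Ep Es]; subst p0 s0.
have [L1 [y [nb [h [c [EP1 yl tri hl]]]]]] := IH _ EP0'.
have ok1 := ep_ok EP1; have ok0 := ep_ok EP0'.
subst L; have tri2 := ext_tri ok0 sw wl.
set H := replace_tri _ _ in tri2 *.
have triK : @tri_at (lgr L0) H (h (lab L1 s)) (ext_nb s w) (rep_inl (lab L0 s)) inr by rewrite hl.
have ly : lab L1 s != y by rewrite eq_sym.
have [H' [nb1' [h1' [c1' [nb2' [h2' [c2' [t1 t2 [_ hc2 hc1] _ nbj]]]]]]]] :=
  tri_commute (lok_simple ok1) ly tri triK.
have nl : forall j, j != s -> nb1' j = lab L1 j.
  move=> j js; apply: nbj; first by rewrite eq_sym.
  by rewrite /ext_nb (negbTE js) hl.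
have [L3 EP3 [g [gi gl]]] := ep_extend EP1 t1 nl.
have [h3 [t3 h3g]] := tri_iso_at t2 gi.
exists L3, (g (h1' y)), (g \o nb2'), h3, c2'; split=> //.
  move=> i; rewrite -gl (inj_eq (bij_inj (proj1 gi))).
  by apply: (tri_hNc t1); rewrite eq_sym.
by move=> i; rewrite -gl h3g /= hc1.
Qed.

(** An extension at [s] leaves the two other labelled vertices behind between triangles; replacing
    one of them creates a tricorn. Letters are peeled off the front of the pattern until the prism
    remains, where [ext1_tricorn] decides. *)
Lemma ep_rung p L s i nb1 H h1 c1 nb2 K h2 c2 : is_ext_prism p L -> s != i ->
  @tri_at (lgr L) H (lab L s) nb1 h1 c1 -> @tri_at H K (h1 (lab L i)) nb2 h2 c2 ->
  tricorn_like K.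
Proof.
elim: p L nb1 H h1 c1 nb2 K h2 c2 => [|a p IH] L nb1 H h1 c1 nb2 K h2 c2 EP si tri1 tri2.
  case: (ep_rcons_inv EP) => [[_ EL]|[p1 [? [? [? [E]]]]]]; last by case: p1 E.
  subst L; have [nb3 [c3 [tri3 _ _]]] := ext1_lab s.
  have [g [gi gh]] := tri_unique_at prism_simple tri1 tri3.
  have [h' [tri2' _]] := tri_iso_at tri2 gi.
  have [nb4 [h4 [c4 tri4]]] := ext1_tricorn si.
  have gE : g (h1 (lab prism_l i)) = @inord 7 (rung_vertex s i).
    rewrite gh /=; last first.
      rewrite -val_eqE /= !inordK; [|by have := ltn_ord s; lia|by have := ltn_ord i; lia].
      by move: si; rewrite -val_eqE /=; lia.
    rewrite inordK; last by have := ltn_ord i; lia.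
    by rewrite addn3_ltF addnK.
  rewrite gE in tri2'.
  have sE : simple_graph (ext1 s) by apply: tri_simple tri3 prism_simple.
  have [f [fi _]] := tri_unique_at sE tri2' tri4.
  by left; exists f.
have [L0 [y [nb [h [c [EP0' yl tri hl]]]]]] := ep_unshift EP.
have ok0 := ep_ok EP0'; have s0 := lok_simple ok0.
rewrite -hl in tri1; have ly j : lab L0 j != y by rewrite eq_sym.
(* Two interchanges bring both replacements below the one at the base vertex [y], which then is one
   more step from a tricorn-like graph. *)
have [H1 [nb1' [h1' [c1' [nb2' [h2' [c2' [t1 t2 [hh _ _] _ _]]]]]]]] :=
  tri_commute s0 (ly s) tri tri1.
have s1 := tri_simple t1 s0.
have li : lab L0 i != lab L0 s by rewrite (inj_eq (lab_inj ok0)) eq_sym.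
have Ei : h1 (lab L i) = h2' (h1' (lab L0 i)) by rewrite -hl hh.
rewrite Ei in tri2.
have yi : h1' (lab L0 i) != h1' y.
  by apply: contra (ly i) => /eqP/(tri_h_inj t1 li)-> //; rewrite eq_sym.
have [K1 [? [? [? [? [? [? [u1 u2 _ _ _]]]]]]]] := tri_commute s1 yi t2 tri2.
apply: tricorn_like_step (IH _ _ _ _ _ _ _ _ _ EP0' si t1 u1) _.
by apply/tri_stepP; do 4!eexists; apply: u2.
Qed.

(** The replacement is pushed down the pattern. If it meets a vertex left behind by an extension, a
    tricorn appears; if it reaches the base, it becomes a new first letter. *)
Lemma ep_replace p L : is_ext_prism p L -> forall y nb H h c, (forall i, y != lab L i) ->
  @tri_at (lgr L) H y nb h c ->
  (exists a L2, is_ext_prism (a :: p) L2 /\ liso (@LGraph H (h \o lab L)) L2) \/ tricorn_like H.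
Proof.
elim=> [|{}p {}L s w EP IH sw wl] y nb H h c yl tri2.
  by left; apply: prism_extend_base tri2.
have ok := ep_ok EP; have sL := lok_simple ok; have tri1 := ext_tri ok sw wl.
case: (tri_cover tri1 y) => [[y0 y0s Ey]|[j Ej]]; last by have := yl j; rewrite /= Ej eqxx.
subst y; move: tri2; set K := replace_tri _ _ in tri1 yl *.
move=> tri2; have tri2' : @tri_at K H (rep_inl (lab L s) y0) nb h c := tri2.
have [/existsP[i /eqP Ei]|nl] := boolP [exists i, y0 == lab L i].
  right; rewrite Ei in tri2'; apply: (ep_rung EP _ tri1 tri2').
  by apply: contraNneq y0s => ->; rewrite Ei.
have y0l i : y0 != lab L i by apply: contra nl => /eqP E; apply/existsP; exists i; rewrite E.
have [H0 [nb1' [h1' [c1' [nb2' [h2' [c2' [t1 t2 [_ hc _] nbi _]]]]]]]] :=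
  tri_commute sL y0s tri1 tri2'.
have [[a [L2 [EP2 [f [fi fl]]]]]|TD] := IH _ _ _ _ _ y0l t1; last first.
  right; apply: tricorn_like_step TD _.
  by apply/tri_stepP; do 4!eexists; apply: t2.
left; exists a; have [h3 [t3 _]] := tri_iso_at t2 fi.
rewrite [f _]fl in t3.
have nl3 j : j != s -> (f \o nb2') j = lab L2 j.
  move=> js; rewrite /= nbi /ext_nb (negbTE js); first exact: fl.
  by rewrite eq_sym.
have [L3 EP3 [g [gi gl]]] := ep_extend EP2 t3 nl3.
exists L3; split=> //; exists g; split=> // i.
by rewrite -gl /= hc.
Qed.

Definition K4_tree (G : graph) : Prop :=
  [\/ iso G K4, (exists p L, is_ext_prism p L /\ iso G (lgr L)) | tricorn_like G].

Lemma K4_tree_step G H : K4_tree G -> tri_step G H -> K4_tree H.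
Proof.
case=> [iG|[p [L [EP iG]]]|tG] sGH; last by constructor 3; apply: tricorn_like_step sGH.
  have /tri_stepP[x [nb [h [c tri]]]] := tri_step_iso iG sGH.
  by constructor 2; exists [::], prism_l; split; [exact: EP0|apply: K4_prism tri].
have /tri_stepP[y [nb [h [c tri]]]] := tri_step_iso iG sGH.
have [/existsP[s /eqP Ey]|nl] := boolP [exists i, y == lab L i].
  rewrite Ey in tri; have [nb' [c' [tri' nl']]] := tri_relabel (ep_ok EP) tri.
  have [L' EP' [f [fi _]]] := ep_extend EP tri' nl'.
  by constructor 2; exists (rcons p s), L'; split=> //; exists f.
have yl i : y != lab L i by apply: contra nl => /eqP E; apply/existsP; exists i; rewrite E.
have [[a [L2 [EP2 [f [fi _]]]]]|TD] := ep_replace EP yl tri; last by constructor 3.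
by constructor 2; exists (a :: p), L2; split=> //; exists f.
Qed.

Theorem in_U_K4_tree G : in_U G -> K4_tree G.
Proof.
have [n] := ubnP #|gV G|; elim: n G => // n IH G leG /in_U_reduction[iG|[G' [UG' sG' ltG]]].
  by constructor 1.
by apply: K4_tree_step sG'; apply: IH UG'; apply: leq_trans ltG _.
Qed.

(** * Counting lonely edges *)

(* A perfect matching of a graph on {0,...,n-1} is coded by the table
   [:: p 0; ...; p (n-1)] of its partner function p. *)
Fixpoint pm_prefixes (n : nat) (e : rel nat) (i : nat) : seq (seq nat) :=
  if i is i'.+1 then
    flatten [seq [seq rcons t j | j <- iota 0 n &
       e i' j && (((j < i') || (i' \in t)) ==> (nth 0 t j == i'))] | t <- pm_prefixes n e i']
  else [:: [::]].

Definition pm_table (n : nat) (e : rel nat) (t : seq nat) : bool :=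
  all (fun i => [&& nth 0 t i < n, e i (nth 0 t i) & nth 0 t (nth 0 t i) == i]) (iota 0 n).

(** The prefixes only restrict the search, [pm_table] decides; duplicates are removed so that
    counting entries counts matchings. *)
Definition pm_tables (n : nat) (e : rel nat) : seq (seq nat) :=
  undup [seq t <- pm_prefixes n e n | pm_table n e t].

Lemma pm_prefixesS n e i : pm_prefixes n e i.+1 =
  flatten [seq [seq rcons t j | j <- iota 0 n &
     e i j && (((j < i) || (i \in t)) ==> (nth 0 t j == i))] | t <- pm_prefixes n e i].
Proof. by []. Qed.

Section Tables.
Variables (n : nat) (e : rel 'I_n.+1) (en : rel nat).
Hypothesis eE : forall i j : 'I_n.+1, e i j = en i j.
Let G := Graph e.
Implicit Types (p q : {ffun gV G -> gV G}).

Definition table p : seq nat := mkseq (fun i => nat_of_ord (p (inord i))) n.+1.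

Lemma nth_table p (u : 'I_n.+1) : nth 0 (table p) u = p u.
Proof. by rewrite nth_mkseq ?inord_val // ltn_ord. Qed.

Lemma table_inj : injective table.
Proof.
move=> p q E; apply/ffunP => u; apply: ord_inj.
by rewrite -!nth_table E.
Qed.

Lemma size_prefixes i t : t \in pm_prefixes n.+1 en i -> size t = i.
Proof.
elim: i t => [|i IH] t /=; first by rewrite inE => /eqP->.
by case/flatten_mapP => t' /IH st' /mapP[j _ ->]; rewrite size_rcons st'.
Qed.

Lemma table_pm p : pmf p -> table p \in pm_tables n.+1 en.
Proof.
move=> pp; rewrite mem_undup mem_filter; apply/andP; split.
  apply/allP => i; rewrite mem_iota /= => lt.
  have -> : i = nat_of_ord (Ordinal lt) by [].
  by rewrite nth_table ltn_ord -eE nth_table (pmfK _ pp) eqxx andbT; apply: (pmf_edge _ pp).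
have pre i : i <= n.+1 -> mkseq (fun i => nat_of_ord (p (inord i))) i \in pm_prefixes n.+1 en i.
  elim: i => [|i IH] lt; first by rewrite inE.
  rewrite mkseqS pm_prefixesS; apply/flatten_mapP; exists (mkseq (fun i => nat_of_ord (p (inord i))) i).
    by apply: IH; apply: ltnW.
  apply: map_f; rewrite mem_filter mem_iota leq0n ltn_ord !andbT; apply/andP; split.
    by have := pmf_edge (@inord n i : gV G) pp; rewrite /= eE inordK.
  have ii : nat_of_ord (@inord n i) = i by rewrite inordK.
  apply/implyP; case/orP => [ji|/mapP[i' ]].
    by rewrite nth_mkseq // inord_val (pmfK _ pp) ii.
  rewrite mem_iota /= add0n => i'i Ei.
  have ii' : nat_of_ord (@inord n i') = i' by rewrite inordK //; apply: ltn_trans i'i _.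
  have -> : p (inord i) = inord i'.
    by rewrite -[RHS](pmfK _ pp); congr (p _); apply: ord_inj; rewrite ii.
  by rewrite ii' nth_mkseq // -Ei.
exact: pre.
Qed.

Lemma pm_of_table t : t \in pm_tables n.+1 en -> exists2 p, pmf p & table p = t.
Proof.
rewrite mem_undup mem_filter => /andP[/allP vt /size_prefixes st].
have v (u : 'I_n.+1) : [&& nth 0 t u < n.+1, en u (nth 0 t u) & nth 0 t (nth 0 t u) == u].
  by apply: vt; rewrite mem_iota /= ltn_ord.
pose p : {ffun gV G -> gV G} := [ffun u : 'I_n.+1 => inord (nth 0 t u) : 'I_n.+1].
have pE (u : 'I_n.+1) : nat_of_ord (p u : 'I_n.+1) = nth 0 t u.
  by rewrite ffunE inordK //; case/and3P: (v u).
exists p.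
  apply/pmfP; split=> u; first by rewrite /= eE pE; case/and3P: (v u).
  by apply: ord_inj; rewrite !pE; case/and3P: (v u) => _ _ /eqP.
apply: (@eq_from_nth _ 0); first by rewrite size_mkseq st.
move=> i; rewrite size_mkseq => lt.
by have := nth_table p (Ordinal lt); rewrite pE.
Qed.

Lemma pm_tables_all (Q : pred (seq nat)) :
  all Q (pm_tables n.+1 en) -> forall p, pmf p -> Q (table p).
Proof. by move=> /allP H p /table_pm; apply: H. Qed.

Lemma pm_tables_has (Q : pred (seq nat)) :
  has Q (pm_tables n.+1 en) -> exists2 p, pmf p & Q (table p).
Proof. by case/hasP => t /pm_of_table[p pp <-]; exists p. Qed.

Lemma card_pm (Q : pred (seq nat)) :
  #|[set p | pmf p & Q (table p)]| = count Q (pm_tables n.+1 en).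
Proof.
rewrite cardE -size_filter -(size_map table (enum _)); apply: perm_size.
apply: uniq_perm; first by rewrite map_inj_uniq ?enum_uniq //; apply: table_inj.
  by rewrite filter_uniq // undup_uniq.
move=> t; rewrite mem_filter; apply/mapP/andP => [[p]|[Qt /pm_of_table[p pp Et]]].
  by rewrite mem_enum inE => /andP[pp Qp] ->; split=> //; apply: table_pm.
by exists p; rewrite // mem_enum inE pp Et.
Qed.

Lemma plonely_table (u v : 'I_n.+1) :
  @plonely G u v = (count (fun t => nth 0 t u == v) (pm_tables n.+1 en) == 1).
Proof.
rewrite /plonely -card_pm; congr (_ == 1); apply: eq_card => p; rewrite !inE.
by rewrite nth_table.
Qed.

End Tables.

Lemma card_pairs n (B : rel nat) :
  #|[set z : 'I_n * 'I_n | B z.1 z.2]| =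
  size [seq z <- [seq (i, j) | i <- iota 0 n, j <- iota 0 n] | B z.1 z.2].
Proof.
pose f (z : 'I_n * 'I_n) := (nat_of_ord z.1, nat_of_ord z.2).
have fi : injective f by move=> [a b] [a' b'] [/ord_inj-> /ord_inj->].
rewrite cardE -(size_map f); apply: perm_size.
apply: uniq_perm; first by rewrite map_inj_uniq ?enum_uniq.
  by rewrite filter_uniq // allpairs_uniq ?iota_uniq // => -[? ?] [? ?].
move=> [i j]; rewrite mem_filter /=; apply/mapP/andP => [[[a b]]|[Bij]].
  rewrite mem_enum inE /= => Bab [-> ->]; split=> //.
  by apply/allpairsP; exists (a : nat, b : nat); rewrite !mem_iota /= !ltn_ord.
case/allpairsP => -[a b] /=; rewrite !mem_iota /= => -[lta ltb [Ea Eb]]; subst i j.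
by exists (Ordinal lta, Ordinal ltb); rewrite // mem_enum inE.
Qed.

Lemma lonely_count_table n (e : rel 'I_n.+1) (en : rel nat) :
  simple_graph (Graph e) -> (forall i j : 'I_n.+1, e i j = en i j) ->
  (lonely_count (Graph e)).*2 =
  size [seq z <- [seq (i, j) | i <- iota 0 n.+1, j <- iota 0 n.+1] |
         count (fun t => nth 0 t z.1 == z.2) (pm_tables n.+1 en) == 1].
Proof.
move=> sG eE; rewrite lonely_countE //.
rewrite -(card_pairs n.+1 (fun i j => count (fun t => nth 0 t i == j) (pm_tables n.+1 en) == 1)).
apply: eq_card => z; rewrite !inE; exact: plonely_table.
Qed.

(** * Perfect matchings and lonely edges by state *)

Section States.
Variable L : lgraph.
Local Notation G := (lgr L).
Implicit Types (q : {ffun gV G -> gV G}) (z : gV G * gV G) (k : 'I_3).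

(* A perfect matching meets the edge cut around the triangle T_v in the single
   edge at label k (state k), or in all three edges of the cut (state 0). *)
Definition in_state k q : bool :=
  [exists i, exists j, [&& i != j, i != k, j != k & q (lab L i) == lab L j]].
Definition in_state0 q : bool := [forall i, forall j, q (lab L i) != lab L j].

Definition label_pair z : bool := (z.1 \in codom (lab L)) && (z.2 \in codom (lab L)).

Definition lonely_state k : {set gV G * gV G} :=
  [set z | plonely z.1 z.2 & [exists q, [&& pmf q, in_state k q & q z.1 == z.2]]].

Definition lonely_off k : {set gV G * gV G} := [set z in lonely_state k | ~~ label_pair z].

(** Here [t k] amounts to the triangle edge opposite label [k] being lonely, and [o k] records
    whether there is a lonely edge of state [k] off the triangle, doubled as an ordered pair. By
    [ci_0] no lonely edge belongs to a matching of state 0. The existence clauses provide the second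
    matchings that destroy loneliness in an extension. *)
Record count_inv (t o : 'I_3 -> bool) : Prop := CountInv {
  ci_st : forall k, exists2 q, pmf q & in_state k q;
  ci_st0 : exists2 q, pmf q & in_state0 q;
  ci_t : forall k, t k = (#|[set q | pmf q & in_state k q]| == 1);
  ci_0 : forall q u, pmf q -> in_state0 q -> exists q', [/\ pmf q', q' u = q u & q' != q];
  ci_o : forall k, #|lonely_off k| = (o k).*2 }.

Hypothesis okL : label_ok L.

Let sG : simple_graph G := lok_simple okL.

Lemma in_stateP k q :
  reflect (exists i j, [/\ i != j, i != k, j != k & q (lab L i) = lab L j]) (in_state k q).
Proof.
apply: (iffP existsP) => [[i /existsP[j /and4P[? ? ? /eqP ?]]]|[i [j [? ? ? /eqP ?]]]].
  by exists i, j.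
by exists i; apply/existsP; exists j; apply/and4P.
Qed.

Lemma in_state_map k q i j : pmf q -> in_state k q -> i != j -> i != k -> j != k ->
  q (lab L i) = lab L j.
Proof.
move=> qq /in_stateP[a [b [ab ak bk Eq]]] ij ik jk.
have Eqb : q (lab L b) = lab L a by rewrite -Eq pmfK.
case: (ord3_cases i ab ak bk) ik ij => [->|->|->]; rewrite ?eqxx //.
  by case: (ord3_cases j ab ak bk) jk => [->|->|->]; rewrite ?eqxx.
by case: (ord3_cases j ab ak bk) jk => [->|->|->]; rewrite ?eqxx.
Qed.

Lemma other_labels k : exists i j : 'I_3, [/\ i != j, i != k & j != k].
Proof. by elim/ord3P: k; [exists (Ordinal (isT : 1 < 3)), (Ordinal (isT : 2 < 3))
  |exists (Ordinal (isT : 0 < 3)), (Ordinal (isT : 2 < 3))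
  |exists (Ordinal (isT : 0 < 3)), (Ordinal (isT : 1 < 3))]. Qed.

Lemma in_state_uniq k k' q : pmf q -> in_state k q -> in_state k' q -> k = k'.
Proof.
move=> qq sk sk'; apply/eqP; apply: contraT => kk'.
case/andP: (thirdP kk') => mk mk'; set m := third k k' in mk mk'.
have k'k : k' != k by rewrite eq_sym.
have := in_state_map qq sk mk' mk k'k; rewrite (in_state_map qq sk' mk mk' kk').
by move/(lab_inj okL) => E; rewrite E eqxx in kk'.
Qed.

Lemma in_state0N k q : in_state0 q -> ~~ in_state k q.
Proof.
move/forallP=> s0; apply/in_stateP => -[i [j [_ _ _ E]]].
by have /forallP/(_ j) := s0 i; rewrite E eqxx.
Qed.

Lemma state_cases q : pmf q -> in_state0 q \/ exists k, in_state k q.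
Proof.
move=> qq; have [|] := boolP (in_state0 q); first by left.
case/forallPn => i /forallPn[j]; rewrite negbK => /eqP E; right.
have ij : i != j.
  by have := pmf_edge (lab L i) qq; rewrite E (lok_tri okL).
exists (third i j); apply/in_stateP; exists i, j.
by case/andP: (thirdP ij) => t1 t2; rewrite ij !(eq_sym _ (third i j)).
Qed.

Section Total.
Variables (t o : 'I_3 -> bool).
Hypothesis ci : count_inv t o.

(** The only matching through a lonely edge has just one state, and [ci_0] rules out state 0. *)
Lemma lonely_state_sum (z : gV G * gV G) : plonely z.1 z.2 ->
  \sum_k (z \in lonely_state k) = 1.
Proof.
move=> lz; have /plonelyP[q [qq qz uq]] := lz.
have [s0|[k sk]] := state_cases qq.
  by have [q' [qq' Eq' /eqP]] := ci_0 ci z.1 qq s0; case; apply: uq; rewrite // Eq'.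
rewrite (bigD1 k) //= inE lz /= (_ : [exists _, _]) /=; last first.
  by apply/existsP; exists q; rewrite qq sk qz eqxx.
rewrite big1 ?addn0 // => k' kk'; rewrite inE lz /=.
case: existsP => // -[q' /and3P[qq' sk' /eqP Eq']].
by rewrite (uq q' qq' Eq') in sk'; rewrite (in_state_uniq qq sk' sk) eqxx in kk'.
Qed.

(** The matchings through a triangle edge are exactly those of the opposite state, so the edge is
    lonely when that state has a single matching. *)
Lemma lonely_state_labels k : #|[set z in lonely_state k | label_pair z]| = (t k).*2.
Proof.
have [i [j [ij ik jk]]] := other_labels k.
have li := lab_inj okL.
have sub z : z \in [set z in lonely_state k | label_pair z] ->
    exists q, [/\ pmf q, in_state k q, forall q', pmf q' -> q' z.1 = z.2 -> q' = q &
      z = (lab L i, lab L j) \/ z = (lab L j, lab L i)].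
  rewrite !inE => /andP[/andP[lz /existsP[q /and3P[qq sk /eqP qz]]]].
  case/andP => /codomP[a Ea] /codomP[b Eb]; exists q; split=> //.
    by case/plonelyP: lz => q0 [_ _ uq] q' qq' qz'; rewrite (uq q' qq' qz') (uq q qq qz).
  have ab : a != b.
    by have := pmf_edge z.1 qq; rewrite qz Ea Eb (lok_tri okL).
  have Eab : q (lab L a) = lab L b by rewrite -Ea qz Eb.
  have sm : in_state (third a b) q.
    case/andP: (thirdP ab) => t1 t2.
    by apply/in_stateP; exists a, b; rewrite ab !(eq_sym _ (third a b)).
  have Ek := in_state_uniq qq sm sk.
  case/andP: (thirdP ab); rewrite Ek => ka kb.
  case: z {lz qz} Ea Eb => z1 z2 /= -> ->.
  case: (ord3_cases a ij ik jk) ab ka => ->; rewrite ?eqxx // => ab ka.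
    by case: (ord3_cases b ij ik jk) ab kb => ->; rewrite ?eqxx //; left.
  by case: (ord3_cases b ij ik jk) ab kb => ->; rewrite ?eqxx //; right.
rewrite (ci_t ci); case: (boolP (_ == 1)) => [/cards1P[q0 /setP E]|none].
  have := E q0; rewrite !inE eqxx => /andP[qq0 sq0].
  have lon a b : a != b -> a != k -> b != k ->
      (lab L a, lab L b) \in [set z in lonely_state k | label_pair z].
    move=> ab ak bk; rewrite !inE /label_pair /= !codom_f !andbT; apply/andP; split.
      apply/plonelyP; exists q0; split=> //; first exact: (in_state_map qq0 sq0).
      move=> q qq Eq; have := E q; rewrite !inE qq /=.
      suff -> : in_state k q by move/esym/eqP.
      by apply/in_stateP; exists a, b.
    by apply/existsP; exists q0; rewrite qq0 sq0 (in_state_map qq0 sq0 ab ak bk) eqxx.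
  rewrite -[RHS]/2 -(_ : #|[set (lab L i, lab L j); (lab L j, lab L i)]| = 2); last first.
    by rewrite cards2 xpair_eqE negb_and (inj_eq li) ij.
  apply: eq_card => z; apply/idP/idP.
    by case/sub=> q [_ _ _ [->|->]]; rewrite !inE eqxx ?orbT.
  by case/set2P=> ->; apply: lon; rewrite // eq_sym.
apply/eqP; rewrite cards_eq0; apply/eqP/setP => z; rewrite [RHS]inE; apply: contraNF none.
case/sub=> q [qq sk uq Ez]; apply/cards1P; exists q; apply/setP => q'; rewrite !inE.
apply/andP/eqP => [[qq' sk']|->//]; apply: uq => //.
have ji : j != i by rewrite eq_sym.
by case: Ez => -> /=; apply: (in_state_map qq' sk').
Qed.

Lemma lonely_count_inv : lonely_count G = \sum_k (t k + o k).
Proof.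
apply: double_inj; rewrite (lonely_countE sG) -sum1_card.
rewrite (eq_bigr (fun z => \sum_k (z \in lonely_state k))); last first.
  by move=> z; rewrite inE => /lonely_state_sum.
rewrite exchange_big /= -mul2n big_distrr; apply: eq_bigr => k _ /=.
rewrite mul2n doubleD -(ci_o ci) -lonely_state_labels.
rewrite -big_mkcondr /= sum1dep_card -(cardsID [set z | label_pair z]).
congr (_ + _); apply: eq_card => z; rewrite !inE.
  by case: (plonely _ _).
by case: (plonely _ _) => //=; rewrite andbC.
Qed.
End Total.
End States.

(** The new state [k != s] consists of lifts of the old state [third s k]. The new state [s]
    contains lifts of the old states [s] and 0, hence at least two matchings. *)
Definition step_t (s : 'I_3) (t : 'I_3 -> bool) (k : 'I_3) : bool := (k != s) && t (third s k).
(** In state [s] only the old triangle edge opposite label [s] can remain lonely, and it now lies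
    off the triangle; elsewhere two values are exchanged. *)
Definition step_o (s : 'I_3) (t o : 'I_3 -> bool) (k : 'I_3) : bool :=
  if k == s then t s else o (third s k).

(** * Effect of one extension on states and lonely edges *)

Section Step.
Variables (L : lgraph) (s : 'I_3) (nb : 'I_3 -> gV (lgr L)) (H : graph).
Variables (h : gV (lgr L) -> gV H) (c : 'I_3 -> gV H).
Hypotheses (okL : label_ok L) (tri : @tri_at (lgr L) H (lab L s) nb h c).
Hypothesis nbl : forall j, j != s -> nb j = lab L j.
Local Notation G := (lgr L).
Local Notation x := (lab L s).
Let L' := @LGraph H c.
Let sG : simple_graph G := lok_simple okL.
Let sH : simple_graph H := tri_simple tri sG.
Let nbx i : nb i != x := tri_nbx tri sG i.
Let nbi := tri_nb_inj tri.
Let li : injective (lab L) := lab_inj okL.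
Implicit Types (q : {ffun gV G -> gV G}) (P : {ffun gV H -> gV H}) (k : 'I_3).
Local Notation lift1 := (lift1 x nb h c).
Local Notation lift3 := (lift3 x nb h c).

Lemma thirdC i : i != s -> third s (third s i) = i.
Proof.
move=> si; have is_ : s != i by rewrite eq_sym.
by case/andP: (thirdP is_) => t1 t2; apply: third_uniq; rewrite // eq_sym.
Qed.

Lemma third_s i : i != s -> (third s i != s) && (third s i != i).
Proof. by move=> si; apply: thirdP; rewrite eq_sym. Qed.

Lemma partner_nb q : pmf q -> exists k, q x = nb k.
Proof. by move=> qq; case: (proj1 (tri_nbE tri _) (pmf_edge x qq)) => k; exists k. Qed.

Lemma state_partner_s q : pmf q -> in_state s q -> q x = nb s.
Proof.
move=> qq /[dup] sq /in_stateP[i [j [ij ins js Eq]]]; have [l El] := partner_nb qq.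
have [ls|ls] := eqVneq l s; first by rewrite El ls.
have := pmfK x qq; rewrite El nbl //.
case/andP: (third_s ls) => t1 t2; have lt : l != third s l by rewrite eq_sym.
by rewrite (in_state_map qq sq lt ls t1) => /li E; rewrite E eqxx in t1.
Qed.

Lemma state_partner k q : k != s -> pmf q -> in_state k q -> q x = nb (third s k).
Proof.
move=> ks qq sq; case/andP: (third_s ks) => t1 t2; rewrite nbl //.
by apply: (in_state_map qq sq) => //; rewrite eq_sym.
Qed.

Lemma partner_state i q : i != s -> q x = nb i -> in_state (third s i) q.
Proof.
move=> ins Eq; case/andP: (third_s ins) => t1 t2; apply/in_stateP; exists s, i.
by rewrite !(eq_sym _ (third s i)) (eq_sym s) Eq nbl.
Qed.

Lemma state0_partner q : pmf q -> in_state0 q -> q x = nb s.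
Proof.
move=> qq s0; have [l El] := partner_nb qq; have [ls|ls] := eqVneq l s; first by rewrite El ls.
by have := in_state0N (third s l) s0; rewrite partner_state.
Qed.

Lemma partner_s_state q : pmf q -> q x = nb s -> in_state0 q \/ in_state s q.
Proof.
move=> qq Eq; case: (state_cases okL qq) => [|[k sk]]; first by left.
have [<-|ks] := eqVneq k s; first by right.
have := state_partner ks qq sk; rewrite Eq => /nbi E.
by case/andP: (third_s ks); rewrite -E eqxx.
Qed.

Lemma state_star q : pmf q -> in_state s q -> star x nb q.
Proof.
move=> qq sq; apply/forallP => i; have [->|ins] := eqVneq i s.
  by rewrite -(state_partner_s qq sq) pmfK // eqxx orbT.
apply/orP; left; apply/existsP; exists (third s i); case/andP: (third_s ins) => t1 t2.
have it : i != third s i by rewrite eq_sym.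
by rewrite !nbl // (in_state_map qq sq it ins t1).
Qed.

Lemma lift1_state k q : pmf q -> @in_state L' k (lift1 q) = (q x == nb k).
Proof.
move=> qq; apply/in_stateP/eqP => /= [[i [j [ij ik jk]]]|Eq]; last first.
  have [i [j [ij ik jk]]] := other_labels k; exists i, j; split=> //.
  rewrite (lift1_c tri) Eq (inj_eq nbi) (negbTE ik) (nb_idxK tri).
  by rewrite (@third_uniq i k j) // eq_sym.
rewrite (lift1_c tri); have [m Em] := partner_nb qq; rewrite Em (nb_idxK tri) (inj_eq nbi).
have [im|im] := eqVneq i m.
  by move=> E; have := tri_hNc tri j (nbx i); rewrite E eqxx.
move/(tri_c_inj tri) => Ej; congr nb; apply/esym.
case/andP: (thirdP im); rewrite Ej => ji jm.
by case: (ord3_cases k ij im jm) ik jk => ->; rewrite ?eqxx.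
Qed.

Lemma lift1_state0 q : pmf q -> ~~ @in_state0 L' (lift1 q).
Proof.
move=> qq; have [m Em] := partner_nb qq; apply/negP => /(in_state0N m).
by rewrite lift1_state // Em eqxx.
Qed.

Lemma lift3_state0 q : @in_state0 L' (lift3 q).
Proof.
apply/forallP => i; apply/forallP => j /=; rewrite (lift3_c tri).
exact: (tri_hNc tri).
Qed.

Lemma pmf_ext_cases P : pmf P ->
  (exists2 q, pmf q & lift1 q = P) \/ (exists q, [/\ pmf q, in_state s q & lift3 q = P]).
Proof.
move=> PP; case: (pmf_triangle tri PP) => [Pc|[i [j [k [ij ik jk Pij Pk]]]]]; last first.
  by have [q [qq _ E]] := lift1_onto tri sG PP ij ik jk Pij Pk; left; exists q.
right; have es i j : i != s -> j != s -> i != j -> gE G (nb i) (nb j).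
  by move=> ins js ij; rewrite !nbl // (lok_tri okL).
have [q [qq sq qx E]] := lift3_onto tri sG PP Pc es; exists q; split=> //.
have [i [j [ij ins js]]] := other_labels s; apply/in_stateP; exists i, j; split=> //.
rewrite -!nbl // (star_nb tri sG qq sq qx ins) (@third_uniq i s j) //; by rewrite eq_sym.
Qed.

Lemma lift3_pm q : pmf q -> in_state s q -> pmf (lift3 q).
Proof. by move=> qq sq; apply: lift3_pmf => //; apply: state_star. Qed.

Lemma state_lift1 k P : pmf P -> @in_state L' k P -> exists q, [/\ pmf q, q x = nb k & lift1 q = P].
Proof.
move=> PP sP; case: (pmf_ext_cases PP) => [[q qq E]|[q [qq sq E]]].
  by exists q; split=> //; apply/eqP; rewrite -lift1_state // E.
by have := in_state0N k (lift3_state0 q); rewrite E sP.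
Qed.

Lemma state0_lift3 P : pmf P -> @in_state0 L' P -> exists q, [/\ pmf q, in_state s q & lift3 q = P].
Proof.
move=> PP sP; case: (pmf_ext_cases PP) => [[q qq E]|//].
by have := lift1_state0 qq; rewrite E sP.
Qed.

Lemma lift1_hE q u v : u != x -> v != x -> lift1 q (h u) = h v -> q u = v.
Proof.
move=> ux vx; rewrite (lift1_h tri) //; have [_|qx] := eqVneq (q u) x.
  by move=> E; have := tri_hNc tri (nb_idx nb u) vx; rewrite E eqxx.
by move/(tri_h_inj tri qx vx).
Qed.

Lemma lift1_hI q u v : u != x -> v != x -> q u = v -> lift1 q (h u) = h v.
Proof. by move=> ux vx E; rewrite (lift1_h tri) // E (negbTE vx). Qed.

Lemma lift3_hE q u v : pmf q -> u != x -> v != x -> lift3 q (h u) = h v -> q u = v /\ ~~ gE G x u.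
Proof.
move=> qq ux vx; rewrite (lift3_h tri) //; case: ifP => [_|/negbT xu].
  by move=> E; have := tri_hNc tri (nb_idx nb u) vx; rewrite E eqxx.
have qx : q u != x.
  by apply: contra xu => /eqP <-; rewrite (edge_sym sG) pmf_edge.
by move/(tri_h_inj tri qx vx).
Qed.

Lemma lift13_neq q q' : pmf q' -> lift1 q' <> lift3 q.
Proof. by move=> qq' E; have := lift1_state0 qq'; rewrite E lift3_state0. Qed.

Variables (t o : 'I_3 -> bool).
Hypothesis ci : count_inv L t o.

Lemma step_st k : exists2 P, pmf P & @in_state L' k P.
Proof.
have [ks|ks] := eqVneq k s.
  have [q qq sq] := ci_st ci s; exists (lift1 q); first exact: lift1_pmf.
  by rewrite lift1_state // (state_partner_s qq sq) ks.
have [q qq sq] := ci_st ci (third s k); exists (lift1 q); first exact: lift1_pmf.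
case/andP: (third_s ks) => t1 t2.
by rewrite lift1_state // (state_partner t1 qq sq) thirdC.
Qed.

Lemma step_st0 : exists2 P, pmf P & @in_state0 L' P.
Proof.
have [q qq sq] := ci_st ci s; exists (lift3 q); first exact: lift3_pm.
exact: lift3_state0.
Qed.

Lemma ci_tP k : reflect (forall q q', pmf q -> pmf q' -> in_state k q -> in_state k q' -> q = q') (t k).
Proof.
rewrite (ci_t ci); apply: (iffP cards1P) => [[q0 /setP E] q q' qq qq' sq sq'|uq].
  have := E q; have := E q'; rewrite !inE qq qq' sq sq'.
  by move=> /esym/eqP-> /esym/eqP->.
have [q qq sq] := ci_st ci k; exists q; apply/setP => q'; rewrite !inE.
by apply/andP/eqP => [[qq' sq']|->//]; apply: uq.
Qed.

Lemma step_tE k : step_t s t k = (#|[set P | pmf P & @in_state L' k P]| == 1).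
Proof.
rewrite /step_t; have [->|ks] /= := eqVneq k s.
  apply/esym/cards1P => -[P /setP E].
  have [q1 qq1 sq1] := ci_st ci s; have [q2 qq2 sq2] := ci_st0 ci.
  have := E (lift1 q1); have := E (lift1 q2).
  rewrite !inE !lift1_pmf // !lift1_state // (state_partner_s qq1 sq1) (state0_partner qq2 sq2).
  rewrite eqxx => /esym/eqP E2 /esym/eqP E1.
  have E12 : q1 = q2 by apply: (lift1_inj tri sG) => //; rewrite E1 E2.
  by have := in_state0N s sq2; rewrite -E12 sq1.
case/andP: (third_s ks) => t1 t2.
have stE q : pmf q -> (q x == nb k) = in_state (third s k) q.
  move=> qq; apply/eqP/idP => [/(partner_state ks)//|/(state_partner t1 qq)].
  by rewrite thirdC.
apply/ci_tP/cards1P => [uq|[P /setP E] q q' qq qq' sq sq'].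
  have [q qq sq] := ci_st ci (third s k); exists (lift1 q); apply/setP => P; rewrite !inE.
  apply/andP/eqP => [[PP sP]|->]; last by rewrite lift1_pmf // lift1_state // stE.
  have [q' [qq' /eqP Eq' <-]] := state_lift1 PP sP; congr lift1.
  by apply: uq; rewrite // -stE.
have := E (lift1 q); have := E (lift1 q').
rewrite !inE !lift1_pmf // !lift1_state // !stE // sq sq' => /esym/eqP E2 /esym/eqP E1.
by apply: (lift1_inj tri sG); rewrite // E1 E2.
Qed.

(** An edge leaving the new triangle at [c i] lies in a matching of state [i] and in one of state
    0. *)
Lemma cross_not_lonely i P : pmf P -> P (c i) = h (nb i) ->
  exists P', [/\ pmf P', P' (c i) = h (nb i) & P' != P].
Proof.
move=> PP Pi; have [P1 PP1 sP1] := step_st i; have [P0 PP0 sP0] := step_st0.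
have P0i : P0 (c i) = h (nb i).
  by have [q [_ _ <-]] := state0_lift3 PP0 sP0; rewrite (lift3_c tri).
have P1i : P1 (c i) = h (nb i).
  by have [q [qq Eq <-]] := state_lift1 PP1 sP1; rewrite (lift1_c tri) Eq eqxx.
have [E|ne] := eqVneq P0 P; last by exists P0.
exists P1; split=> //; rewrite -E; apply: contraTneq sP1 => ->.
exact: in_state0N.
Qed.

(** Edges leaving the triangle fall under [cross_not_lonely]; any other edge of [lift3 q] belongs to
    [lift1 q] as well. *)
Lemma step_0 P a : pmf P -> @in_state0 L' P -> exists P', [/\ pmf P', P' a = P a & P' != P].
Proof.
move=> PP sP; have [q [qq sq Eq]] := state0_lift3 PP sP.
have Pc i : P (c i) = h (nb i) by rewrite -Eq (lift3_c tri).
case: (tri_cover tri a) => [[u ux ->]|[i ->]]; last by rewrite Pc; apply: cross_not_lonely.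
have [/(tri_nbE tri)[i Ei]|xu] := boolP (gE G x u).
  have [P' [PP' Ei' ne]] := cross_not_lonely PP (Pc i); exists P'; split=> //.
  by rewrite -Ei -{1}Ei' pmfK // -Pc pmfK.
exists (lift1 q); split; first exact: lift1_pmf.
  rewrite -Eq (lift1_h tri) // (lift3_h tri) // (negbTE xu).
  by case: eqP => // E; rewrite -E (edge_sym sG) pmf_edge in xu.
by rewrite -Eq; apply/eqP/lift13_neq.
Qed.

(** Edges leaving the new triangle are not lonely, so a lonely edge off the triangle is an edge of
    [G] avoiding [x]. *)
Lemma lonely_off_inner k z : z \in @lonely_off L' k ->
  exists q u v, [/\ u != x, v != x, z = (h u, h v), pmf q &
    [/\ q x = nb k, q u = v &
     forall P, pmf P -> P (h u) = h v -> P = lift1 q]].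
Proof.
case: z => a b; rewrite !inE /label_pair /= => /andP[/andP[lz /existsP[P /and3P[PP sP /eqP Pab]]] nl].
have uP P' : pmf P' -> P' a = b -> P' = P.
  by case/plonelyP: lz => P0 [_ _ uq] PP' E; rewrite (uq P' PP' E) (uq P PP Pab).
have [q [qq Eq EP]] := state_lift1 PP sP.
have cross i v : v != x -> (a = c i /\ b = h v) \/ (a = h v /\ b = c i) -> False.
  move=> vx ab; have ev : gE H (c i) (h v).
    case: ab => -[Ea Eb]; first by rewrite -Ea -Eb -Pab pmf_edge.
    by rewrite (edge_sym sH) -Ea -Eb -Pab pmf_edge.
  move: ev; rewrite (tri_ch tri) // => /eqP Ev.
  have Pi : P (c i) = h (nb i).
    case: ab => -[Ea Eb]; first by rewrite -Ea -Ev -Eb.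
    by rewrite -Ev -Ea -Eb -Pab pmfK.
  have [P' [PP' P'i /eqP[]]] := cross_not_lonely PP Pi; apply: uP => //.
  case: ab => -[Ea Eb]; first by rewrite Ea Eb P'i Ev.
  by rewrite Ea Eb Ev -P'i pmfK.
case: (tri_cover tri a) => [[u ux Ea]|[i Ea]]; case: (tri_cover tri b) => [[v vx Eb]|[j Eb]].
- exists q, u, v; split=> //; first by rewrite Ea Eb.
  split=> //; first by apply: lift1_hE; rewrite // EP -Ea -Eb.
  by move=> P' PP'; rewrite -Ea -Eb EP; apply: uP.
- by case: (cross j u ux); right.
- by case: (cross i v vx); left.
- by move: nl; rewrite Ea Eb !codom_f.
Qed.

Lemma h_not_label u v : u != x -> label_pair (L := L') (h u, v) = false.
Proof.
move=> ux; apply/negbTE/negP => /andP[/codomP[i /= E] _].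
by have := tri_hNc tri i ux; rewrite E eqxx.
Qed.

(** An edge from an old matching of state 0 is shared with another old matching, by [ci_0]. For an
    old matching [q] of state [s], an edge away from the neighbours of [x] also lies in [lift3 q].
    What remains is the edge between the two other old labels, lonely exactly when the old state [s]
    has one matching. *)
Lemma step_os : #|@lonely_off L' s| = (t s).*2.
Proof.
have [i [j [ij ins js]]] := other_labels s.
have ix : lab L i != x by rewrite (inj_eq li).
have jx : lab L j != x by rewrite (inj_eq li).
have sub z : z \in @lonely_off L' s ->
    t s /\ (z = (h (lab L i), h (lab L j)) \/ z = (h (lab L j), h (lab L i))).
  case/lonely_off_inner => q [u [v [ux vx -> qq [qx quv uP]]]].
  case: (partner_s_state qq qx) => [s0|sq].
    have [q' [qq' Eq' /eqP[]]] := ci_0 ci u qq s0.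
    apply: (lift1_inj tri sG) => //; apply: uP; first exact: lift1_pmf.
    by apply: lift1_hI; rewrite // Eq'.
  have [xu|xu] := boolP (gE G x u); last first.
    have := uP (lift3 q) (lift3_pm qq sq).
    rewrite (lift3_h tri) // (negbTE xu) quv => /(_ erefl) E.
    by case: (lift13_neq qq (esym E)).
  have [l El] := proj1 (tri_nbE tri _) xu.
  have ls : l != s.
    by apply: contraNneq vx => E; rewrite -quv -El E -qx pmfK.
  case/andP: (third_s ls) => t1 t2.
  have lt : l != third s l by rewrite eq_sym.
  have qt q' : pmf q' -> in_state s q' -> q' u = lab L (third s l).
    by move=> qq' sq'; rewrite -El nbl // (in_state_map qq' sq' lt).
  split.
    apply/ci_tP => q1 q2 qq1 qq2 sq1 sq2; apply: (lift1_inj tri sG) => //.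
    have aux q' : pmf q' -> in_state s q' -> lift1 q' = lift1 q.
      move=> qq' sq'; apply: uP; first exact: lift1_pmf.
      by apply: lift1_hI; rewrite // -quv !qt.
    by rewrite !aux.
  rewrite -quv qt // -El nbl //.
  case: (ord3_cases l ij ins js) ls => ->; rewrite ?eqxx // => _; [left|right].
    by rewrite (@third_uniq s i j) // eq_sym.
  by rewrite (@third_uniq s j i) // eq_sym.
case ts: (t s); last first.
  apply/eqP; rewrite cards_eq0; apply/eqP/setP => z; rewrite [RHS]inE; apply/negbTE/negP.
  by case/sub; rewrite ts.
have lon a b : a != b -> a != s -> b != s -> (h (lab L a), h (lab L b)) \in @lonely_off L' s.
  move=> ab as_ bs.
  have ax : lab L a != x by rewrite (inj_eq li).
  have bx : lab L b != x by rewrite (inj_eq li).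
  rewrite !inE h_not_label // andbT /=.
  have [q qq sq] := ci_st ci s.
  have Pq : lift1 q (h (lab L a)) = h (lab L b).
    by apply: lift1_hI => //; apply: (in_state_map qq sq).
  apply/andP; split; last first.
    apply/existsP; exists (lift1 q); rewrite lift1_pmf // lift1_state //.
    by rewrite (state_partner_s qq sq) Pq !eqxx.
  apply/plonelyP; exists (lift1 q); split=> //; first exact: lift1_pmf.
  move=> P PP Pab; case: (pmf_ext_cases PP) => [[q' qq' E]|[q' [qq' sq' E]]].
    rewrite -E; congr lift1; move/ci_tP: ts; apply=> //.
    by apply/in_stateP; exists a, b; split=> //; apply: lift1_hE; rewrite // E.
  have := @lift3_hE q' (lab L a) (lab L b) qq' ax bx; rewrite E => /(_ Pab)[_].
  by rewrite (lok_tri okL) eq_sym as_.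
rewrite -[RHS]/2 -(_ : #|[set (h (lab L i), h (lab L j)); (h (lab L j), h (lab L i))]| = 2); last first.
  rewrite cards2 xpair_eqE negb_and (_ : h (lab L i) != h (lab L j)) //.
  by apply: contra ij => /eqP/(tri_h_inj tri ix jx)/li->.
apply: eq_card => z; apply/idP/idP.
  by case/sub=> _ [->|->]; rewrite !inE eqxx ?orbT.
by case/set2P=> ->; apply: lon; rewrite // eq_sym.
Qed.

(** In the old state [third s k] the partner of [x] is label [k], so lonely edges off the old
    triangle avoid [x] and can be carried over by [h]. They stay lonely: a matching of the form
    [lift3 q'] comes from the old state [s], while the only old matching through such an edge has
    another state. *)
Lemma step_ok k : k != s -> #|@lonely_off L' k| = (o (third s k)).*2.
Proof.
move=> ks; case/andP: (third_s ks) => t1 t2; rewrite -(ci_o ci).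
have off_x z : z \in lonely_off L (third s k) -> z.1 != x /\ z.2 != x.
  rewrite !inE => /andP[/andP[_ /existsP[q /and3P[qq sq /eqP qz]]]] nl.
  have qx := state_partner t1 qq sq; rewrite thirdC // nbl // in qx.
  split; apply: contra nl => /eqP E; rewrite /label_pair.
    by rewrite -qz E qx !codom_f.
  by rewrite -(pmfK z.1 qq) qz E qx !codom_f.
rewrite -(card_in_imset (f := fun z => (h z.1, h z.2)) (D := lonely_off L (third s k))); last first.
  move=> [a b] [a' b'] /off_x[/= ax bx] /off_x[/= ax' bx'] [].
  by move=> /(tri_h_inj tri ax ax')-> /(tri_h_inj tri bx bx')->.
apply: eq_card => z; apply/idP/imsetP.
  case/lonely_off_inner => q [u [v [ux vx -> qq [qx quv uP]]]]; exists (u, v) => //.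
  have sq := partner_state ks qx.
  rewrite !inE /=; apply/andP; split; [apply/andP; split|].
  - apply/plonelyP; exists q; split=> // q' qq' Eq'; apply: (lift1_inj tri sG) => //.
    by apply: uP; [apply: lift1_pmf|apply: lift1_hI].
  - by apply/existsP; exists q; rewrite qq sq quv eqxx.
  apply/negP => /andP[/codomP[a /= Ea] /codomP[b /= Eb]].
  have as_ : a != s by apply: contraNneq ux => <-; rewrite Ea.
  have bs : b != s by apply: contraNneq vx => <-; rewrite Eb.
  have ab : a != b.
    by apply: contraTneq (pmf_edge u qq) => E; rewrite quv Ea Eb E (edge_irr sG).
  have ss : in_state s q by apply/in_stateP; exists a, b; split=> //; rewrite -Ea quv.
  by have := in_state_uniq okL qq ss sq => E; rewrite -E eqxx in t1.
case=> -[u v] uvO ->; have [/= ux vx] := off_x _ uvO.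
move: uvO; rewrite !inE /= => /andP[/andP[lz /existsP[q /and3P[qq sq /eqP quv]]] nl].
have uq q' : pmf q' -> q' u = v -> q' = q.
  by case/plonelyP: lz => q0 [_ _ uq] qq' E; rewrite (uq q' qq' E) (uq q qq quv).
have qx := state_partner t1 qq sq; rewrite thirdC // in qx.
rewrite h_not_label // andbT; apply/andP; split; last first.
  apply/existsP; exists (lift1 q); rewrite lift1_pmf // lift1_state // qx eqxx /=.
  by apply/eqP/lift1_hI.
apply/plonelyP; exists (lift1 q); split; first exact: lift1_pmf.
  exact: lift1_hI.
move=> P PP Puv; case: (pmf_ext_cases PP) => [[q' qq' E]|[q' [qq' sq' E]]].
  by rewrite -E; congr lift1; apply: uq => //; apply: lift1_hE; rewrite // E.
have := @lift3_hE q' u v qq' ux vx; rewrite E => /(_ Puv)[/(uq _ qq') Eq' _].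
rewrite Eq' in sq'; have := state_partner_s qq sq'; rewrite qx => /nbi Ek.
by rewrite Ek eqxx in ks.
Qed.

Lemma count_inv_step : count_inv L' (step_t s t) (step_o s t o).
Proof.
split.
- exact: step_st.
- exact: step_st0.
- exact: step_tE.
- exact: step_0.
move=> k; rewrite /step_o; have [->|ks] := eqVneq k s; first exact: step_os.
exact: step_ok.
Qed.
End Step.

(** In the prism each state [k] has one matching; its rung is shared with state 0, and its two other
    edges, one in each triangle, are lonely. *)
Lemma prism_count_inv : count_inv prism_l xpredT xpredT.
Proof.
have eE : forall i j : 'I_6, gE prism i j = prism_rel i j by [].
have labE (i : 'I_3) : nat_of_ord (lab prism_l i) = i + 3.
  by rewrite /= inordK // (leq_add2r 3 i.+1 3) ltn_ord.
pose st (k : nat) (t : seq nat) := has (fun i => has (fun j =>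
  [&& i != j, i != k, j != k & nth 0 t (i + 3) == j + 3]) (iota 0 3)) (iota 0 3).
pose st0 (t : seq nat) := all (fun i => all (fun j => nth 0 t (i + 3) != j + 3) (iota 0 3)) (iota 0 3).
have I3 (i : 'I_3) : (i : nat) \in iota 0 3 by rewrite mem_iota /= ltn_ord.
have tabE (q : {ffun gV prism -> gV prism}) (i j : 'I_3) :
    (q (lab prism_l i) == lab prism_l j) = (nth 0 (table q) (i + 3) == j + 3).
  by rewrite -!labE nth_table.
have stE (k : 'I_3) (q : {ffun gV prism -> gV prism}) : in_state (L := prism_l) k q = st k (table q).
  apply/in_stateP/hasP => [[i [j [ij ik jk /eqP]]]|[i i3 /hasP[j j3 /and4P[ij ik jk Eq]]]].
    rewrite tabE => Eq; exists (i : nat); first exact: I3.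
    by apply/hasP; exists (j : nat); [exact: I3|apply/and4P].
  move: i3 j3; rewrite !mem_iota /= => i3 j3.
  by exists (Ordinal i3), (Ordinal j3); split=> //; apply/eqP; rewrite tabE.
have st0E (q : {ffun gV prism -> gV prism}) : in_state0 (L := prism_l) q = st0 (table q).
  apply/forallP/allP => [H i|H i].
    rewrite mem_iota => i3; apply/allP => j; rewrite mem_iota => j3.
    have /forallP/(_ (Ordinal (j3 : j < 3))) := H (Ordinal (i3 : i < 3)); by rewrite tabE.
  apply/forallP => j; rewrite tabE.
  have : all (fun j => nth 0 (table q) (i + 3) != j + 3) (iota 0 3) := H i (I3 i).
  by move/allP/(_ _ (I3 j)).
pose T := pm_tables 6 prism_rel.
split.
- move=> k; have /(pm_tables_has eE)[q qq Eq] : has (st k) T by elim/ord3P: k; vm_compute.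
  by exists q; rewrite ?stE.
- have /(pm_tables_has eE)[q qq Eq] : has st0 T by vm_compute.
  by exists q; rewrite ?st0E.
- move=> k; rewrite (_ : [set _ | _ & _] = [set q | pmf q & st k (table q)]); last first.
    by apply/setP => q; rewrite !inE stE.
  by rewrite (card_pm eE); elim/ord3P: k; vm_compute.
- move=> q u qq; rewrite st0E => s0.
  pose Q (t : seq nat) := st0 t ==> all (fun u => has (fun t' => (nth 0 t' u == nth 0 t u) && (t' != t)) T) (iota 0 6).
  have QT : all Q T by vm_compute.
  have u6 : (u : nat) \in iota 0 6 by rewrite mem_iota /= ltn_ord.
  have := pm_tables_all eE QT qq; rewrite /Q s0 implyTb => /allP/(_ _ u6)/(pm_tables_has eE)[q' qq' /andP[Eq ne]].
  exists q'; split=> //; last by apply: contraNneq ne => ->.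
  by apply: ord_inj; apply/eqP; rewrite -!nth_table.
move=> k.
pose B (i j : nat) := [&& count (fun t => nth 0 t i == j) T == 1,
  has (fun t => st k t && (nth 0 t i == j)) T & ~~ ((3 <= i) && (3 <= j))].
have labP (u : gV prism) : (u \in codom (lab prism_l)) = (3 <= u).
  apply/codomP/idP => [[i ->]|u3]; first by rewrite labE leq_addl.
  case: (prism_lab_cases u) => [[a Eu]|[a Eu]]; last by exists a.
  move: u3; rewrite Eu inordK; first by rewrite leqNgt ltn_ord.
  exact: leq_trans (ltn_ord a) _.
transitivity #|[set z : 'I_6 * 'I_6 | B z.1 z.2]|.
  apply: eq_card => z; rewrite !inE (plonely_table eE) /B /label_pair !labP -andbA.
  congr [&& _, _ & _]; apply/existsP/idP => [[q /and3P[qq sq /eqP Eq]]|].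
    apply/hasP; exists (table q); first exact: (table_pm eE).
    by rewrite -stE sq nth_table Eq eqxx.
  case/(pm_tables_has eE) => q qq /andP[sq Eq]; exists q.
  by rewrite qq stE sq /= -val_eqE /= -nth_table.
by rewrite card_pairs /B /T; elim/ord3P: k {labP B}; vm_compute.
Qed.

(** * Lonely counts as a function of the pattern *)

Definition step_v (v : 'I_3 -> nat) (s : 'I_3) : 'I_3 -> nat :=
  fun k => if k == s then (v s).-1 else v (third s k).

(* [word_val p k] is the number of lonely edges of the extended prism with
   pattern p whose perfect matching is in state k. *)
Definition word_val (p : seq 'I_3) : 'I_3 -> nat := foldl step_v (fun=> 2) p.

Lemma word_val_rcons p s : word_val (rcons p s) = step_v (word_val p) s.
Proof. by rewrite /word_val foldl_rcons. Qed.

Lemma sum_ord3 (F : 'I_3 -> nat) a b c : a != b -> a != c -> b != c ->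
  \sum_k F k = F a + F b + F c.
Proof.
move=> ab ac bc; rewrite (bigD1 a) //= (bigD1 b) 1?eq_sym //= (bigD1 c) /=; last first.
  by rewrite !(eq_sym c) ac bc.
rewrite big1 ?addn0 ?addnA // => k /andP[/andP[ka kb] kc].
by case: (ord3_cases k ab ac bc) ka kb kc => ->; rewrite eqxx.
Qed.

(** Because [t k] implies [o k], the pair is determined by its sum, and putting [t s] in place of
    [o s] and false in place of [t s] sends the sums 2, 1, 0 to 1, 0, 0. *)
Lemma ep_word_val p L : is_ext_prism p L ->
  exists t o, [/\ count_inv L t o, forall k, t k -> o k & forall k, t k + o k = word_val p k].
Proof.
elim=> [|{}p {}L s w EP [t [o [ci to E]]] sw wl].
  by exists xpredT, xpredT; split=> //; apply: prism_count_inv.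
have ok := ep_ok EP; have tri := ext_tri ok sw wl.
have nbl j : j != s -> ext_nb s w j = lab L j by move=> js; rewrite /ext_nb (negbTE js).
exists (step_t s t), (step_o s t o); split; first exact: (count_inv_step ok tri nbl ci).
  by move=> k; rewrite /step_t /step_o; case: eqP => //= _; apply: to.
move=> k; rewrite word_val_rcons /step_v /step_t /step_o -!E.
by case: (k == s) => //=; case: (t s) (to s) => [->|] //; case: (o s).
Qed.

Lemma ep_lonely_count p L : is_ext_prism p L -> lonely_count (lgr L) = \sum_k word_val p k.
Proof.
move=> EP; have [t [o [ci _ E]]] := ep_word_val EP.
by rewrite (lonely_count_inv (ep_ok EP) ci); apply: eq_bigr => k _; apply: E.
Qed.

Lemma step_v_same v s : step_v v s s = (v s).-1.
Proof. by rewrite /step_v eqxx. Qed.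

Lemma step_v_other v s a b : s != a -> s != b -> a != b -> step_v v s a = v b.
Proof.
by move=> sa sb ab; rewrite /step_v eq_sym (negbTE sa) (@third_uniq s a b).
Qed.

Lemma rcons_nseq (T : Type) m (a : T) : rcons (nseq m a) a = nseq m.+1 a.
Proof. by elim: m => //= m ->. Qed.

Lemma word_val_const m a k : word_val (nseq m a) k = if k == a then 2 - m else 2.
Proof.
elim: m k => [|m IH] k; first by rewrite subn0 if_same.
rewrite -rcons_nseq word_val_rcons /step_v !IH eqxx; case: (eqVneq k a) => [_|ka]; first by lia.
have ak : a != k by rewrite eq_sym.
by case/andP: (thirdP ak) => /negbTE->.
Qed.

(** Up to renaming the indices this is the pattern of the theorem, with [i] = h - 1 and [j] = k -
    h. *)
Definition block_word (a b c : 'I_3) (i j : nat) : seq 'I_3 := nseq i a ++ b :: nseq j c.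

Lemma block_word_rcons a b c i j :
  block_word a b c i j.+1 = rcons (block_word a b c i j) c.
Proof.
by rewrite /block_word rcons_cat rcons_cons rcons_nseq.
Qed.

(** The first block lowers the value at [a] to 2 - i, the letter [b] hands this value to [c], and
    each letter [c] lowers it further while exchanging the values 2 and 1 at [a] and [b]. *)
Lemma word_val_block a b c i j : a != b -> a != c -> b != c ->
  word_val (block_word a b c i j) c = 2 - (i + j) /\
  ((word_val (block_word a b c i j) a = 2 /\ word_val (block_word a b c i j) b = 1) \/
   (word_val (block_word a b c i j) a = 1 /\ word_val (block_word a b c i j) b = 2)).
Proof.
move=> ab ac bc; have [ba ca cb] : [/\ b != a, c != a & c != b] by rewrite !(eq_sym b) !(eq_sym c).
elim: j => [|j [IHc IHab]].
  have -> : block_word a b c i 0 = rcons (nseq i a) b by rewrite -cats1.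
  rewrite !word_val_rcons step_v_same (step_v_other _ ba bc ac) (step_v_other _ bc ba ca).
  by rewrite !word_val_const eqxx (negbTE ca) (negbTE ba) addn0; split=> //; left.
rewrite block_word_rcons !word_val_rcons step_v_same.
rewrite (step_v_other _ ca cb ab) (step_v_other _ cb ca ba) IHc; split; first by lia.
by case: IHab => -[-> ->]; [right|left].
Qed.

Lemma word_sum_block a b c i j : a != b -> a != c -> b != c ->
  \sum_k word_val (block_word a b c i j) k = 3 + (2 - (i + j)).
Proof.
move=> ab ac bc; rewrite (sum_ord3 _ ab ac bc).
by case: (word_val_block i j ab ac bc) => -> [[-> ->]|[-> ->]].
Qed.

Lemma step_v_sum v s : \sum_k step_v v s k = \sum_k v k - (0 < v s).
Proof.
have [a [b [ab as_ bs]]] := other_labels s.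
have [ba sa sb] : [/\ b != a, s != a & s != b] by rewrite !(eq_sym s) (eq_sym b).
rewrite !(sum_ord3 _ sa sb ab) step_v_same (step_v_other _ sa sb ab) (step_v_other _ sb sa ba).
by case: (v s) => [|n] /=; lia.
Qed.

Lemma word_sum_rcons p s :
  \sum_k word_val (rcons p s) k = \sum_k word_val p k - (0 < word_val p s).
Proof. by rewrite word_val_rcons step_v_sum. Qed.

Lemma word_val_aba a b k : a != b -> word_val [:: a; b; a] k = 1.
Proof.
move=> ab; case/andP: (thirdP ab); set c := third a b => ca cb.
have ac : a != c by rewrite eq_sym.
have bc : b != c by rewrite eq_sym.
have ba : b != a by rewrite eq_sym.
have -> : [:: a; b; a] = rcons (rcons (nseq 1 a) b) a by [].
rewrite !word_val_rcons; case: (ord3_cases k ab ac bc) => ->.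
- by rewrite step_v_same (step_v_other _ ba bc ac) word_val_const (negbTE ca).
- rewrite (step_v_other _ ab ac bc) (step_v_other _ bc ba ca) word_val_const eqxx //.
- by rewrite (step_v_other _ ac ab cb) step_v_same word_val_const (negbTE ba).
Qed.

Lemma word_sum_aba a b : a != b -> \sum_k word_val [:: a; b; a] k = 3.
Proof. by move=> ab; rewrite (eq_bigr (fun=> 1)) ?sum1_card ?card_ord // => k _; apply: word_val_aba. Qed.

(** The condition on [i] and [j] leaves one-letter words to [ShapeConst] and forces a word of two
    distinct letters to be written with [i = 1] and [j = 0]. [ShapeSmall] is stable because the
    total never grows. *)
Variant word_shape (p : seq 'I_3) : Prop :=
| ShapeConst m a of p = nseq m a
| ShapeBlock a b c i j of a != b & a != c & b != c & (0 < i) || (1 < j) & p = block_word a b c i j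
| ShapeABA a b of a != b & p = [:: a; b; a]
| ShapeSmall of \sum_k word_val p k <= 2.

Lemma wordP p : word_shape p.
Proof.
elim/last_ind: p => [|p s]; first exact: (@ShapeConst _ 0 ord0 erefl).
case=> [m a Ep|a b c i j ab ac bc ij Ep|a b ab Ep|le2].
- rewrite Ep; case: (eqVneq s a) => [->|sa].
    by apply: (@ShapeConst _ m.+1 a); rewrite rcons_nseq.
  case/andP: (thirdP sa) => cs ca.
  case: m Ep => [|m] Ep; first exact: (@ShapeConst _ 1 s erefl).
  apply: (@ShapeBlock _ a s (third s a) m.+1 0) => //; rewrite 1?eq_sym //.
  by rewrite /block_word cats1.
- have [ba ca cb] : [/\ b != a, c != a & c != b] by rewrite !(eq_sym b) !(eq_sym c).
  case: (eqVneq s c) => [->|sc].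
    rewrite Ep -block_word_rcons; apply: (@ShapeBlock _ a b c i j.+1) => //.
    by case/orP: ij => [->|ij] //; rewrite (ltn_trans ij) ?orbT.
  (* From three letters on the total is 3 and the values at [a] and [b] are positive, so any letter
     other than [c] lowers the total to 2. *)
  have [ij2|ij1] := leqP 2 (i + j).
    apply: ShapeSmall; rewrite word_sum_rcons Ep word_sum_block //.
    have [_ E] := word_val_block i j ab ac bc.
    suff -> : 0 < word_val (block_word a b c i j) s by lia.
    have : s = a \/ s = b.
      by case: (ord3_cases s ab ac bc) => E'; [left|right|rewrite E' eqxx in sc].
    by case: E => -[E1 E2] [->|->]; rewrite ?E1 ?E2.
  (* The word is [[:: a; b]]: appending [a] gives the exceptional shape, and appending [b] gives a
     block with empty first part and middle letter [a]. *)
  have [Ei Ej] : i = 1 /\ j = 0 by lia.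
  rewrite {}Ep {}Ei {}Ej; case: (ord3_cases s ab ac bc) => E; last by rewrite E eqxx in sc.
    by rewrite E; apply: (@ShapeABA _ a b).
  rewrite E; apply: (@ShapeBlock _ c a b 0 2) => //.
- apply: ShapeSmall; rewrite word_sum_rcons Ep word_sum_aba // word_val_aba //.
by apply: ShapeSmall; rewrite word_sum_rcons; lia.
Qed.

Lemma word_sum3 p : \sum_k word_val p k = 3 ->
  (exists a b c i j, [/\ a != b, a != c, b != c, 1 < i + j & p = block_word a b c i j]) \/
  exists a b, a != b /\ p = [:: a; b; a].
Proof.
case: (wordP p) => [m a ->|a b c i j ab ac bc _ ->|a b ab ->|]; last by lia.
- have [b [c [bc ba ca]]] := other_labels a; rewrite (sum_ord3 _ ba bc) 1?eq_sym //.
  rewrite !word_val_const eqxx (negbTE ba) (negbTE ca); lia.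
- by rewrite word_sum_block // => E; left; exists a, b, c, i, j; split=> //; lia.
by right; exists a, b.
Qed.

(** * Renaming the indices of a pattern *)

(** The prism is [K4] with vertex 3 replaced, so permuting the vertices 0, 1, 2 of [K4] induces an
    automorphism of the prism acting on the labels by [s]; the extensions carry it along. *)
Lemma ep_permute (s : 'I_3 -> 'I_3) p L : injective s -> is_ext_prism p L ->
  exists L' (f : gV (lgr L) -> gV (lgr L')),
    [/\ is_ext_prism (map s p) L', is_iso f & forall i, f (lab L i) = lab L' (s i)].
Proof.
move=> si; have [r sK rK] := injF_bij si.
elim=> [|{}p {}L k w EP [L1 [f [EP1 fi fl]]] kw wl].
  pose f (v : gV K4) : gV K4 := if v < 3 then @inord 3 (s (@inord 2 v)) else v.
  have f3 (v : 'I_4) : v < 3 -> nat_of_ord (f v) = s (@inord 2 v).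
    by move=> lt; rewrite /f lt inordK //; apply: leq_trans (ltn_ord _) _.
  have f3' (v : 'I_4) : ~~ (v < 3) -> f v = v by rewrite /f => /negbTE->.
  have fi : injective f.
    move=> u v E; have := congr1 val E; rewrite /=.
    have [u3|u3] := boolP (u < 3); have [v3|v3] := boolP (v < 3).
    - rewrite !f3 // => /ord_inj/si/(congr1 val) /=; rewrite !inordK //; exact: ord_inj.
    - by rewrite f3 // (f3' v) // => E'; rewrite -E' ltn_ord in v3.
    - by rewrite (f3' u) // f3 // => E'; rewrite E' ltn_ord in u3.
    - by rewrite !f3' // => /ord_inj.
  have fiso : is_iso f by split=> [|u v]; [apply: injF_bij|rewrite /= (inj_eq fi)].
  have fx : f (@inord 3 3) = @inord 3 3 by rewrite f3' // inordK.
  have fnb (i : 'I_3) : f (@inord 3 i) = @inord 3 (s i).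
    have i4 : i < 4 by apply: leq_trans (ltn_ord i) _.
    by apply: ord_inj; rewrite f3 inordK // ?inord_val // ?inordK // (leq_trans (ltn_ord _)).
  have [g [gi _ gc]] := tri_unique prism_tri prism_tri fiso fx fnb.
  exists prism_l, g; split=> // [|i]; first exact: EP0.
  by rewrite /= !(addnC _ 3) gc.
have ok := ep_ok EP; have tri := ext_tri ok kw wl.
have [h' [tri1 _]] := tri_iso_at tri fi.
have ri : injective r := can_inj rK.
(* Numbering through the inverse [r] gives the new vertex [i] the label [s i]. *)
have tri2 := tri_perm tri1 ri; rewrite fl in tri2.
have nl j : j != s k -> ((f \o ext_nb k w) \o r) j = lab L1 j.
  move=> jk; rewrite /= /ext_nb; case: eqP => [E|_]; first by rewrite -E rK eqxx in jk.
  by rewrite fl rK.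
have [L2 EP2 [g [gi gl]]] := ep_extend EP1 tri2 nl.
exists L2, g; split=> //; first by rewrite map_rcons.
by move=> i; rewrite -gl /= sK.
Qed.

Lemma perm3_ex (a b c x y z : 'I_3) : a != b -> a != c -> b != c -> x != y -> x != z -> y != z ->
  exists s : 'I_3 -> 'I_3, [/\ injective s, s a = x, s b = y & s c = z].
Proof.
move=> ab ac bc xy xz yz.
have [ba ca cb] : [/\ b != a, c != a & c != b] by rewrite !(eq_sym b) !(eq_sym c).
pose s k := if k == a then x else if k == b then y else z.
have [sa sb sc] : [/\ s a = x, s b = y & s c = z].
  by rewrite /s !eqxx (negbTE ba) (negbTE ca) (negbTE cb).
exists s; split=> // i j.
case: (ord3_cases i ab ac bc) => ->; case: (ord3_cases j ab ac bc) => ->; rewrite ?sa ?sb ?sc //;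
  by move=> E; move: xy xz yz; rewrite ?E ?eqxx.
Qed.

(** * Transport along isomorphisms and the classification *)

Section IsoTransport.
Variables (G H : graph) (f : gV G -> gV H).
Hypothesis fi : is_iso f.

Lemma iso_simple : simple_graph H -> simple_graph G.
Proof.
by case: fi => _ fE [sy ir]; split=> [u v|u]; rewrite -!fE.
Qed.

Lemma iso_cubic : cubic H -> cubic G.
Proof.
case: fi => bf fE cH u; rewrite -(cH (f u)) -(card_image (bij_inj bf)).
case: bf => g fK gK; apply: eq_card => v; rewrite inE -[v]gK fE.
by rewrite mem_image ?inE //; apply: can_inj fK.
Qed.

Lemma iso_3ec : three_edge_connected H -> three_edge_connected G.
Proof.
case: fi => bf fE tH X X0 XT; have finj := bij_inj bf; case: bf => g fK gK.
have mf u : (f u \in f @: X) = (u \in X) by apply: mem_imset.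
have CX : f @: (~: X) = ~: (f @: X).
  by apply/setP => v; rewrite inE -[v]gK mf mem_imset // inE.
have -> : cut X (~: X) = cut (f @: X) (~: (f @: X)).
  rewrite -CX /cut big_imset /=; last by move=> ? ? _ _; apply: finj.
  apply: eq_bigr => u _; rewrite big_imset /=; last by move=> ? ? _ _; apply: finj.
  by apply: eq_bigr => v _; rewrite fE.
apply: tH; first by rewrite imset_eq0.
apply: contraNneq XT => E; apply/eqP/setP => u.
by rewrite -mf E !inE.
Qed.

Lemma iso_plonely u v : plonely u v -> plonely (f u) (f v).
Proof.
case: fi => [[g fK gK] fE].
have tr p : pmf p -> pmf [ffun a => f (p (g a))].
  move=> pp; apply/pmfP; split=> a; rewrite !ffunE; last by rewrite fK pmfK ?gK.
  by rewrite -{1}[a]gK fE pmf_edge.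
have tr' q : pmf q -> pmf [ffun a => g (q (f a))].
  move=> qq; apply/pmfP; split=> a; rewrite !ffunE; last by rewrite gK pmfK ?fK.
  by rewrite -fE gK pmf_edge.
case/plonelyP => p [pp pu up]; apply/plonelyP; exists [ffun a => f (p (g a))].
split; [exact: tr|by rewrite ffunE fK pu|move=> q qq qu].
have E : [ffun a => g (q (f a))] = p by apply: up; [apply: tr'|rewrite ffunE qu fK].
by apply/ffunP => a; rewrite ffunE -E ffunE !gK.
Qed.
End IsoTransport.

Lemma iso_lonely_count G H : simple_graph H -> iso G H -> lonely_count G = lonely_count H.
Proof.
move=> sH [f fi]; have sG := iso_simple fi sH; have := fi; case=> -[g fK gK] fE.
have gi : is_iso g.
  split; first by exists f.
  by move=> u v; rewrite -fE !gK.
apply: double_inj; rewrite (lonely_countE sG) (lonely_countE sH).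
rewrite -(card_imset _ (f := fun z => (f z.1, f z.2))); last first.
  by move=> [a b] [a' b'] /= [/(can_inj fK)-> /(can_inj fK)->].
apply: eq_card => -[a b]; rewrite inE /=; apply/imsetP/idP => [[[u v]]|lab].
  by rewrite inE /= => luv [-> ->]; apply: iso_plonely.
exists (g a, g b); rewrite ?inE /= ?gK //; exact: iso_plonely gi _ _ lab.
Qed.

Lemma in_Uk_intro k G H : iso G H -> simple_graph H -> cubic H -> three_edge_connected H ->
  0 < #|gV H| -> 0 < k -> lonely_count H = k -> in_Uk k G.
Proof.
move=> /[dup] iG [f fi] sH cH tH nH k0 lH.
have sG := iso_simple fi sH; have cG := iso_cubic fi cH; have tG := iso_3ec fi tH.
have lG := iso_lonely_count sH iG.
split; last by rewrite lG.
split=> //; last by rewrite lG lH.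
apply: three_edge_connected_vertex => //; apply: cubic_card => //.
by case/card_gt0P: nH => v _; case: fi => -[g _ _] _; apply/card_gt0P; exists (g v).
Qed.

Lemma K4_lonely_count : lonely_count K4 = 6.
Proof.
apply: double_inj.
by rewrite (@lonely_count_table 3 _ (fun i j => i != j) K4_simple) //; vm_compute.
Qed.

(** Two replacements lead from the prism to the tricorn, so these properties are inherited and only
    the lonely edges have to be computed. *)
Lemma tricorn_from_prism : simple_graph tricorn /\ cubic tricorn /\ three_edge_connected tricorn.
Proof.
pose o0 : 'I_3 := ord0; pose o1 : 'I_3 := Ordinal (isT : 1 < 3).
have [nb [c [tri _ _]]] := ext1_lab o0.
have [nb2 [h2 [c2 tri2]]] := @ext1_tricorn o0 o1 isT.
have sP := prism_simple; have okP := prism_ok.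
have sE := tri_simple tri sP; have cE := proj1 (tri_cubic tri sP) (lok_cubic okP).
have tE := tri_3ec_up tri sP (lok_cubic okP) (lok_3ec okP).
split; first exact: tri_simple tri2 sE.
split; first exact: proj1 (tri_cubic tri2 sE) cE.
exact: tri_3ec_up tri2 sE cE tE.
Qed.

Lemma tricorn_lonely_count : lonely_count tricorn = 3.
Proof.
apply: double_inj; have [sT _] := tricorn_from_prism.
by rewrite (@lonely_count_table 9 _ (sym_list tricorn_edges) sT) //; vm_compute.
Qed.

Lemma idx_neq : [/\ idx 3 != idx 2, idx 3 != idx 1 & idx 2 != idx 1].
Proof. by rewrite -!val_eqE /= !inordK. Qed.

Lemma map_idx_pattern k h :
  map idx (nseq h.-1 3 ++ 2 :: nseq (k - h) 1) = block_word (idx 3) (idx 2) (idx 1) h.-1 (k - h).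
Proof. by rewrite map_cat /= !map_nseq. Qed.

Lemma ep_in_U3 p L G : is_ext_prism p L -> iso G (lgr L) -> \sum_k word_val p k = 3 -> in_Uk 3 G.
Proof.
move=> EP iG E; have [sL cL tL _] := ep_ok EP.
apply: (in_Uk_intro iG sL cL tL) => //; last by rewrite (ep_lonely_count EP).
by apply/card_gt0P; exists (lab L ord0).
Qed.

Lemma ep_permute_iso (s : 'I_3 -> 'I_3) p L (q : seq nat) G : injective s -> is_ext_prism p L ->
  iso G (lgr L) -> map s p = map idx q -> ext_prism_iso q G.
Proof.
move=> si EP iG Eq; have [L' [f [EP' fi _]]] := ep_permute si EP.
by exists L'; rewrite -Eq; split=> //; apply: iso_trans iG _; exists f.
Qed.

Theorem mainTheorem13 (G : graph) :
  in_Uk 3 G <->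
  in_W3 G \/
  exists k h, [/\ 3 <= k, 1 <= h, h <= k &
    ext_prism_iso (nseq h.-1 3 ++ 2 :: nseq (k - h) 1) G].
Proof.
have [n32 n31 n21] := idx_neq.
split.
- move=> UG; case: (UG) => UG' lG; case: (in_U_K4_tree UG') => [iG|[p [L [EP iG]]]|[iG|dG]].
  + by move: lG; rewrite (iso_lonely_count K4_simple iG) K4_lonely_count.
  + have := iso_lonely_count (lok_simple (ep_ok EP)) iG.
    rewrite lG (ep_lonely_count EP) => /esym/word_sum3.
    case=> [[a [b [c [i [j [ab ac bc ij Ep]]]]]]|[a [b [ab Ep]]]].
      have [s [si sa sb sc]] := perm3_ex ab ac bc n32 n31 n21.
      (* With these values h - 1 = [i] and k - h = [j], and [1 < i + j] becomes k >= 3. *)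
      right; exists (i + j).+1, i.+1; split; rewrite ?ltnS ?leq_addr //.
      apply: (ep_permute_iso si EP iG).
      rewrite map_idx_pattern Ep map_cat /= !map_nseq sa sb sc.
      by rewrite subSS addKn.
    case/andP: (thirdP ab); rewrite ![third a b == _]eq_sym => ac bc.
    have n12 : idx 1 != idx 2 by rewrite eq_sym.
    have [s [si sa sb _]] := perm3_ex ab ac bc n31 n32 n12.
    left; right; right; apply: (ep_permute_iso si EP iG).
    by rewrite Ep /= sa sb.
  + by left; left.
  + by left; right; left.
case=> [[iG|[[_ UG]|[L [EP iG]]]]|[k [h [k3 h1 hk [L [EP iG]]]]]].
- have [sT [cT tT]] := tricorn_from_prism.
  apply: (in_Uk_intro iG sT cT tT) => //.
    by rewrite card_ord.
  exact: tricorn_lonely_count.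
- exact: UG.
- by apply: (ep_in_U3 EP iG); apply: word_sum_aba.
apply: (ep_in_U3 EP iG); rewrite map_idx_pattern word_sum_block //.
by rewrite (_ : 2 - _ = 0) //; lia.
Qed.
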